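(* Let $\mu$ be a Radon measure on $\mathbb{R}^d$ and $s\ge 0$ be such that $0<\Theta^{*s}(\mu,x)<\infty$ for $\mu$-a.e. $x\in\mathbb{R}^d$. Suppose that $\mu$ admits $(p,q)$ Fourier restriction at the endpoint $q=\frac{s}{d}p'$, for some $p>1$. Then either $q=p'$ and $\mu$ is absolutely continuous with respect to the Lebesgue measure $\mathcal{L}^d$, or $\mu$ is supported on a $1$-purely unrectifiable set.
   Context: The Fourier transform of $f\in\mathcal{S}(\mathbb{R}^d)$ (Schwartz space) is $\hat f(\xi)=\int e^{-2\pi i \xi\cdot x}f(x)\,dx$. A measure $\mu$ on $\mathbb{R}^d$ admits $(p,q)$ restriction, written $R_\mu(p\to q)$, if there is a constant $C$ such that $\|\hat f\|_{L^q(\mu)}\le C\|f\|_{L^p(\mathbb{R}^d)}$ for every $f\in\mathcal{S}(\mathbb{R}^d)$. Here $p'$ denotes the conjugate exponent of $p$, $1/p+1/p'=1$. The upper $s$-dimensional density is $\Theta^{*s}(\mu,x)=\limsup_{r\to 0}\frac{\mu(B(x,r))}{\omega_s r^s}$ (with $\omega_s$ the usual normalizing constant). A set $E\subset\mathbb{R}^d$ is $1$-purely unrectifiable if $\mathcal{H}^1(E\cap\phi(\mathbb{R}))=0$ for every Lipschitz map $\phi:\mathbb{R}\to\mathbb{R}^d$, where $\mathcal{H}^1$ is the $1$-dimensional Hausdorff measure; ''$\mu$ is supported on $E$'' means $\mu(\mathbb{R}^d\setminus E)=0$. *)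

(* Defs.v *)
(* R^d is modelled as [d.-tuple R]
   equipped with the library's product sigma-algebra (generated by the
   coordinate projections; this is the Borel sigma-algebra of R^d). *)
From HB Require Import structures.
From mathcomp Require Import all_boot all_order all_algebra.
From mathcomp Require Import all_classical all_reals all_analysis.
From mathcomp Require Import complex.

Set Implicit Arguments.
Unset Strict Implicit.
Unset Printing Implicit Defensive.

Import Order.TTheory GRing.Theory Num.Theory.
Local Open Scope classical_set_scope.
Local Open Scope ring_scope.

Section Defs.
Variable R : realType.

Definition dotp d (x y : d.-tuple R) : R := \sum_(i < d) tnth x i * tnth y i.

Definition edist d (x y : d.-tuple R) : R :=
  Num.sqrt (\sum_(i < d) (tnth x i - tnth y i) ^+ 2).

Definition cball d (x : d.-tuple R) (r : R) : set (d.-tuple R) :=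
  [set y | edist x y <= r].

Definition shift d (x : d.-tuple R) (i : 'I_d) (t : R) : d.-tuple R :=
  [tuple (if j == i then tnth x j + t else tnth x j) | j < d].

(** ** Lebesgue integral on R^d (iterated one-dimensional Lebesgue
    integrals; by Tonelli this is the integral w.r.t. L^d for nonnegative
    measurable integrands) *)
Fixpoint lebint (n : nat) : (n.-tuple R -> \bar R) -> \bar R :=
  match n with
  | 0 => fun f => f [tuple]
  | n'.+1 => fun f =>
      (\int[@lebesgue_measure R]_x lebint (fun t : n'.-tuple R =>
          f [tuple of x :: t]))%E
  end.

Definition lebd d (A : set (d.-tuple R)) : \bar R :=
  lebint (fun x => (\1_A x)%:E).

Definition lebintR d (f : d.-tuple R -> R) : R :=
  fine (lebint (fun x => (Num.max (f x) 0)%:E)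
        - lebint (fun x => (Num.max (- f x) 0)%:E))%E.

Definition pderiv d (i : 'I_d) (g : d.-tuple R -> R) : d.-tuple R -> R :=
  fun x => derive1 (fun t => g (shift x i t)) 0.

Fixpoint pderivs d (l : seq 'I_d) (g : d.-tuple R -> R) : d.-tuple R -> R :=
  match l with
  | [::] => g
  | i :: l' => pderiv i (pderivs l' g)
  end.

(* monomial x^alpha, alpha given as a list of coordinates (with repetition) *)
Definition monom d (a : seq 'I_d) (x : d.-tuple R) : R :=
  \prod_(i <- a) tnth x i.

Definition schwartzR d (g : d.-tuple R -> R) : Prop :=
  (forall (l : seq 'I_d) (i : 'I_d) (x : d.-tuple R),
      derivable (fun t => pderivs l g (shift x i t)) 0 1) /\
  (forall (a b : seq 'I_d), exists M : R, forall x : d.-tuple R,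
      `|monom a x * pderivs b g x| <= M).

Definition schwartz d (f : d.-tuple R -> R[i]) : Prop :=
  schwartzR (fun x => complex.Re (f x)) /\ schwartzR (fun x => complex.Im (f x)).

Definition cexpi (t : R) : R[i] := (cos t +i* sin t)%C.

Definition fourier d (f : d.-tuple R -> R[i]) (xi : d.-tuple R) : R[i] :=
  let g := fun x => cexpi (- (2 * pi * dotp xi x)) * f x in
  (lebintR (fun x => complex.Re (g x)) +i* lebintR (fun x => complex.Im (g x)))%C.

Definition cmod (z : R[i]) : R :=
  Num.sqrt (complex.Re z ^+ 2 + complex.Im z ^+ 2).

Definition LpnormRd d (p : R) (f : d.-tuple R -> R[i]) : \bar R :=
  poweR (lebint (fun x => (cmod (f x) `^ p)%:E)) p^-1.

Definition restriction d (mu : {measure set (d.-tuple R) -> \bar R})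
  (p q : R) : Prop :=
  exists C : R, forall f : d.-tuple R -> R[i], schwartz f ->
    (Lnorm mu q%:E (fun xi => (cmod (fourier f xi))%:E)
       <= C%:E * LpnormRd p f)%E.

(** ** Radon measures on R^d: locally finite Borel measures *)
Definition locally_finite d (mu : {measure set (d.-tuple R) -> \bar R}) :=
  forall (x : d.-tuple R) (r : R), (mu (cball x r) < +oo)%E.

Definition Gamma (z : R) : R :=
  fine (\int[@lebesgue_measure R]_(t in `]0%R, +oo[) ((t `^ (z - 1)) * expR (- t))%:E)%E.

Definition omega (s : R) : R := (pi `^ (s / 2)) / Gamma (s / 2 + 1).

Definition upper_density d (mu : {measure set (d.-tuple R) -> \bar R})
  (s : R) (x : d.-tuple R) : \bar R :=
  ereal_inf [set ereal_sup [set (mu (cball x r) * ((omega s * r `^ s)^-1)%:E)%E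
                              | r in `]0, delta[] | delta in `]0%R, +oo[].

Definition diam d (E : set (d.-tuple R)) : \bar R :=
  ereal_sup ([set 0%E] `|` [set (edist x y)%:E | x in E & y in E]).

Definition H1_delta d (delta : R) (E : set (d.-tuple R)) : \bar R :=
  ereal_inf [set (\sum_(0 <= k <oo) diam (F k))%E | F in
     [set F : nat -> set (d.-tuple R) |
        E `<=` \bigcup_k F k /\ forall k, (diam (F k) <= delta%:E)%E]].

Definition H1 d (E : set (d.-tuple R)) : \bar R :=
  ereal_sup [set H1_delta delta E | delta in `]0%R, +oo[].

Definition lipschitz_map d (phi : R -> d.-tuple R) : Prop :=
  exists L : R, forall s t : R, edist (phi s) (phi t) <= L * `|s - t|.

Definition purely_unrectifiable1 d (E : set (d.-tuple R)) : Prop :=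
  forall phi : R -> d.-tuple R, lipschitz_map phi ->
    H1 (E `&` range phi) = 0%E.

Definition abs_cont_leb d (mu : {measure set (d.-tuple R) -> \bar R}) : Prop :=
  forall A : set (d.-tuple R), measurable A -> lebd A = 0%E -> mu A = 0%E.

End Defs.

(* Main.v *)
Require Import Defs.
From HB Require Import structures.
From mathcomp Require Import all_boot all_order all_algebra.
From mathcomp Require Import all_classical all_reals all_analysis.
From mathcomp Require Import complex.
From mathcomp Require Import measurable_realfun ring lra.
Import Order.TTheory GRing.Theory Num.Theory.
Import numFieldNormedType.Exports.
Set Implicit Arguments.
Unset Strict Implicit.
Unset Printing Implicit Defensive.
Local Open Scope classical_set_scope.
Local Open Scope ring_scope.

(** A modulated Gaussian adapted to a box has a Fourier transform that is
    bounded below on the dual box, so restriction at the endpoint bounds the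
    mass of every box, of any orientation, by a constant times the power
    [s / d] of its volume; in particular [mu (cube x r) <= C r^s].

    If [s >= d], a Vitali covering argument gives [mu = 0] when [s > d] and
    [mu <= C L^d], whence absolute continuity, when [s = d].

    If [s < d], fix a direction [e].  A long thin tube of dimensions
    [L r, r, .., r] has mass at most [C L^(s/d) r^s], which for [L] large is
    negligible compared with [L r^s].  Hence around almost every point one can
    build, from disjoint bumps at small scales, functions [phi] that are
    uniformly small, uniformly Lipschitz, and whose derivative along all
    directions in a fixed thin cone around [e] is bounded below by a continuous
    [f] with [f >= kappa] on average.  A Frank-Wolfe (convexity) argument makes
    [f >= kappa] on most of the space, so almost every point lies in a set where
    a whole sequence of such functions, tending to [0], grows at a definite rate
    in the direction [e].  A Lipschitz curve spends no time in that set while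
    moving in the direction [e], since [phi] along the curve would otherwise
    have a large increment.  Intersecting over a countable dense set of
    directions, a Lipschitz curve meets the resulting full-measure set only at
    parameters where its velocity is undefined or zero, up to a null set, and
    the image of these parameters has zero length. *)

(** * Lebesgue integral of Gaussians on R^d *)

(** The endpoint makes the Gaussian test scale invariant: for a matrix of determinant [D] the
    transform has size [1 / D] on the dual box and the [L^p] norm has size [D^(-1/p)], so the box
    has mass at most a constant times [D^(q (1 - 1/p))], and [q (1 - 1/p) = s / d].

    The bumps exploit the tube bound by rising over a short thick core and falling along a tube [L]
    times longer, where the loss is weighed by little mass. They are adapted to one Lipschitz weight
    [g] at a time, nearly constant on each bump: they make the integral of [f g] large, with [f]
    depending on [g]. To obtain one [f] that is large almost everywhere is a minimax problem; hence
    the class of admissible [f] records only bounds on [phi], which makes it convex, and the weight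
    is taken to be the current defect.

    One null set has to serve all Lipschitz curves. The aperture [alpha] of the cone is therefore
    fixed before the direction, so that countably many rational directions suffice. *)

Lemma lebint_gauss1 (R : realType) (b c : R) : b != 0 ->
  (\int[@lebesgue_measure R]_x (expR (- (c + b * x) ^+ 2))%:E)%E
  = (Num.sqrt pi / `|b|)%:E.
Proof.
move=> b0; pose sg := (`|b| * Num.sqrt 2)^-1.
have s20 : Num.sqrt 2 != 0 :> R by rewrite sqrtr_eq0 -ltNge.
have nb0 : `|b| != 0 by rewrite normr_eq0.
have sg0 : sg != 0 by rewrite invr_eq0 mulf_neq0.
have spi : 0 < Num.sqrt pi :> R by rewrite sqrtr_gt0 pi_gt0.
have sgE : sg ^+ 2 *+ 2 = (b ^+ 2)^-1.
  rewrite /sg exprVn exprMn sqr_sqrtr// real_normK ?num_real//.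
  by rewrite -mulr_natr; field.
have pkE : normal_peak sg = `|b| / Num.sqrt pi.
  rewrite /normal_peak -mulrnAl -[RHS]invf_div; congr (_^-1).
  by rewrite mulrnAl -mulrnAr mulrnAr -mulrnAl sgE sqrtrM ?invr_ge0 ?sqr_ge0//
    sqrtrV ?sqr_ge0// sqrtr_sqr mulrC.
(* The integrand is a multiple of the normal density with mean [- c / b] and deviation [sg]. *)
under eq_integral => x _.
  rewrite (_ : expR _ = (normal_peak sg)^-1 * normal_pdf (- c / b) sg x); last first.
    rewrite normal_pdfE// mulKf ?gt_eqF ?normal_peak_gt0//.
    rewrite /normal_fun sgE invrK mulNr; congr expR; congr (- _).
    by rewrite -exprMn; congr (_ ^+ 2); field.
  rewrite EFinM.
  over.
rewrite /= integralZl//; last exact: integrable_normal_pdf.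
by rewrite integral_normal_pdf mule1 pkE invf_div.
Qed.

Section sigma_finite_upgrade.
Context d (T : measurableType d) (R : realType).
Variable m : {measure set T -> \bar R}.
Hypothesis sf : sigma_finite setT m.

Let m' : set T -> \bar R := m.
HB.instance Definition _ := Measure.on m'.
HB.instance Definition _ := @Measure_isSigmaFinite.Build d T R m' sf.

Lemma sigma_finite_measure_exists :
  exists M : {sigma_finite_measure set T -> \bar R}, forall A, M A = m A.
Proof. by exists m'. Qed.

End sigma_finite_upgrade.

Section lebint_theory.
Local Open Scope ereal_scope.
Context {R : realType}.

Definition box n (k : R) : set (n.-tuple R) :=
  [set x | forall i, `|tnth x i| <= k]%R.
Arguments box : clear implicits.

Lemma measurable_box n (k : R) : measurable (box n k).
Proof.
rewrite /box (_ : [set _ | _] = \bigcap_(i in [set: 'I_n])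
    ((tnth (T:=R))^~ i) @^-1` `[(-k)%R, k]%classic).
  apply: fin_bigcap_measurable => // i _; rewrite -[X in measurable X]setTI.
  exact: measurable_tnth.
apply/seteqP; split => x /=.
  by move=> H i _; rewrite /= in_itv/= -ler_norml.
by move=> H i; have := H i I; rewrite /= in_itv/= -ler_norml.
Qed.

Lemma box_cover n : \bigcup_k box n k%:R = [set: n.-tuple R].
Proof.
apply/seteqP; split => // x _.
pose M := (\sum_(i < n) `|tnth x i|)%R.
exists (Num.truncn M).+1 => // i /=.
apply: (@le_trans _ _ M); last exact: ltW (truncnS_gt _).
by rewrite /M (bigD1 i)//= lerDl sumr_ge0.
Qed.

Lemma sigma_finite_box n (m : {measure set (n.-tuple R) -> \bar R}) :
  (forall k : R, m (box n k) < +oo) -> sigma_finite setT m.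
Proof.
move=> mk; exists (fun k => box n k%:R); first by rewrite box_cover.
by move=> k; split => //; exact: measurable_box.
Qed.

(** Turns the iterated integral into integration against a measure, which gives access to linearity,
    monotonicity and additivity. The measure is the push-forward under [cons] of the product of
    Lebesgue measure with the previous one; finiteness on boxes keeps it sigma-finite, as Tonelli
    requires. *)
Lemma lebint_integral n :
  exists m : {sigma_finite_measure set (n.-tuple R) -> \bar R},
  (forall k, m (box n k) < +oo) /\
  forall f : n.-tuple R -> \bar R, measurable_fun [set: n.-tuple R] f ->
    (forall x, 0 <= f x) -> lebint f = \int[m]_x f x.
Proof.
suff [m [m1 m2]] : exists m : {measure set (n.-tuple R) -> \bar R},
  (forall k, m (box n k) < +oo) /\
  forall f : n.-tuple R -> \bar R, measurable_fun [set: n.-tuple R] f ->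
    (forall x, 0 <= f x) -> lebint f = \int[m]_x f x.
  have [M ME] := sigma_finite_measure_exists (sigma_finite_box m1).
  exists M; split=> [k|f mf f0]; first by rewrite ME.
  by rewrite m2//; apply: eq_measure_integral => A mA _; rewrite ME.
elim: n => [|n [m' [m1' IH']]].
  exists (@dirac _ _ [tuple] R); split.
    by move=> k; rewrite /= diracE; case: (_ \in _); rewrite ltry.
  move=> f mf f0 /=.
  by rewrite integral_dirac// diracT mul1e.
have [m mE] := sigma_finite_measure_exists (sigma_finite_box m1').
have m1 k : m (box n k) < +oo by rewrite mE.
have IH f : measurable_fun [set: n.-tuple R] f ->
    (forall x, 0 <= f x) -> lebint f = \int[m]_x f x.
  move=> mf f0; rewrite IH'//.
  by apply: eq_measure_integral => A mA _; rewrite mE.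
pose c := fun x : R * n.-tuple R => [tuple of x.1 :: x.2] : n.+1.-tuple R.
have mc : measurable_fun setT c by apply: measurable_cons.
have [M0 M0E] : exists M0 : {measure set (n.+1.-tuple R) -> \bar R},
    M0 = pushforward (@lebesgue_measure R \x m) c :> (set _ -> \bar R).
  by unshelve eexists; first unshelve refine (pushforward (@lebesgue_measure R \x m) c).
exists M0; split.
  move=> k; rewrite M0E /pushforward.
  rewrite (_ : _ @^-1` _ = `[(-k)%R, k]%classic `*` box n k).
    rewrite product_measure1E//; last exact: measurable_box.
    rewrite lte_mul_pinfty//.
      by rewrite ge0_fin_numE//= lebesgue_measure_itv; case: ifP => _; rewrite ltry.
  apply/seteqP; split => -[x t] /=.
    move=> H; split; first by have := H ord0; rewrite in_itv/= -ler_norml.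
    by move=> i; have := H (lift ord0 i); rewrite tnthS.
  rewrite in_itv/= -ler_norml => -[H1 H2] i.
  by case: (unliftP ord0 i) => [j|] ->; rewrite ?tnthS.
move=> f mf f0 /=.
rewrite M0E ge0_integral_pushforward//.
rewrite preimage_setT fubini_tonelli1 /=; last 2 first.
- exact: measurableT_comp.
- by move=> x; exact: f0.
  exact: sigma_finiteT.
move=> _; apply: eq_integral => x _; rewrite /fubini_F IH//.
apply: (measurableT_comp mf).
exact: measurable_cons.
Qed.

Lemma lebintZ n (k : R) (f : n.-tuple R -> \bar R) : (0 <= k)%R ->
  measurable_fun [set: n.-tuple R] f -> (forall x, 0 <= f x) ->
  lebint (fun x => k%:E * f x) = k%:E * lebint f.
Proof.
move=> k0 mf f0; have [m [_ mE]] := lebint_integral n.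
rewrite !mE//; first by rewrite ge0_integralZl.
- by apply: measurable_funeM.
- by move=> x; rewrite mule_ge0.
Qed.

Lemma lebintD n (f g : n.-tuple R -> \bar R) :
  measurable_fun [set: n.-tuple R] f -> (forall x, 0 <= f x) ->
  measurable_fun [set: n.-tuple R] g -> (forall x, 0 <= g x) ->
  lebint (fun x => f x + g x) = lebint f + lebint g.
Proof.
move=> mf f0 mg g0; have [m [_ mE]] := lebint_integral n.
rewrite !mE//; first by rewrite ge0_integralD.
- exact: emeasurable_funD.
- by move=> x; rewrite adde_ge0.
Qed.

Lemma le_lebint n (f g : n.-tuple R -> \bar R) :
  measurable_fun [set: n.-tuple R] f -> (forall x, 0 <= f x) ->
  measurable_fun [set: n.-tuple R] g -> (forall x, f x <= g x) ->
  lebint f <= lebint g.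
Proof.
move=> mf f0 mg fg; have [m [_ mE]] := lebint_integral n.
rewrite !mE//; first exact: ge0_le_integral.
by move=> x; exact: le_trans (fg x).
Qed.

Local Open Scope ring_scope.

Lemma measurable_gauss n (A : 'M[R]_n) (c : 'I_n -> R) :
  measurable_fun [set: n.-tuple R] (fun x =>
    expR (- \sum_i (c i + \sum_j A i j * tnth x j) ^+ 2)).
Proof.
apply: measurableT_comp => //; apply: measurableT_comp => //.
apply: measurable_sum => i; apply: measurable_funX; apply: measurable_funD => //.
apply: measurable_sum => j; apply: measurable_funM => //.
exact: measurable_tnth.
Qed.

(** The matrix is lower triangular: once the first coordinate [x] is fixed, the remaining rows form
    a Gaussian of the same kind with shift [c' x], and its integral does not depend on the shift. *)
Lemma lebint_gauss n (A : 'M[R]_n) (c : 'I_n -> R) :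
  (forall i j : 'I_n, (i < j)%N -> A i j = 0) -> (forall i, A i i != 0) ->
  lebint (fun x => (expR (- \sum_i (c i + \sum_j A i j * tnth x j) ^+ 2))%:E)
  = (\prod_i (Num.sqrt pi / `|A i i|))%:E.
Proof.
elim: n A c => [|n IH] A c A0 A1; first by rewrite /= !big_ord0 oppr0 expR0.
pose A' : 'M[R]_n := \matrix_(i, j) A (lift ord0 i) (lift ord0 j).
pose c' x := fun i => c (lift ord0 i) + A (lift ord0 i) ord0 * x.
rewrite /= [in RHS]big_ord_recl mulrC EFinM -(lebint_gauss1 (c ord0))//.
rewrite -ge0_integralZl//; last 2 first.
- apply/measurable_EFinP; apply: measurableT_comp => //; apply: measurableT_comp => //.
  by apply: measurable_funX; apply: measurable_funD => //; exact: measurable_funM.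
- by rewrite lee_fin prodr_ge0// => i _; rewrite divr_ge0// sqrtr_ge0.
apply: eq_integral => x _.
rewrite (_ : \prod_(i < n) _ = \prod_i (Num.sqrt pi / `|A' i i|)); last first.
  by apply: eq_bigr => i _; rewrite mxE.
rewrite muleC -(IH A' (c' x)) -?lebintZ ?expR_ge0//; last first.
- by move=> i; rewrite mxE.
- by move=> i j ij; rewrite mxE A0//= /bump/= !add1n ltnS.
- by apply/measurable_EFinP; exact: measurable_gauss.
congr lebint; apply/funext => t; rewrite -EFinM -expRD -opprD; congr (expR (- _))%:E.
rewrite big_ord_recl; congr (_ + _).
  rewrite big_ord_recl tnth0 big1 ?addr0 1?addrC// => j _.
  by rewrite A0 ?mul0r.
apply: eq_bigr => i _; rewrite big_ord_recl tnth0 addrA; congr ((_ + _) ^+ 2).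
by apply: eq_bigr => j _; rewrite tnthS mxE.
Qed.

End lebint_theory.
Arguments box {R} n k.

(** * Schwartz functions and wave packets *)

Lemma is_derive_affine (R : realType) (a b t : R) :
  is_derive t 1 (fun t => a + b * t) b.
Proof.
by apply: is_derive_eq; rewrite add0r mul1r /GRing.scale/= mulr1.
Qed.

Section trigpoly.
Context {R : realType} {d : nat}.
Implicit Types (f g : d.-tuple R -> R) (x w : d.-tuple R).

(** A class that contains the phases and quadratic forms in use, is stable under partial derivatives
    and grows polynomially. Every derivative of [f * exp(-Q)] then keeps this form, which is what
    the Schwartz bounds require. *)
Inductive trigpoly : (d.-tuple R -> R) -> Prop :=
| trigpoly_cst c : trigpoly (fun=> c)
| trigpoly_coord i : trigpoly (fun x => tnth x i)
| trigpolyD f g : trigpoly f -> trigpoly g -> trigpoly (fun x => f x + g x)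
| trigpolyM f g : trigpoly f -> trigpoly g -> trigpoly (fun x => f x * g x)
| trigpoly_cos w : trigpoly (fun x => cos (dotp w x))
| trigpoly_sin w : trigpoly (fun x => sin (dotp w x)).

Lemma trigpoly_sum (I : Type) (s : seq I) (F : I -> d.-tuple R -> R) :
  (forall i, trigpoly (F i)) -> trigpoly (fun x => \sum_(i <- s) F i x).
Proof.
move=> HF; elim: s => [|i s IH].
  by under eq_fun do rewrite big_nil; exact: trigpoly_cst.
by under eq_fun do rewrite big_cons; exact: trigpolyD.
Qed.

Lemma tnth_shift x i t j : tnth (Defs.shift x i t) j = tnth x j + t *+ (j == i).
Proof. by rewrite tnth_mktuple; case: eqP; rewrite ?addr0. Qed.

Lemma shift0 x i : Defs.shift x i 0 = x.
Proof. by apply: eq_from_tnth => j; rewrite tnth_shift mul0rn addr0. Qed.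

Lemma dotp_shift w x i t : dotp w (Defs.shift x i t) = dotp w x + tnth w i * t.
Proof.
rewrite /dotp; under eq_bigr do rewrite tnth_shift mulrDr.
rewrite big_split/=; congr (_ + _); rewrite (bigD1 i)//= eqxx big1 ?addr0//.
by move=> j /negbTE->; rewrite mulr0.
Qed.

Lemma trigpoly_derive f : trigpoly f -> forall i, exists2 f', trigpoly f' &
  forall x, is_derive (0 : R) 1 (fun t => f (Defs.shift x i t)) (f' x).
Proof.
elim=> {f} [c|j|f g _ IHf _ IHg|f g tf IHf tg IHg|w|w] i.
- by exists (fun=> 0); [exact: trigpoly_cst|move=> x; exact: is_derive_cst].
- exists (fun=> (j == i)%:R); first exact: trigpoly_cst.
  move=> x; under eq_fun do rewrite tnth_shift -mulr_natr.
  by under eq_fun do rewrite mulrC; exact: is_derive_affine.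
- have [f' tf' df] := IHf i; have [g' tg' dg] := IHg i.
  by exists (fun x => f' x + g' x); [exact: trigpolyD|move=> x; exact: is_deriveD].
- have [f' tf' df] := IHf i; have [g' tg' dg] := IHg i.
  exists (fun x => f x * g' x + g x * f' x).
    by apply: trigpolyD; exact: trigpolyM.
  move=> x; have := df x; have := dg x => dgx dfx.
  by apply: is_derive_eq; rewrite !shift0.
- exists (fun x => - tnth w i * sin (dotp w x)).
    by apply: trigpolyM; [exact: trigpoly_cst|exact: trigpoly_sin].
  move=> x; under eq_fun do rewrite dotp_shift.
  have := is_derive_affine (dotp w x) (tnth w i) 0 => du.
  have := @is_derive1_comp R cos _ 0 _ _ (is_derive_cos _) du.
  by rewrite mulr0 addr0 mulNr -mulrN mulrC.
- exists (fun x => tnth w i * cos (dotp w x)).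
    by apply: trigpolyM; [exact: trigpoly_cst|exact: trigpoly_cos].
  move=> x; under eq_fun do rewrite dotp_shift.
  have := is_derive_affine (dotp w x) (tnth w i) 0 => du.
  have := @is_derive1_comp R sin _ 0 _ _ (is_derive_sin _) du.
  by rewrite mulr0 addr0 mulrC.
Qed.

Lemma trigpoly_bound f : trigpoly f -> exists (C : R) (N : nat), 0 <= C /\
  forall x, `|f x| <= C * (1 + \sum_i tnth x i ^+ 2) ^+ N.
Proof.
have S1 x : 1 <= 1 + \sum_i tnth x i ^+ 2.
  by rewrite lerDl sumr_ge0// => i _; exact: sqr_ge0.
have S0 x : 0 <= 1 + \sum_i tnth x i ^+ 2 := le_trans ler01 (S1 x).
elim=> {f} [c|j|f g _ [C [N [C0 Hf]]] _ [D [M [D0 Hg]]]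
           |f g _ [C [N [C0 Hf]]] _ [D [M [D0 Hg]]]|w|w].
- by exists `|c|, 0%N; split=> // x; rewrite expr0 mulr1.
- exists 1, 1%N; split=> // x; rewrite mul1r expr1.
  apply: (@le_trans _ _ (1 + tnth x j ^+ 2)).
    rewrite -real_normK ?num_real//.
    by have := normr_ge0 (tnth x j); set a := `|_|; nra.
  by rewrite lerD2l (bigD1 j)//= lerDl sumr_ge0// => i _; exact: sqr_ge0.
- exists (C + D), (N + M)%N; split=> [|x]; first exact: addr_ge0.
  rewrite (le_trans (ler_normD _ _))// mulrDl lerD//.
    by rewrite (le_trans (Hf x))// ler_wpM2l// ler_weXn2l// leq_addr.
  by rewrite (le_trans (Hg x))// ler_wpM2l// ler_weXn2l// leq_addl.
- exists (C * D), (N + M)%N; split=> [|x]; first exact: mulr_ge0.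
  by rewrite normrM exprD mulrACA ler_pM.
- exists 1, 0%N; split=> // x; rewrite expr0 mulr1 ler_norml.
  by rewrite cos_geN1 cos_le1.
- exists 1, 0%N; split=> // x; rewrite expr0 mulr1 ler_norml.
  by rewrite sin_geN1 sin_le1.
Qed.

(** Comes from [1 + u <= expR u] at [u = eta * z / N.+1%:R], raised to the power [N]; dividing by
    [N.+1] instead of [N] includes the case [N = 0]. *)
Lemma poly_expR_bound (eta : R) N : 0 < eta -> exists C : R,
  forall z, 0 <= z -> (1 + z) ^+ N * expR (- (eta * z)) <= C.
Proof.
move=> eta0; pose K := Num.max 1 (N.+1%:R / eta).
exists (K ^+ N) => z z0.
have K1 : 1 <= K by rewrite /K le_max lexx.
have e1 : 1 + z <= K * expR (eta * z / N.+1%:R).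
  apply: (@le_trans _ _ (K * (1 + eta * z / N.+1%:R))); last first.
    by rewrite ler_wpM2l ?expR_ge1Dx// (le_trans ler01).
  rewrite mulrDr mulr1 lerD// mulrC -!mulrA mulrCA.
  rewrite ler_peMr// mulrA.
  have : N.+1%:R / eta <= K by rewrite /K le_max lexx orbT.
  rewrite ler_pdivrMr// => H.
  by rewrite mulrAC ler_pdivlMr ?ltr0n// mul1r mulrC.
have e2 : (1 + z) ^+ N <= K ^+ N * expR (eta * z).
  apply: (@le_trans _ _ ((K * expR (eta * z / N.+1%:R)) ^+ N)).
    by apply: lerXn2r => //; rewrite nnegrE ?mulr_ge0 ?addr_ge0 ?expR_ge0// (le_trans ler01).
  rewrite exprMn ler_wpM2l ?exprn_ge0 ?(le_trans ler01)//.
  rewrite -expRM_natl ler_expR mulrCA ler_piMr ?mulr_ge0 ?(ltW eta0)//.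
  by rewrite ler_pdivrMr// mul1r ler_nat.
rewrite (le_trans (ler_wpM2r (expR_ge0 _) e2))//.
by rewrite -mulrA -expRD subrr expR0 mulr1.
Qed.

Lemma schwartzR_gauss f (Q : d.-tuple R -> R) (eta : R) :
  trigpoly f -> trigpoly Q -> 0 < eta ->
  (forall x, eta * \sum_i tnth x i ^+ 2 <= Q x) ->
  schwartzR (fun x => f x * expR (- Q x)).
Proof.
move=> tf tQ eta0 HQ.
have step c i : trigpoly c -> exists2 c', trigpoly c' & forall x,
    is_derive (0 : R) 1 (fun t => c (Defs.shift x i t) * expR (- Q (Defs.shift x i t)))
      (c' x * expR (- Q x)).
  move=> tc; have [c' tc' dc] := trigpoly_derive tc i.
  have [Q' tQ' dQ] := trigpoly_derive tQ i.
  exists (fun x => c' x + c x * (-1 * Q' x)).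
    apply: trigpolyD => //; apply: trigpolyM => //; apply: trigpolyM => //.
    exact: trigpoly_cst.
  move=> x; have dNQ := is_deriveN (dQ x).
  have := @is_derive1_comp R expR _ 0 _ _ (is_derive_expR _) dNQ => dE.
  have H := is_deriveM (dc x) dE.
  rewrite [X in is_derive _ _ _ X](_ : _ = c (Defs.shift x i 0) *:
    (expR (- Q (Defs.shift x i 0)) * - Q' x) + expR (- Q (Defs.shift x i 0)) *: c' x).
    exact: H.
  by rewrite /GRing.scale/= shift0; ring.
have Hc l : exists c, trigpoly c /\ pderivs l (fun x => f x * expR (- Q x)) =
      (fun x => c x * expR (- Q x)).
  elim: l => [|i l [c [tc IH]]]; first by exists f.
  have [c' tc' dc'] := step c i tc.
  exists c'; split=> //=; apply/funext => x; rewrite /pderiv IH derive1E.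
  exact: (@derive_val _ _ _ _ _ _ _ (dc' x)).
split=> [l i x|a b].
  have [c [tc ->]] := Hc l; have [c' _ dc'] := step c i tc.
  exact: (@ex_derive _ _ _ _ _ _ _ (dc' x)).
have [c [tc ->]] := Hc b.
have tm : trigpoly (monom a).
  rewrite /monom; elim: a => [|i a IH].
    by under eq_fun do rewrite big_nil; exact: trigpoly_cst.
  under eq_fun do rewrite big_cons; apply: trigpolyM => //; exact: trigpoly_coord.
have [C [N [C0 HC]]] := trigpoly_bound (trigpolyM tm tc).
have [D HD] := poly_expR_bound N eta0.
exists (C * D) => x; rewrite mulrA normrM (ger0_norm (expR_ge0 _)).
rewrite (le_trans (ler_wpM2r (expR_ge0 _) (HC x)))// -mulrA ler_wpM2l//.
have S0 : 0 <= \sum_i tnth x i ^+ 2 by rewrite sumr_ge0// => i _; exact: sqr_ge0.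
apply: le_trans (HD _ S0); rewrite ler_wpM2l ?exprn_ge0 ?addr_ge0//.
by rewrite ler_expR lerN2.
Qed.

End trigpoly.

(** Applied to the modulus of a Fourier transform whose measurability is not established: the
    integral of a nonnegative function is a supremum over the simple functions below it, hence
    monotone. *)
Lemma le_integral_ge0 d (T : measurableType d) (R : realType)
    (mu : {measure set T -> \bar R}) (f g : T -> \bar R) :
  (forall x, 0 <= f x)%E -> (forall x, f x <= g x)%E ->
  (\int[mu]_x f x <= \int[mu]_x g x)%E.
Proof.
move=> f0 fg; have g0 x : (0 <= g x)%E by apply: le_trans (fg x).
rewrite !ge0_integralTE// le_ereal_sup// => _ [h hf <-].
by exists h => // x; exact: le_trans (fg x).
Qed.

Lemma sqr_sin_le (R : realType) (y : R) : sin y ^+ 2 <= y ^+ 2.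
Proof.
wlog y0 : y / 0 <= y => [H|].
  have [/H//|y0] := leP 0 y; rewrite -(sqrrN y) -(sqrrN (sin y)) -sinN.
  by apply: H; rewrite oppr_ge0 ltW.
have [c _] := MVT_segment y0 (fun x _ => is_derive_sin x)
  (continuous_subspaceT (@continuous_sin R)).
rewrite sin0 !subr0 => ->; by rewrite exprMn ler_piMl ?sqr_ge0// cos2sin2 gerBl sqr_ge0.
Qed.

Lemma cos_ge (R : realType) (y : R) : 1 - y ^+ 2 / 2 <= cos y.
Proof.
have -> : cos y = 1 - 2 * sin (y / 2) ^+ 2.
  by rewrite [in LHS](splitr y) cosD -!expr2 cos2sin2; ring.
have := sqr_sin_le (y / 2); set s := sin _ ^+ 2; lra.
Qed.

Section gauss_form.
Context {R : realType} {d : nat}.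
Variable A : 'M[R]_d.
Hypothesis Atrig : forall i j : 'I_d, (i < j)%N -> A i j = 0.
Hypothesis Adiag : forall i, A i i != 0.

Definition qform (x : d.-tuple R) := \sum_i (\sum_j A i j * tnth x j) ^+ 2.

Lemma qform_ge0 x : 0 <= qform x.
Proof. by rewrite sumr_ge0// => i _; exact: sqr_ge0. Qed.

Lemma measurable_qform : measurable_fun [set: d.-tuple R] qform.
Proof.
apply: measurable_sum => i; apply: measurable_funX.
apply: measurable_sum => j; apply: measurable_funM => //.
exact: measurable_tnth.
Qed.

Lemma trigpoly_qform (l : R) : trigpoly (fun x => l * qform x).
Proof.
apply: trigpolyM; first exact: trigpoly_cst.
apply: trigpoly_sum => i; under eq_fun do rewrite expr2.
by apply: trigpolyM; apply: trigpoly_sum => j;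
  (apply: trigpolyM; [exact: trigpoly_cst|exact: trigpoly_coord]).
Qed.

(** Writing [x = B (A x)] with [B] the inverse of [A], Cauchy-Schwarz on each row bounds the squared
    norm of [x] by [K * qform A x], where [K] is the sum of the squared entries of [B]. Coercivity
    is what makes the wave packets decay. *)
Lemma qform_coercive : exists2 eta : R, 0 < eta &
  forall x, eta * \sum_i tnth x i ^+ 2 <= qform x.
Proof.
have Au : A \in unitmx.
  rewrite unitmxE det_trig ?unitfE.
    by rewrite prodf_seq_neq0; apply/allP => i _; rewrite Adiag.
  by apply/is_trig_mxP => i j; exact: Atrig.
pose B := invmx A.
pose K := \sum_i \sum_j B i j ^+ 2.
have K0 : 0 <= K by rewrite sumr_ge0// => i _; rewrite sumr_ge0// => j _; exact: sqr_ge0.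
exists (1 + K)^-1; first by rewrite invr_gt0 ltr_wpDr.
move=> x; rewrite mulrC ler_pdivrMr ?ltr_wpDr//.
apply: (@le_trans _ _ (qform x * K)); last first.
  by rewrite ler_wpM2l ?qform_ge0// lerDr.
rewrite mulr_sumr ler_sum// => i _.
have -> : tnth x i = \sum_j B i j * (\sum_k A j k * tnth x k).
  have := congr1 (fun M : 'cV_d => M i ord0) (mulKmx Au (\col_k tnth x k)).
  rewrite !mxE => <-; apply: eq_bigr => j _; congr (_ * _); rewrite mxE.
  by apply: eq_bigr => k _; rewrite mxE.
rewrite mulrC.
have CS (n : nat) (a b : 'I_n -> R) : (\sum_j a j * b j) ^+ 2 <=
    (\sum_j a j ^+ 2) * (\sum_j b j ^+ 2).
  elim: n a b => [|n IH] a b; first by rewrite !big_ord0 expr0n/= mulr0.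
  rewrite !big_ord_recl; have := IH (fun i => a (lift ord0 i)) (fun i => b (lift ord0 i)).
  set S := \sum_(j < n) _; set P := \sum_(j < n) _; set Q := \sum_(j < n) _ => H.
  have P0 : 0 <= P by rewrite sumr_ge0// => ? _; exact: sqr_ge0.
  have Q0 : 0 <= Q by rewrite sumr_ge0// => ? _; exact: sqr_ge0.
  set u := a ord0; set v := b ord0.
  suff : 2 * (u * v * S) <= u ^+ 2 * Q + P * v ^+ 2.
    by move=> H2; rewrite sqrrD exprMn mulrDl !mulrDr; lra.
  have : (2 * (u * v * S)) ^+ 2 <= (u ^+ 2 * Q + P * v ^+ 2) ^+ 2.
    have -> : (2 * (u * v * S)) ^+ 2 = 4 * (u ^+ 2 * v ^+ 2) * S ^+ 2 by ring.
    have : 4 * (u ^+ 2 * v ^+ 2) * S ^+ 2 <= 4 * (u ^+ 2 * v ^+ 2) * (P * Q).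
      by apply: ler_wpM2l => //; apply: mulr_ge0 => //; apply: mulr_ge0; exact: sqr_ge0.
    have := sqr_ge0 (u ^+ 2 * Q - P * v ^+ 2); lra.
  set y := u ^+ 2 * Q + _; set x' := 2 * _ => Hxy.
  have y0 : 0 <= y by apply: addr_ge0; apply: mulr_ge0 => //; exact: sqr_ge0.
  by rewrite leNgt; apply/negP => yx; move: Hxy; rewrite leNgt ltr_sqr ?nnegrE ?yx// ltW// (le_lt_trans y0).
exact: CS.
Qed.

Lemma lebint_qform (l : R) : 0 < l ->
  lebint (fun x => (expR (- (l * qform x)))%:E) =
  ((Num.sqrt pi / Num.sqrt l) ^+ d / \prod_i `|A i i|)%:E.
Proof.
move=> l0; have sl0 : Num.sqrt l != 0 by rewrite gt_eqF// sqrtr_gt0.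
transitivity (lebint (fun x => (expR (- \sum_i (0 + \sum_j
    (Num.sqrt l *: A) i j * tnth x j) ^+ 2))%:E)).
  congr lebint; apply/funext => x; congr (expR (- _))%:E.
  rewrite mulr_sumr; apply: eq_bigr => i _; rewrite add0r.
  under [X in _ = X ^+ 2]eq_bigr do rewrite mxE -mulrA.
  by rewrite -mulr_sumr exprMn sqr_sqrtr// ltW.
rewrite lebint_gauss; last 2 first.
- by move=> i j ij; rewrite mxE Atrig// mulr0.
- by move=> i; rewrite mxE mulf_neq0.
congr (_%:E); under eq_bigr do rewrite mxE normrM ger0_norm ?sqrtr_ge0// invfM mulrA.
by rewrite big_split/= prodr_const card_ord prodfV.
Qed.

End gauss_form.

Section gauss_fourier.
Context {R : realType} {d : nat}.
Variable A : 'M[R]_d.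
Hypothesis Atrig : forall i j : 'I_d, (i < j)%N -> A i j = 0.
Hypothesis Adiag : forall i, A i i != 0.
Local Notation q := (qform A).

Definition wave_packet (l : R) (xi0 : d.-tuple R) (x : d.-tuple R) : R[i] :=
  cexpi (2 * pi * dotp xi0 x) * (expR (- (l * q x)))%:C%C.

Lemma dotpZl (c : R) (w x : d.-tuple R) :
  c * dotp w x = dotp [tuple c * tnth w i | i < d] x.
Proof.
by rewrite /dotp mulr_sumr; apply: eq_bigr => i _; rewrite tnth_mktuple mulrA.
Qed.

Lemma dotpC (w x : d.-tuple R) : dotp w x = dotp x w.
Proof. by rewrite /dotp; apply: eq_bigr => i _; rewrite mulrC. Qed.

Lemma schwartz_wave_packet l xi0 : 0 < l -> schwartz (wave_packet l xi0).
Proof.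
move=> l0; have [eta eta0 Heta] := qform_coercive Atrig Adiag.
have H x : l * eta * \sum_i tnth x i ^+ 2 <= l * q x by rewrite -mulrA ler_pM2l.
have leta : 0 < l * eta by exact: mulr_gt0.
split.
  rewrite (_ : (fun _ => _) = (fun x => cos (dotp [tuple 2 * pi * tnth xi0 i | i < d] x)
      * expR (- (l * q x)))).
    exact: schwartzR_gauss (trigpoly_cos _) (trigpoly_qform _ _) leta H.
  by apply/funext => x; rewrite /= dotpZl mulr0 subr0.
rewrite (_ : (fun _ => _) = (fun x => sin (dotp [tuple 2 * pi * tnth xi0 i | i < d] x)
      * expR (- (l * q x)))).
  exact: schwartzR_gauss (trigpoly_sin _) (trigpoly_qform _ _) leta H.
by apply/funext => x; rewrite /= dotpZl mulr0 add0r.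
Qed.

Lemma cmod_wave_packet l xi0 x : cmod (wave_packet l xi0 x) = expR (- (l * q x)).
Proof.
rewrite /cmod /= !mulr0 subr0 add0r !exprMn -mulrDl cos2Dsin2 mul1r sqrtr_sqr.
by rewrite ger0_norm// expR_ge0.
Qed.

Lemma LpnormRd_wave_packet p l xi0 : 0 < p -> 0 < l ->
  LpnormRd p (wave_packet l xi0) =
  ((((Num.sqrt pi / Num.sqrt (p * l)) ^+ d / \prod_i `|A i i|) `^ p^-1)%:E)%E.
Proof.
move=> p0 l0; rewrite /LpnormRd.
rewrite (_ : lebint _ = lebint (fun x => (expR (- (p * l * q x)))%:E)).
  by rewrite lebint_qform ?mulr_gt0// poweR_EFin.
congr lebint; apply/funext => x; rewrite cmod_wave_packet -expRM.
by congr (expR _)%:E; rewrite mulNr [X in - X]mulrC mulrA.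
Qed.

Lemma measurable_dotp (w : d.-tuple R) :
  measurable_fun [set: d.-tuple R] (fun x => dotp w x).
Proof.
apply: measurable_sum => j; apply: measurable_funM => //.
exact: measurable_tnth.
Qed.

(** Half of the Gaussian decay is spent on absorbing the factor [z]. *)
Lemma gauss_moment (l z : R) : 0 < l -> z * expR (- (l * z)) <= 2 / l * expR (- (l / 2 * z)).
Proof.
move=> l0; have : l / 2 * z <= expR (l / 2 * z).
  by have := expR_ge1Dx (l / 2 * z); lra.
rewrite -(ler_pM2r (expR_gt0 (- (l / 2 * z)))) -expRD subrr expR0 => H.
rewrite (_ : - (l * z) = - (l / 2 * z) + - (l / 2 * z)); last by field.
rewrite expRD mulrA ler_wpM2r ?expR_ge0//.
by rewrite -[2 / l]invf_div -[leRHS]mulr1 ler_pdivlMl ?divr_gt0// mulrA.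
Qed.

(* Since [cos t >= 1 - t^2 / 2], the transform of a wave packet is at least
   half its total mass on the region where the phase varies slowly. *)
Lemma fourier_wave_packet (xi0 xi : d.-tuple R) :
  let l := 8 * pi ^+ 2 * Num.sqrt 2 ^+ d in
  (forall x, (dotp x xi0 - dotp x xi) ^+ 2 <= q x) ->
  (Num.sqrt pi / Num.sqrt l) ^+ d / \prod_i `|A i i| / 2 <=
  cmod (fourier (wave_packet l xi0) xi).
Proof.
move=> l Hxi; have s20 : 0 < Num.sqrt 2 :> R by rewrite sqrtr_gt0.
have l0 : 0 < l by rewrite !mulr_gt0 ?exprn_gt0 ?pi_gt0.
set I := (Num.sqrt pi / Num.sqrt l) ^+ d / \prod_i `|A i i|.
pose th x := 2 * pi * (dotp x xi0 - dotp x xi).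
pose g x := expR (- (l * q x)).
pose h x := cos (th x) * g x.
have mth : measurable_fun [set: d.-tuple R] th.
  rewrite /th; apply: measurable_funM => //; apply: measurable_funB.
    by under eq_fun do rewrite dotpC; exact: measurable_dotp.
  by under eq_fun do rewrite dotpC; exact: measurable_dotp.
have mg : measurable_fun [set: d.-tuple R] g.
  apply: measurableT_comp => //; apply: measurableT_comp => //.
  by apply: measurable_funM => //; exact: measurable_qform.
have mh : measurable_fun [set: d.-tuple R] h.
  apply: measurable_funM => //; apply: measurableT_comp => //.
  by apply: continuous_measurable_fun; exact: continuous_cos.
have g0 x : 0 < g x by exact: expR_gt0.
have Ih : complex.Re (fourier (wave_packet l xi0) xi) = lebintR h.
  rewrite /fourier /=; congr lebintR; apply/funext => x.
  have thE : th x = - (2 * pi * dotp xi x) + 2 * pi * dotp xi0 x.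
    by rewrite /th (dotpC x xi0) (dotpC x xi); ring.
  by rewrite /h thE cosD /g; ring.
have cmodRe (z : R[i]) : complex.Re z <= cmod z.
  case: z => a b; rewrite /cmod/=; apply: le_trans (ler_norm a) _.
  by rewrite -sqrtr_sqr ler_sqrt ?addr_ge0 ?sqr_ge0// lerDl sqr_ge0.
apply: le_trans (cmodRe _); rewrite Ih /lebintR.
have IE : lebint (fun x => (g x)%:E) = I%:E by rewrite lebint_qform.
pose P := lebint (fun x => (Num.max (h x) 0)%:E).
pose N := lebint (fun x => (Num.max (- h x) 0)%:E).
rewrite -/P -/N.
have mP : measurable_fun [set: d.-tuple R] (fun x => (Num.max (h x) 0)%:E).
  by apply/measurable_EFinP; exact: measurable_maxr.
have mN : measurable_fun [set: d.-tuple R] (fun x => (Num.max (- h x) 0)%:E).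
  by apply/measurable_EFinP; apply: measurable_maxr => //; exact: measurableT_comp.
have P0 x : (0 <= (Num.max (h x) 0)%:E)%E by rewrite lee_fin le_max lexx orbT.
have N0 x : (0 <= (Num.max (- h x) 0)%:E)%E by rewrite lee_fin le_max lexx orbT.
have hg x : `|h x| <= g x.
  rewrite /h normrM (gtr0_norm (g0 x)) ler_piMl ?(ltW (g0 x))//.
  by rewrite ler_norml cos_geN1 cos_le1.
have mEg : measurable_fun [set: d.-tuple R] (fun x => (g x)%:E).
  exact/measurable_EFinP.
have PI : (P <= I%:E)%E.
  rewrite -IE; apply: le_lebint => // x; rewrite lee_fin ge_max (ltW (g0 x)) andbT.
  by rewrite (le_trans (ler_norm _)).
have NI : (N <= I%:E)%E.
  rewrite -IE; apply: le_lebint => // x; rewrite lee_fin ge_max (ltW (g0 x)) andbT.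
  by rewrite (le_trans (ler_norm _))// normrN.
have PN0 : (0 <= P)%E /\ (0 <= N)%E.
  have [m [_ mE]] := @lebint_integral R d.
  by rewrite /P /N !mE//; split; apply: integral_ge0.
have Pf : P \is a fin_num by rewrite ge0_fin_numE ?(le_lt_trans PI) ?ltry ?PN0.1.
have Nf : N \is a fin_num by rewrite ge0_fin_numE ?(le_lt_trans NI) ?ltry ?PN0.2.
rewrite fineB// -(fineK Pf) -(fineK Nf)/=.
have mT : measurable_fun [set: d.-tuple R] (fun x => (th x ^+ 2 / 2 * g x)%:E).
  apply/measurable_EFinP; apply: measurable_funM => //; apply: measurable_funM => //.
  exact: measurable_funX.
pose T := lebint (fun x => (th x ^+ 2 / 2 * g x)%:E).
have T0 x : (0 <= (th x ^+ 2 / 2 * g x)%:E)%E.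
  by rewrite lee_fin mulr_ge0 ?(ltW (g0 x))// divr_ge0// sqr_ge0.
(* The bound on the cosine is integrated in the form [g + h^- <= h^+ + (th^2 / 2) * g], so that all
   four integrands are nonnegative. *)
have key : (I%:E + N <= P + T)%E.
  rewrite -IE /N /P /T -!lebintD//.
  - apply: le_lebint.
    + exact: emeasurable_funD.
    + by move=> x; rewrite adde_ge0// lee_fin ltW.
    + exact: emeasurable_funD.
    move=> x; rewrite -!EFinD lee_fin.
    have /(ler_wpM2r (ltW (g0 x))) := cos_ge (th x); rewrite mulrBl mul1r -/(h x).
    have [h0|h0] := leP 0 (h x).
      by rewrite max_r ?oppr_le0//; lra.
    by rewrite max_l ?oppr_ge0 ?(ltW h0)//; lra.
  - by move=> x; rewrite lee_fin ltW.
(* Here [th^2 / 2 <= 2 * pi^2 * q], and the moment bound halves the exponent, which multiplies the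
   Gaussian integral by [(sqrt 2)^d]. The total is [4 * pi^2 * (sqrt 2)^d / l] times [I]; the
   constant [l] is chosen to make this exactly one half. *)
have TI : (T <= (I / 2)%:E)%E.
  apply: (@le_trans _ _ (lebint (fun x => (8 * pi ^+ 2 / (2 * l))%:E * (expR (- (l / 2 * q x)))%:E)%E)).
    apply: le_lebint => //.
      apply: measurable_funeM; apply/measurable_EFinP.
      apply: measurableT_comp => //; apply: measurableT_comp => //.
      by apply: measurable_funM => //; exact: measurable_qform.
    move=> x; rewrite -EFinM lee_fin.
    apply: (@le_trans _ _ (2 * pi ^+ 2 * (q x * g x))).
      rewrite mulrA ler_pM2r// /th exprMn exprMn.
      have : pi ^+ 2 * (dotp x xi0 - dotp x xi) ^+ 2 <= pi ^+ 2 * q x.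
        by rewrite ler_wpM2l// sqr_ge0.
      lra.
    apply: (@le_trans _ _ (2 * pi ^+ 2 * (2 / l * expR (- (l / 2 * q x))))).
      apply: ler_wpM2l; last exact: gauss_moment.
      by apply: mulr_ge0 => //; exact: sqr_ge0.
    rewrite mulrA le_eqVlt; apply/orP; left; apply/eqP; congr (_ * _).
    by field; rewrite gt_eqF.
  have k0 : 0 <= 8 * pi ^+ 2 / (2 * l).
    by apply: divr_ge0; apply: mulr_ge0 => //; [exact: sqr_ge0|exact: ltW].
  rewrite (lebintZ k0); last 2 first.
  - apply/measurable_EFinP; apply: measurableT_comp => //; apply: measurableT_comp => //.
    by apply: measurable_funM => //; exact: measurable_qform.
  - by move=> x; rewrite lee_fin expR_ge0.
  rewrite lebint_qform ?divr_gt0// -EFinM lee_fin.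
  have sl0 : 0 < Num.sqrt l by rewrite sqrtr_gt0.
  have -> : Num.sqrt (l / 2) = Num.sqrt l / Num.sqrt 2.
    by rewrite sqrtrM ?(ltW l0)// sqrtrV.
  rewrite invf_div mulrCA exprMn -/I.
  rewrite le_eqVlt; apply/orP; left; apply/eqP.
  rewrite /I expr_div_n (_ : 8 * pi ^+ 2 / (2 * l) = (2 * Num.sqrt 2 ^+ d)^-1).
    rewrite expr_div_n; field.
    by rewrite !gt_eqF ?exprn_gt0// prodr_gt0// => i _; rewrite normr_gt0.
  have p0 : pi != 0 :> R by rewrite gt_eqF// pi_gt0.
  have S0 : Num.sqrt 2 ^+ d != 0 :> R by rewrite gt_eqF// exprn_gt0.
  have gen (u v : R) : u != 0 -> v != 0 -> 8 * u ^+ 2 / (2 * (8 * u ^+ 2 * v)) = (2 * v)^-1.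
    by move=> u0 v0; field; rewrite v0 u0.
  exact: gen.
move: key; rewrite -(fineK Pf) -(fineK Nf).
have Tf : T \is a fin_num.
  rewrite ge0_fin_numE ?(le_lt_trans TI) ?ltry//.
  by have [m [_ mE]] := @lebint_integral R d; rewrite /T mE//; exact: integral_ge0.
rewrite -(fineK Tf) -!EFinD lee_fin => key.
move: TI; rewrite -(fineK Tf) lee_fin; lra.
Qed.

End gauss_fourier.

(** Chebyshev's inequality for the transform of the packet centred at [xi0], whose modulus is at
    least [c1 / (2 D)] on [S]. The constant is uniform in [A] and [xi0], so boxes of every shape and
    position are covered. *)
Lemma restriction_gauss_box (R : realType) d
    (mu : {measure set (d.-tuple R) -> \bar R}) (p q : R) :
  0 < p -> 0 < q -> restriction mu p q ->
  exists2 K : R, 0 <= K & forall (A : 'M[R]_d) (xi0 : d.-tuple R) S,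
    (forall i j : 'I_d, (i < j)%N -> A i j = 0) -> (forall i, A i i != 0) ->
    measurable S ->
    (forall xi, S xi -> forall x, (dotp x xi0 - dotp x xi) ^+ 2 <= qform A x) ->
    (mu S <= (K * (\prod_i `|A i i|) `^ (q * (1 - p^-1)))%:E)%E.
Proof.
move=> p0 q0 [C HC].
pose l : R := 8 * pi ^+ 2 * Num.sqrt 2 ^+ d.
have s20 : 0 < Num.sqrt 2 :> R by rewrite sqrtr_gt0.
have l0 : 0 < l by rewrite !mulr_gt0 ?exprn_gt0 ?pi_gt0.
have spi : 0 < Num.sqrt pi :> R by rewrite sqrtr_gt0 pi_gt0.
pose c1 := (Num.sqrt pi / Num.sqrt l) ^+ d.
pose c2 := (Num.sqrt pi / Num.sqrt (p * l)) ^+ d.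
have c10 : 0 < c1 by rewrite exprn_gt0// divr_gt0// sqrtr_gt0.
have c20 : 0 < c2 by rewrite exprn_gt0// divr_gt0// sqrtr_gt0 mulr_gt0.
(* The Chebyshev bound solved for [mu S], with [|C|] in place of [C], whose sign is unknown. *)
exists ((2 * `|C| * c2 `^ p^-1 / c1) `^ q); first exact: powR_ge0.
move=> A xi0 S Atrig Adiag mS HS.
pose D := \prod_i `|A i i|; rewrite -/D.
have D0 : 0 < D by rewrite prodr_gt0// => i _; rewrite normr_gt0.
pose F xi := cmod (fourier (wave_packet A l xi0) xi).
have FI xi : S xi -> c1 / D / 2 <= F xi.
  by move=> Sxi; exact: (fourier_wave_packet Atrig Adiag (HS _ Sxi)).
have {HC} := HC _ (schwartz_wave_packet Atrig Adiag xi0 l0).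
rewrite LpnormRd_wave_packet// -/D -/c2 -EFinM => HC.
have b0 : 0 < c1 / D / 2 by rewrite !divr_gt0.
have F0 xi : 0 <= F xi by exact: sqrtr_ge0.
have H1 : (((c1 / D / 2) `^ q)%:E * mu S <= ((`|C| * (c2 / D) `^ p^-1) `^ q)%:E)%E.
  apply: (@le_trans _ _ (Lnorm mu q%:E (fun xi => (F xi)%:E) `^ q)%E); last first.
    rewrite -poweR_EFin; apply: gt0_ler_poweR; rewrite ?(ltW q0)//.
    - by rewrite in_itv/= Lnorm_ge0 leey.
    - by rewrite in_itv/= lee_fin mulr_ge0 ?powR_ge0// leey.
    apply: le_trans HC _; rewrite lee_fin ler_wpM2r ?powR_ge0// ler_norm//.
  rewrite poweR_Lnorm ?gt_eqF//.
  apply: (@le_trans _ _ (\int[mu]_x (((c1 / D / 2) `^ q)%:E * (\1_S x)%:E))%E).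
    by rewrite ge0_integralZl//= ?integral_indic ?setIT// ?lee_fin ?powR_ge0//; apply/measurable_EFinP.
  apply: le_integral_ge0 => x.
    by rewrite -EFinM lee_fin mulr_ge0 ?powR_ge0.
  rewrite indicE; have [xS|xS] := boolP (x \in S); last by rewrite mule0 poweR_ge0.
  rewrite mule1 -poweR_EFin; apply: gt0_ler_poweR; rewrite ?(ltW q0)//.
  - by rewrite in_itv/= lee_fin ltW// leey.
  - by rewrite in_itv/= lee_fin normr_ge0 leey.
  by rewrite lee_fin ger0_norm//; apply: FI; rewrite inE in xS.
have bq0 : 0 < (c1 / D / 2) `^ q by exact: powR_gt0.
rewrite -(@lee_pmul2l _ ((c1 / D / 2) `^ q)%:E)// (le_trans H1)// -EFinM lee_fin.
have u0 : 0 <= 2 * `|C| * c2 `^ p^-1 / c1.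
  by apply: divr_ge0; [apply: mulr_ge0; [exact: mulr_ge0|exact: powR_ge0]|exact: ltW].
rewrite (mulrC q) powRrM -(powRM _ u0 (powR_ge0 _ _)).
rewrite -(powRM _ (ltW b0) (mulr_ge0 u0 (powR_ge0 _ _))).
rewrite le_eqVlt; apply/orP; left; apply/eqP; congr (_ `^ _).
rewrite powRM ?(ltW c20) ?invr_ge0 ?(ltW D0)//.
have -> : D^-1 `^ p^-1 = D `^ (- p^-1).
  by rewrite -(powR_inv1 (ltW D0)) -powRrM mulN1r.
have -> : D `^ (1 - p^-1) = D * D `^ (- p^-1).
  by rewrite powRD ?powRr1 ?(ltW D0)// (gt_eqF D0)/= implybT.
by field; rewrite !gt_eqF.
Qed.

(** * Oblique tubes and the bound on their mass *)

Section tubes.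
Context {R : realType} {d : nat}.
Implicit Types (e : 'I_d -> R) (x y : d.-tuple R).

Definition cube x (r : R) : set (d.-tuple R) :=
  [set y | forall i, `|tnth y i - tnth x i| <= r].

(* The coordinate of [y - x] along [e], read off on the axis [k] where
   [e k != 0]. *)
Definition ucoord e k x y : R := (tnth y k - tnth x k) / e k.

(** When [e k != 0] the [k]-th residual vanishes identically, so this is a parallelepiped whose
    volume is of order [|e k| * a * b^(d-1)]. *)
Definition tube e k x (a b : R) : set (d.-tuple R) :=
  [set y | `|ucoord e k x y| <= a /\
    forall i, `|tnth y i - tnth x i - ucoord e k x y * e i| <= b].

Lemma measurable_ucoord e k x : measurable_fun [set: d.-tuple R] (ucoord e k x).
Proof.
apply: measurable_funM => //; apply: measurable_funB => //.
exact: measurable_tnth.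
Qed.

Lemma measurable_norm_le (g : d.-tuple R -> R) a :
  measurable_fun [set: d.-tuple R] g -> measurable [set y | `|g y| <= a].
Proof.
move=> mg; rewrite (_ : [set _ | _] = g @^-1` `[- a, a]%classic).
  by rewrite -[X in measurable X]setTI; exact: mg.
by apply/seteqP; split => y /=; rewrite in_itv/= ler_norml.
Qed.

Lemma measurable_forall_ord (P : 'I_d -> set (d.-tuple R)) :
  (forall i, measurable (P i)) -> measurable [set y | forall i, P i y].
Proof.
move=> mP; rewrite (_ : [set _ | _] = \bigcap_(i in [set: 'I_d]) P i).
  exact: fin_bigcap_measurable.
by apply/seteqP; split => y /= H i //; exact: H.
Qed.

Lemma measurable_cube x r : measurable (cube x r).
Proof.
apply: measurable_forall_ord => i; apply: measurable_norm_le.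
by apply: measurable_funB => //; exact: measurable_tnth.
Qed.

Lemma measurable_tube e k x a b : measurable (tube e k x a b).
Proof.
rewrite (_ : tube e k x a b = [set y | `|ucoord e k x y| <= a] `&`
  [set y | forall i, `|tnth y i - tnth x i - ucoord e k x y * e i| <= b])//.
apply: measurableI; first by apply: measurable_norm_le; exact: measurable_ucoord.
apply: measurable_forall_ord => i; apply: measurable_norm_le.
apply: measurable_funB; first by apply: measurable_funB => //; exact: measurable_tnth.
by apply: measurable_funM => //; exact: measurable_ucoord.
Qed.

Lemma sqr_sum_le (n : nat) (a : 'I_n -> R) :
  (\sum_i a i) ^+ 2 <= n%:R * \sum_i a i ^+ 2.
Proof.
elim: n a => [|n IH] a; first by rewrite !big_ord0 expr0n/= mulr0.
rewrite !big_ord_recl; have := IH (fun i => a (lift ord0 i)).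
set S := \sum_(i < n) _; set Q := \sum_(i < n) _ => H.
have H2 : 2 * a ord0 * S <= n%:R * a ord0 ^+ 2 + Q.
  apply: (@le_trans _ _ (\sum_(i < n) (a ord0 ^+ 2 + a (lift ord0 i) ^+ 2))).
    rewrite /S mulr_sumr ler_sum// => i _.
    have := sqr_ge0 (a ord0 - a (lift ord0 i)); lra.
  by rewrite big_split/= sumr_const card_ord mulr_natl.
by rewrite -natr1; lra.
Qed.

(** A tube fits in the box dual to the matrix whose row [k] is [d * a * e] and whose other rows are
    [d * b] times the unit vectors. Since [e] vanishes after [k] the matrix is lower triangular, and
    the factor [d] absorbs the loss in squaring a sum of [d] terms. *)
Lemma gauss_box_tube (mu : {measure set (d.-tuple R) -> \bar R}) (K w : R) :
  (forall (A : 'M[R]_d) (xi0 : d.-tuple R) S,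
    (forall i j : 'I_d, (i < j)%N -> A i j = 0) -> (forall i, A i i != 0) ->
    measurable S ->
    (forall xi, S xi -> forall x, (dotp x xi0 - dotp x xi) ^+ 2 <= qform A x) ->
    (mu S <= (K * (\prod_i `|A i i|) `^ w)%:E)%E) ->
  forall e k x a b, e k != 0 -> (forall i : 'I_d, (k < i)%N -> e i = 0) ->
    0 < a -> 0 < b ->
    (mu (tube e k x a b) <=
      (K * (d%:R ^+ d * (`|e k| * a * b ^+ d.-1)) `^ w)%:E)%E.
Proof.
move=> H e k x a b ek0 ek a0 b0.
have d0 : (0 < d)%N by apply: leq_ltn_trans (ltn_ord k).
have dR : 0 < d%:R :> R by rewrite ltr0n.
pose A : 'M[R]_d := \matrix_(i, j) if i == k then d%:R * a * e j else d%:R * b *+ (i == j).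
have -> : d%:R ^+ d * (`|e k| * a * b ^+ d.-1) = \prod_i `|A i i|.
  rewrite (bigD1 k)//= mxE eqxx (eq_bigr (fun=> d%:R * b)); last first.
    by move=> i /negbTE ik; rewrite mxE ik eqxx mulr1n ger0_norm// mulr_ge0// ltW.
  rewrite prodr_const cardC1 card_ord !normrM (ger0_norm (ltW dR)) (ger0_norm (ltW a0)).
  rewrite -[in LHS](prednK d0) exprS exprMn prednK//; ring.
apply: (H A x); last 2 first.
- exact: measurable_tube.
- move=> y [Hu Hp] z; set u := ucoord e k x y in Hu Hp.
  (* One summand per row of [A]: the displacement along [e] goes to row [k], whose own residual is
     zero, and the other residuals go to their own rows. *)
  pose t i := if i == k then - u * (\sum_j tnth z j * e j) else
     - (tnth z i * (tnth y i - tnth x i - u * e i)).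
  have -> : dotp z x - dotp z y = \sum_i t i.
    have uk : tnth y k - tnth x k - u * e k = 0 by rewrite /u /ucoord divfK// subrr.
    have -> : \sum_i t i = - u * (\sum_j tnth z j * e j) +
        \sum_i - (tnth z i * (tnth y i - tnth x i - u * e i)).
      rewrite (bigD1 k)//= [X in _ = _ + X](bigD1 k)//= uk mulr0 oppr0 add0r /t eqxx.
      by congr (_ + _); apply: eq_bigr => i /negbTE->.
    rewrite /dotp mulr_sumr -sumrB -big_split/=; apply: eq_bigr => i _; ring.
  apply: le_trans (sqr_sum_le _) _; rewrite mulr_sumr ler_sum// => i _.
  have sq (v1 v2 : R) : `|v1| <= v2 -> v1 ^+ 2 <= v2 ^+ 2.
    by move=> v12; rewrite -real_normK ?num_real// lerXn2r// nnegrE// (le_trans _ v12).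
  have dd : d%:R <= d%:R ^+ 2 :> R by rewrite expr2 ler_peMr ?(ltW dR)// ler1n.
  have -> : (\sum_j A i j * tnth z j) ^+ 2 = d%:R ^+ 2 *
      (if i == k then a * (\sum_j tnth z j * e j) else b * tnth z i) ^+ 2.
    rewrite -exprMn; congr (_ ^+ 2); case: eqP => [ik|/eqP ik].
      rewrite !mulr_sumr; apply: eq_bigr => j _; rewrite mxE ik eqxx; ring.
    rewrite (bigD1 i)//= big1 ?addr0.
      by rewrite mxE (negbTE ik) eqxx mulr1n mulrA.
    by move=> j ji; rewrite mxE (negbTE ik) eq_sym (negbTE ji) mulr0n mul0r.
  apply: ler_pM; [exact: ltW|exact: sqr_ge0|exact: dd|].
  rewrite /t; case: eqP => _.
    by rewrite !exprMn sqrrN; apply: ler_wpM2r; [exact: sqr_ge0|exact: sq].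
  by rewrite sqrrN !exprMn mulrC; apply: ler_wpM2r; [exact: sqr_ge0|exact: sq].
- move=> i j ij; rewrite mxE; case: eqP => [ik|_].
    by rewrite ek ?mulr0// -ik.
  by rewrite (negbTE (_ : i != j)) ?mulr0n// neq_ltn ij.
- move=> i; rewrite mxE eqxx mulr1n; have [->|_] := eqVneq i k.
    by rewrite !mulf_neq0// gt_eqF.
  by rewrite !mulf_neq0// gt_eqF.
Qed.

End tubes.

(** * Vitali coverings by cubes *)

Section cube_topology.
Context {R : realType} {d : nat}.
Implicit Types (x y : d.-tuple R) (f : d.-tuple R -> R).

Definition cube_open (U : set (d.-tuple R)) :=
  forall x, U x -> exists2 r : R, 0 < r & cube x r `<=` U.

Lemma cubeS x (r r' : R) : r <= r' -> cube x r `<=` cube x r'.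
Proof. by move=> rr' y H i; exact: le_trans (H i) rr'. Qed.

Lemma cube_trans x y z (r r' : R) : cube x r y -> cube y r' z -> cube x (r + r') z.
Proof.
move=> H1 H2 i; rewrite -(subrKA (tnth y i)) addrC.
by rewrite (le_trans (ler_normD _ _))// lerD// ?H1 ?H2.
Qed.

Lemma cubeC x y (r : R) : cube x r y -> cube y r x.
Proof. by move=> H i; rewrite distrC. Qed.

Lemma cubexx x (r : R) : 0 <= r -> cube x r x.
Proof. by move=> r0 i; rewrite subrr normr0. Qed.

Lemma cube_rat x (r : R) : 0 < r ->
  exists q : {ffun 'I_d -> rat}, cube x r [tuple ratr (q i) | i < d].
Proof.
move=> r0.
have Q i : exists q, `|tnth x i - ratr q| <= r.
  have [q] : exists q, ratr q \in `]tnth x i - r, tnth x i + r[.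
    by apply: rat_in_itvoo; rewrite ltrD2l gtrN.
  by rewrite in_itv/= => /andP[q1 q2]; exists q; rewrite ler_distlC !ltW.
have {Q} [q Hq] := choice Q.
by exists [ffun i => q i] => i; rewrite tnth_mktuple ffunE distrC.
Qed.

(** An open set is the union of the countably many cubes inside it with rational centre and radius
    [1 / (n + 1)]; around a given point two such radii have to fit in [r]. *)
Lemma measurable_cube_open U : cube_open U -> measurable U.
Proof.
move=> oU.
pose c (q : {ffun 'I_d -> rat} * nat) : set (d.-tuple R) :=
  cube [tuple ratr (q.1 i) | i < d] q.2.+1%:R^-1.
have -> : U = \bigcup_(q in [set q | c q `<=` U]) c q.
  apply/seteqP; split => x; last by move=> [q qU]; exact: qU.
  move=> /oU[r r0 xr].
  pose n := Num.truncn (2 / r).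
  have n0 : 0 < n.+1%:R^-1 :> R by rewrite invr_gt0 ltr0n.
  have nr : n.+1%:R^-1 + n.+1%:R^-1 <= r.
    have : 2 / r <= n.+1%:R by rewrite ltW// truncnS_gt.
    by rewrite ler_pdivrMr// -ler_pdivrMl ?ltr0n// mulr_natr mulr2n.
  have [q /cubeC xc] := cube_rat x n0.
  exists (q, n) => //= y yc; apply: xr; apply: cubeS nr _ _.
  by apply: cube_trans yc; exact: cubeC.
rewrite bigcup_mkcond; apply: countable_bigcupT_measurable => [|q]; first exact: countableP.
by case: ifP => // _; exact: measurable_cube.
Qed.

Definition lip (C : R) f :=
  forall x y (h : R), (forall i, `|tnth y i - tnth x i| <= h) -> `|f y - f x| <= C * h.

Lemma measurable_lip C f : lip C f -> measurable_fun [set: d.-tuple R] f.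
Proof.
move=> Lf mD; apply: (measurability _ (RGenOInfty.measurableE R)) => //.
move=> _ [_ [a ->] <-]; rewrite setTI; apply: measurable_cube_open => x /=.
rewrite in_itv/= andbT => ax.
have C0 : 0 < 2 * (1 + `|C|) by rewrite mulr_gt0// ltr_wpDr.
pose r := (f x - a) / (2 * (1 + `|C|)).
have r0 : 0 < r by rewrite divr_gt0 ?subr_gt0.
exists r => // y /Lf; rewrite /= in_itv/= andbT => H.
have Cr : C * r <= (1 + `|C|) * r.
  by rewrite ler_pM2r// (le_trans (ler_norm C))// lerDr.
have : 2 * (1 + `|C|) * r = f x - a by rewrite /r mulrC divfK// gt_eqF.
move: H; rewrite ler_norml => /andP[H _].
lra.
Qed.

End cube_topology.

(* Zorn's lemma on the disjoint subfamilies [D] such that every member of the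
   family meeting [D] meets a member of [D] at least half as large. *)
Lemma vitali_select (R : realType) (T : Type) (X : set T) (rho : T -> R) (rho0 : R)
    (meet : T -> T -> Prop) :
  (forall x, X x -> 0 < rho x <= rho0) -> (forall x, X x -> meet x x) ->
  (forall x y, meet x y -> meet y x) ->
  exists D : set T, [/\ D `<=` X, (forall x y, D x -> D y -> meet x y -> x = y) &
    forall x, X x -> exists y, [/\ D y, meet x y & rho x <= 2 * rho y]].
Proof.
move=> Hrho mxx msym.
pose P (D : set T) := [/\ D `<=` X, (forall x y, D x -> D y -> meet x y -> x = y) &
  forall x, X x -> (exists2 y, D y & meet x y) ->
    exists y, [/\ D y, meet x y & rho x <= 2 * rho y]].
have [F FP totF|D [[DX Ddis Dhalf] Dmax]] := @Zorn_bigcup T P.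
  split.
  - by move=> x [D /FP[DX _ _] /DX].
  - move=> x y [D FD Dx] [E FE Ey] mxy.
    have [DE|ED] := totF _ _ FD FE.
      by have [_ H _] := FP _ FE; apply: H => //; exact: DE.
    by have [_ H _] := FP _ FD; apply: H => //; exact: ED.
  - move=> x Xx [y [D FD Dy] mxy]; have [_ _ H] := FP _ FD.
    have [|z [Dz mxz xz]] := H x Xx; first by exists y.
    by exists z; split=> //; exists D.
exists D; split=> // x Xx; apply: (Dhalf x Xx); apply: contrapT => nx.
(* [N] collects the members that meet nothing in [D]. Adding one whose size exceeds half the
   supremum over [N] keeps property [P], against maximality. *)
pose N := [set z | X z /\ forall y, D y -> ~ meet z y].
have Nx : N x by split=> // y Dy mxy; apply: nx; exists y.
have hs : has_sup (rho @` N).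
  split; first by exists (rho x); exists x.
  by exists rho0 => _ [z [Xz _] <-]; have /andP[] := Hrho z Xz.
pose s := sup (rho @` N).
have s0 : 0 < s.
  have /andP[r0 _] := Hrho x Xx; apply: lt_le_trans r0 _.
  by apply: ub_le_sup; [exact: hs.2|exists x].
have [_ [z [Xz Nz] <-] sz] := @sup_adherent _ _ (s / 2) (divr_gt0 s0 (ltr0n _ 2)) hs.
have zs : s / 2 < rho z by move: sz; rewrite -/s; lra.
have PD' : P (D `|` [set z]).
  split.
  - by move=> w [/DX//|->].
  - move=> u w [Du|->] [Dw|->] // m.
    + exact: Ddis.
    + by exfalso; apply: (Nz u) => //; exact: msym.
    + by exfalso; apply: (Nz w).
  - move=> w Xw [y Hy mwy].
    have [[v Dv mwv]|nw] := pselect (exists2 v, D v & meet w v).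
      have [|v' [Dv' mv' H]] := Dhalf w Xw; first by exists v.
      by exists v'; split=> //; left.
    exists z; case: Hy => [Dy|zy]; first by exfalso; apply: nw; exists y.
    rewrite zy in mwy; split=> //; first by right.
    have : rho w <= s.
      apply: ub_le_sup; first exact: hs.2.
      by exists w => //; split=> // v Dv mv; apply: nw; exists v.
    lra.
apply: Dmax PD'; split=> [w Dw|DD]; first by left.
have Dz : D z by apply: DD; right.
exact: (Nz z Dz (mxx z Xz)).
Qed.

(** Each selected cube contains a rational point and disjoint cubes contain different ones, so the
    family can be indexed by codes of rational points; [valid] marks the codes in use. The factor
    [3] suffices because only the centres [x] have to be covered. *)
Lemma vitali_cubes (R : realType) d (X : set (d.-tuple R)) (rho : d.-tuple R -> R) (rho0 : R) :
  (forall x, X x -> 0 < rho x <= rho0) ->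
  exists (xs : nat -> d.-tuple R) (valid : pred nat),
  [/\ forall n, valid n -> X (xs n),
      forall n m, valid n -> valid m -> n != m ->
        cube (xs n) (rho (xs n)) `&` cube (xs m) (rho (xs m)) = set0 &
      X `<=` \bigcup_(n in [set n | valid n]) cube (xs n) (3 * rho (xs n))].
Proof.
move=> Hrho.
have [//|||D [DX Ddis Dcov]] := @vitali_select R _ X rho rho0
    (fun x y => cube x (rho x) `&` cube y (rho y) !=set0).
- by move=> x /Hrho/andP[r0 _]; exists x; split; apply: cubexx; exact: ltW.
- by move=> x y; rewrite setIC.
have Q x : exists q : {ffun 'I_d -> rat}, D x -> cube x (rho x) [tuple ratr (q i) | i < d].
  have [Dx|nDx] := pselect (D x); last by exists [ffun=> 0].
  by have /andP[r0 _] := Hrho _ (DX _ Dx); have [q Hq] := cube_rat x r0; exists q.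
have {Q} [q Hq] := choice Q.
pose c x := pickle (q x).
have cinj x y : D x -> D y -> c x = c y -> x = y.
  move=> Dx Dy /(pcan_inj pickleK) qxy; apply: Ddis => //.
  by exists [tuple ratr (q x i) | i < d]; split; [|rewrite qxy]; exact: Hq.
have G n : exists x, (exists2 y, D y & c y = n) -> D x /\ c x = n.
  have [[x Dx cx]|nx] := pselect (exists2 y, D y & c y = n); first by exists x.
  by exists [tuple 0 | i < d].
have {G} [xs Hxs] := choice G.
exists xs, (fun n => `[< exists2 y, D y & c y = n >]); split.
- by move=> n /asboolP/Hxs[/DX].
- move=> n m /asboolP/Hxs[Dn cn] /asboolP/Hxs[Dm cm] nm.
  apply/eqP; rewrite -[_ == _]negbK; apply/negP => /set0P /(Ddis _ _ Dn Dm) H.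
  by move: nm; rewrite -cn -cm H eqxx.
- move=> x /Dcov[y [Dy [z [xz yz]] xy]].
  have Py : exists2 y', D y' & c y' = c y by exists y.
  exists (c y); first exact/asboolP.
  have [Dxs cxs] := Hxs _ Py; rewrite (cinj _ _ Dxs Dy cxs).
  have -> : 3 * rho y = rho y + 2 * rho y by ring.
  by apply: cubeS (cube_trans yz (cubeC xz)); rewrite lerD2l.
Qed.

(** * Bumps with a one-sided slope *)

Section scalar_bump.
Context {R : realType}.
Implicit Types a b c u p H L : R.

Lemma minr_dist a b a' b' c : `|a' - a| <= c -> `|b' - b| <= c ->
  `|Num.min a' b' - Num.min a b| <= c.
Proof.
rewrite !ler_norml => /andP[? ?] /andP[? ?]; apply/andP.
by case: (leP a b); case: (leP a' b') => *; split; lra.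
Qed.

Lemma maxr_dist a b a' b' c : `|a' - a| <= c -> `|b' - b| <= c ->
  `|Num.max a' b' - Num.max a b| <= c.
Proof.
rewrite !ler_norml => /andP[? ?] /andP[? ?]; apply/andP.
by case: (leP a b); case: (leP a' b') => *; split; lra.
Qed.

Definition clamp a : R := Num.min 1 (Num.max 0 a).

Lemma clamp_dist a a' c : `|a' - a| <= c -> `|clamp a' - clamp a| <= c.
Proof.
move=> H; have c0 : 0 <= c := le_trans (normr_ge0 _) H.
by apply: minr_dist; rewrite ?subrr ?normr0//; apply: maxr_dist; rewrite ?subrr ?normr0.
Qed.

Lemma clamp_itv a : 0 <= clamp a <= 1.
Proof. by rewrite /clamp; case: (leP 0 a) => ?; [case: (leP 1 a) => ?|case: (leP 1 0) => ?]; lra. Qed.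

Lemma clamp1 a : 1 <= a -> clamp a = 1.
Proof. by rewrite /clamp; case: (leP 0 a) => ?; [case: (leP 1 a) => ? ?|case: (leP 1 0) => ? ?]; lra. Qed.

Lemma clamp0 a : a <= 0 -> clamp a = 0.
Proof. by rewrite /clamp; case: (leP 0 a) => ?; [case: (leP 1 a) => ? ?|case: (leP 1 0) => ? ?]; lra. Qed.

Lemma clamp_gt0 a : 0 < clamp a -> 0 < a.
Proof. by apply: contraTT; rewrite -!leNgt => /clamp0->. Qed.

(* The bump rises with slope [1] along the [u]-axis on [u <= 2 H] and then
   decreases with the small slope [1 / L]; [slope] is a continuous lower bound
   for its derivative in the directions of a thin cone around the axis. *)
Definition tent H L u := Num.min (u + 3 * H) (5 * H - (u - 2 * H) / L).
Definition bump H L u p := Num.max 0 (tent H L u - p).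
Definition slope H L u p : R :=
  2^-1 * clamp (Num.min (3 - 2 * (u / H)) ((tent H L u - p) / H))
  - 2 / L * clamp (1 + (tent H L u - p) / H).

Variables (H L : R).
Hypotheses (H0 : 0 < H) (L4 : 4 <= L).

Let L0 : 0 < L. Proof. by move: L4; lra. Qed.
Let iL0 : 0 < L^-1. Proof. by rewrite invr_gt0. Qed.
Let iL4 : L^-1 <= 4^-1. Proof. by rewrite lef_pV2// posrE. Qed.
Let LL : L * L^-1 = 1. Proof. by rewrite divff// gt_eqF. Qed.

Ltac slra := (have := H0; have := L4; have := L0; have := iL0; have := iL4; have := LL; lra).

Lemma tent_le u : tent H L u <= 5 * H.
Proof.
rewrite /tent ge_min; have [u2|u2] := leP u (2 * H); first by apply/orP; left; slra.
by apply/orP; right; rewrite gerBl mulr_ge0 ?invr_ge0 ?ltW// subr_gt0.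
Qed.

Lemma bump_itv u p : 0 <= p -> 0 <= bump H L u p <= 5 * H.
Proof.
move=> p0; have := tent_le u; rewrite /bump; case: (leP 0 (tent H L u - p)); slra.
Qed.

Lemma tent_dist u u' c : `|u' - u| <= c -> `|tent H L u' - tent H L u| <= c.
Proof.
move=> uc; apply: minr_dist; first by rewrite (_ : _ - _ = u' - u)//; ring.
rewrite (_ : _ - _ = (u - u') * L^-1); last by ring.
rewrite normrM distrC [X in _ * X]ger0_norm ?(ltW iL0)//.
apply: le_trans uc; rewrite ler_piMr//; slra.
Qed.

Lemma bump_dist u p u' p' c c' : `|u' - u| <= c -> `|p' - p| <= c' ->
  `|bump H L u' p' - bump H L u p| <= c + c'.
Proof.
move=> uc pc; apply: maxr_dist.
  by rewrite subrr normr0 addr_ge0//; [exact: le_trans uc|exact: le_trans pc].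
rewrite (_ : _ - _ = (tent H L u' - tent H L u) - (p' - p)); last by ring.
by rewrite (le_trans (ler_normB _ _))// lerD// tent_dist.
Qed.

Lemma slope_dist u p u' p' c : `|u' - u| <= c -> `|p' - p| <= c ->
  `|slope H L u' p' - slope H L u p| <= 4 * (c / H).
Proof.
move=> uc pc; have iH0 : 0 <= H^-1 by rewrite invr_ge0 ltW.
have c0 : 0 <= c := le_trans (normr_ge0 _) uc.
have tc : `|(tent H L u' - p') / H - (tent H L u - p) / H| <= 2 * (c / H).
  rewrite -mulrBl normrM (ger0_norm iH0) mulrA ler_wpM2r//.
  rewrite (_ : _ - _ = (tent H L u' - tent H L u) - (p' - p)); last by ring.
  by rewrite (le_trans (ler_normB _ _))// mulr2n mulrDl mul1r lerD// tent_dist.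
pose X a b := clamp (Num.min (3 - 2 * (a / H)) ((tent H L a - b) / H)).
pose Y a b := clamp (1 + (tent H L a - b) / H).
have Xc : `|X u' p' - X u p| <= 2 * (c / H).
  apply: clamp_dist; apply: minr_dist => //.
  rewrite (_ : _ - _ = - (2 * ((u' - u) / H))); last by ring.
  by rewrite normrN !normrM ger0_norm// ler_pM2l// (ger0_norm iH0) ler_wpM2r.
have Yc : `|Y u' p' - Y u p| <= 2 * (c / H).
  by apply: clamp_dist; rewrite (_ : _ - _ = (tent H L u' - p') / H - (tent H L u - p) / H)//; ring.
rewrite /slope -/(X u' p') -/(Y u' p') -/(X u p) -/(Y u p).
rewrite (_ : _ - _ = 2^-1 * (X u' p' - X u p) - 2 * L^-1 * (Y u' p' - Y u p)); last by ring.
rewrite (le_trans (ler_normB _ _))// !normrM.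
rewrite (ger0_norm (_ : 0 <= 2^-1))// (ger0_norm (ltW iL0)) (ger0_norm (_ : 0 <= 2))//.
have cH : 0 <= c / H by exact: mulr_ge0.
have : 2 * L^-1 * `|Y u' p' - Y u p| <= 1 * (2 * (c / H)).
  by apply: ler_pM => //; slra.
move: Xc; slra.
Qed.

Lemma slope_norm_le u p : `|slope H L u p| <= 1.
Proof.
rewrite /slope; have /andP[a0 a1] := clamp_itv (Num.min (3 - 2 * (u / H)) ((tent H L u - p) / H)).
have /andP[b0 b1] := clamp_itv (1 + (tent H L u - p) / H).
set a := clamp _ in a0 a1 *; set b := clamp _ in b0 b1 *.
have : 0 <= 2 * L^-1 * b <= 2 * L^-1 * 1.
  by rewrite mulr_ge0 ?ler_wpM2l//= mulr_ge0// ltW.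
by rewrite ler_norml; slra.
Qed.

Lemma slope_ge u p : - (2 / L) <= slope H L u p.
Proof.
rewrite /slope; have /andP[a0 a1] := clamp_itv (Num.min (3 - 2 * (u / H)) ((tent H L u - p) / H)).
have /andP[b0 b1] := clamp_itv (1 + (tent H L u - p) / H).
set a := clamp _ in a0 a1 *; set b := clamp _ in b0 b1 *.
have : 0 <= 2 * L^-1 * b <= 2 * L^-1 * 1.
  by rewrite mulr_ge0 ?ler_wpM2l//= mulr_ge0// ltW.
slra.
Qed.

Lemma slope_core u p : `|u| <= H -> p <= H -> 2^-1 - 2 / L <= slope H L u p.
Proof.
rewrite ler_norml => /andP[u1 u2] pH.
have uH : u / H <= 1 by rewrite ler_pdivrMr// mul1r.
have T1 : 1 <= (tent H L u - p) / H.
  rewrite ler_pdivlMr// mul1r.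
  have : 2 * H <= tent H L u.
    rewrite /tent le_min; apply/andP; split; first slra.
    have : (u - 2 * H) / L <= 0 by rewrite mulr_le0_ge0// ?ltW//; slra.
    slra.
  slra.
rewrite /slope clamp1; last by rewrite le_min T1 andbT; slra.
have /andP[b0 b1] := clamp_itv (1 + (tent H L u - p) / H).
set b := clamp _ in b0 b1 *.
have : 2 * L^-1 * b <= 2 * L^-1 * 1 by rewrite ler_wpM2l// mulr_ge0// ltW.
slra.
Qed.

(** The threshold is [- H] because the negative part of [slope] is clamped to zero only a distance
    [H] below the zero level of the bump. On the falling side [u - 2 * H <= 6 * L * H], and [4 <= L]
    turns this into [8 * L * H]. *)
Lemma tent_supp u p : 0 <= p -> - H < tent H L u - p ->
  `|u| <= 8 * L * H /\ p <= 6 * H.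
Proof.
move=> p0 Tp; have T5 := tent_le u; split; last slra.
have : tent H L u <= u + 3 * H by rewrite /tent ge_min lexx.
have : tent H L u <= 5 * H - (u - 2 * H) / L by rewrite /tent ge_min lexx orbT.
move=> T2 T1; have LH : 4 * H <= L * H by rewrite ler_pM2r.
have : (u - 2 * H) / L <= 6 * H by slra.
rewrite ler_pdivrMr// => ?.
by rewrite ler_norml -(mulrA 8); slra.
Qed.

Lemma bump_supp u p : 0 <= p -> bump H L u p != 0 -> `|u| <= 8 * L * H /\ p <= 6 * H.
Proof.
move=> p0 b0; apply: tent_supp => //; rewrite ltNge; apply/negP => Tp.
by move: b0; rewrite /bump max_l ?eqxx//; slra.
Qed.

Lemma slope_supp u p : 0 <= p -> slope H L u p != 0 -> `|u| <= 8 * L * H /\ p <= 6 * H.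
Proof.
move=> p0 b0; apply: tent_supp => //; rewrite ltNge; apply/negP => Tp.
have TH : (tent H L u - p) / H <= -1 by rewrite ler_pdivrMr// mulN1r.
move: b0; rewrite /slope !clamp0 ?mulr0 ?subrr ?eqxx//; first slra.
by rewrite ge_min; apply/orP; right; slra.
Qed.

(** Three regimes. Where the positive part of [slope] is active, [u < 3 / 2 * H] and both end points
    lie on the rising face, so the gain is at least [(1 - 2 * b) * t >= t / 2]. Elsewhere, if the
    bump is positive at the start, the loss is at most [5 / 4 * t / L + b * t <= 2 * t / L]. If it
    vanishes at the start, nothing can be lost. *)
Lemma slope_bump b u p u' p' t : 0 <= b -> b <= 4^-1 -> 2 * b * L <= 1 ->
  0 < t -> 4 * t <= H -> `|u' - u - t| <= b * t -> `|p' - p| <= b * t ->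
  slope H L u p * t <= bump H L u' p' - bump H L u p.
Proof.
move=> b0 b4 bL t0 tH; rewrite !ler_norml => /andP[u1 u2] /andP[p1 p2].
have bt : 0 <= b * t by rewrite mulr_ge0// ltW.
have bt4 : b * t <= 4^-1 * t by rewrite ler_pM2r.
have phi0 : 0 <= bump H L u' p' by rewrite /bump le_max lexx.
have T' : tent H L u - 5 / 4 * (t / L) <= tent H L u'.
  rewrite /tent le_min; apply/andP; split.
    have : Num.min (u + 3 * H) (5 * H - (u - 2 * H) / L) <= u + 3 * H by rewrite ge_min lexx.
    have : 0 <= t / L by rewrite mulr_ge0 ?ltW.
    slra.
  have : Num.min (u + 3 * H) (5 * H - (u - 2 * H) / L) <= 5 * H - (u - 2 * H) / L.
    by rewrite ge_min lexx orbT.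
  have : (u' - u) * L^-1 <= 5 / 4 * t * L^-1 by rewrite ler_pM2r//; slra.
  slra.
have btL : b * t <= 2^-1 * (t / L).
  have bL' : b <= 2^-1 / L by rewrite ler_pdivlMr//; slra.
  have : b * t <= 2^-1 / L * t by rewrite ler_pM2r.
  slra.
have tL : 0 < t / L by rewrite divr_gt0.
set a := clamp (Num.min (3 - 2 * (u / H)) ((tent H L u - p) / H)).
set c := clamp (1 + (tent H L u - p) / H).
have /andP[a0 a1] : 0 <= a <= 1 := clamp_itv _.
have /andP[c0 c1] : 0 <= c <= 1 := clamp_itv _.
have sE : slope H L u p * t = 2^-1 * (a * t) - 2 * (c * (t / L)).
  by rewrite /slope -/a -/c; ring.
have ct0 : 0 <= c * (t / L) by rewrite mulr_ge0// ltW.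
have [a_gt0|a_le0] := ltP 0 a.
  have := clamp_gt0 a_gt0; rewrite lt_min => /andP[].
  move=> uH'; have {uH'} uH : u < 3 / 2 * H by rewrite -ltr_pdivrMr//; slra.
  rewrite pmulr_lgt0 ?invr_gt0// => Tp.
  have TE : tent H L u = u + 3 * H.
    rewrite /tent min_l//.
    have : (u - 2 * H) * L^-1 <= 0 by rewrite mulr_le0_ge0 ?(ltW iL0)//; slra.
    slra.
  have TE' : tent H L u' = u' + 3 * H.
    rewrite /tent min_l//.
    have : (u' - 2 * H) * L^-1 <= 0 by rewrite mulr_le0_ge0 ?(ltW iL0)//; slra.
    slra.
  have -> : bump H L u p = tent H L u - p by rewrite /bump max_r// ltW.
  have : tent H L u' - p' <= bump H L u' p' by rewrite /bump le_max lexx orbT.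
  have : a * t <= 1 * t by rewrite ler_pM2r.
  slra.
have aE : a = 0 by apply/eqP; rewrite eq_le a_le0 a0.
rewrite sE aE mul0r mulr0 sub0r.
have [Tp|Tp] := leP (tent H L u - p) 0.
  have -> : bump H L u p = 0 by rewrite /bump max_l.
  slra.
have -> : c = 1.
  by apply: clamp1; rewrite lerDl ltW// divr_gt0.
have -> : bump H L u p = tent H L u - p by rewrite /bump max_r// ltW.
have : tent H L u' - p' <= bump H L u' p' by rewrite /bump le_max lexx orbT.
slra.
Qed.

End scalar_bump.

Lemma sum_le1 (R : realType) (N : nat) (P : pred nat) (g : nat -> R) c : 0 <= c ->
  (forall n, P n -> `|g n| <= c) ->
  (forall n m, P n -> P m -> n != m -> g n = 0 \/ g m = 0) ->
  `|\sum_(n < N | P n) g n| <= c.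
Proof.
move=> c0 gc g1.
have [[n [Pn gn]]|H] := pselect (exists n : 'I_N, P n /\ g n != 0).
  rewrite (bigD1 n)//= big1 ?addr0; first exact: gc.
  move=> m /andP[Pm mn]; have [//|/eqP] := g1 m n Pm Pn mn.
  by rewrite (negbTE gn).
rewrite big1 ?normr0// => n Pn; apply/eqP; rewrite -[_ == _]negbK; apply/negP => gn.
by apply: H; exists n.
Qed.

(** * Families of disjoint bumps as test functions *)

Section bump_family.
Context {R : realType} {d : nat}.
Implicit Types (x y : d.-tuple R) (f g : d.-tuple R -> R).

Definition thin_cone (e : 'I_d -> R) (alpha t : R) y y' :=
  forall i, `|tnth y' i - tnth y i - t * e i| <= alpha * t.

(** [f] is a lower bound for the derivative of some small [phi], uniform over a cone of directions
    and over all steps up to [del]. The bounds [eps] and [B] are shared by the class, while [del]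
    and the Lipschitz constant of [f] are free: the class is convex, and bumps of every small scale
    belong to it. *)
Definition test_class (e : 'I_d -> R) (alpha B eps : R) f :=
  [/\ forall y, `|f y| <= 1, exists C, lip C f &
  exists phi : d.-tuple R -> R, [/\ forall y, `|phi y| <= eps, lip B phi &
    exists2 del : R, 0 < del & forall y y' t, 0 < t -> t <= del ->
      thin_cone e alpha t y y' -> f y * t <= phi y' - phi y]].

Lemma lipD C C' f g : lip C f -> lip C' g -> lip (C + C') (fun y => f y + g y).
Proof.
move=> Hf Hg x y c H; rewrite opprD addrACA mulrDl.
by rewrite (le_trans (ler_normD _ _))// lerD ?Hf ?Hg.
Qed.

Lemma lipZ C c f : lip C f -> lip (`|c| * C) (fun y => c * f y).
Proof. by move=> Hf x y r H; rewrite -mulrBr normrM -mulrA ler_wpM2l// Hf. Qed.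

Lemma lip_cst (c : R) : lip 0 (fun _ : d.-tuple R => c).
Proof. by move=> x y r _; rewrite subrr normr0 mul0r. Qed.

Lemma lip_sum N (P : pred nat) (F : nat -> d.-tuple R -> R) :
  (forall n, P n -> exists C, lip C (F n)) -> exists C, lip C (fun y => \sum_(n < N | P n) F n y).
Proof.
move=> H; elim: N => [|N [C HC]].
  by exists 0; under eq_fun do rewrite big_ord0; exact: lip_cst.
rewrite (_ : (fun _ => _) = fun y => \sum_(n < N | P n) F n y + (if P N then F N y else 0)); last first.
  by apply/funext => y; rewrite big_mkcond big_ord_recr/= -big_mkcond.
case: (boolP (P N)) => PN; last by exists (C + 0); exact: lipD (lip_cst _).
by have [C' HC'] := H _ PN; exists (C + C'); exact: lipD.
Qed.

Lemma test_class_convex e alpha B eps f g (t : R) : 0 <= t -> t <= 1 ->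
  test_class e alpha B eps f -> test_class e alpha B eps g ->
  test_class e alpha B eps (fun y => (1 - t) * f y + t * g y).
Proof.
move=> t0 t1 [f1 [Cf fC] [phi [phie phiB [del del0 Hdel]]]].
move=> [g1 [Cg gC] [psi [psie psiB [del' del0' Hdel']]]].
have t1' : 0 <= 1 - t by rewrite subr_ge0.
have conv (a b c : R) : `|a| <= c -> `|b| <= c -> `|(1 - t) * a + t * b| <= c.
  move=> ac bc; rewrite (le_trans (ler_normD _ _))// !normrM (ger0_norm t0) (ger0_norm t1').
  rewrite (_ : c = (1 - t) * c + t * c); last by ring.
  by rewrite lerD// ler_wpM2l.
split.
- by move=> y; exact: conv.
- by exists (`|1 - t| * Cf + `|t| * Cg); apply: lipD; exact: lipZ.
exists (fun y => (1 - t) * phi y + t * psi y); split.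
- by move=> y; exact: conv.
- move=> x y c H; have := phiB x y c H; have := psiB x y c H => h1 h2.
  have := conv _ _ _ h2 h1; rewrite !mulrBr; congr (`|_| <= _); ring.
- exists (Num.min del del'); first by rewrite lt_min del0.
  move=> y y' s s0; rewrite le_min => /andP[sd sd'] cone.
  have h1 := Hdel _ _ _ s0 sd cone; have h2 := Hdel' _ _ _ s0 sd' cone.
  have := lerD (ler_wpM2l t1' h1) (ler_wpM2l t0 h2); lra.
Qed.

Definition perp (e : 'I_d -> R) k x y : R :=
  \sum_i `|tnth y i - tnth x i - ucoord e k x y * e i|.

Lemma perp_ge0 e k x y : 0 <= perp e k x y.
Proof. by rewrite sumr_ge0. Qed.

Variables (e : 'I_d -> R) (k : 'I_d) (M L : R).
Hypotheses (M1 : 1 <= M) (eM : forall i, `|e i| <= M) (ekM : M^-1 <= `|e k|).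
Hypothesis (L4 : 4 <= L).

Let h : R := d%:R * (1 + M ^+ 2).

Lemma bump_scale_ge : 1 <= h /\ M <= h.
Proof.
have d1 : 1 <= d%:R :> R by rewrite ler1n (leq_ltn_trans _ (ltn_ord k)).
have H : 1 + M ^+ 2 <= h by rewrite /h ler_peMl// addr_ge0// sqr_ge0.
have := sqr_ge0 M; have := sqr_ge0 (M - 1); have := M1; split; lra.
Qed.
Let h1 : 1 <= h := bump_scale_ge.1.
Let Mh : M <= h := bump_scale_ge.2.
Let h0 : 0 < h. Proof. by apply: lt_le_trans h1. Qed.
Let M0 : 0 < M. Proof. by apply: lt_le_trans M1. Qed.

(** Since [|e k| >= 1 / M], the axis coordinate deviates from [t] by at most [M * c], and each of
    the [d] residuals changes by at most [c + M * (M * c)]. This is the origin of [h]. *)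
Lemma coord_dist x y y' t c : (forall i, `|tnth y' i - tnth y i - t * e i| <= c) ->
  `|ucoord e k x y' - ucoord e k x y - t| <= h * c /\
  `|perp e k x y' - perp e k x y| <= h * c.
Proof.
move=> H; have c0 : 0 <= c := le_trans (normr_ge0 _) (H k).
have ek0 : 0 < `|e k| by apply: lt_le_trans ekM; rewrite invr_gt0.
have ek : e k != 0 by rewrite -normr_gt0.
have Hu : `|ucoord e k x y' - ucoord e k x y - t| <= M * c.
  rewrite (_ : _ - _ = (tnth y' k - tnth y k - t * e k) / e k); last first.
    by rewrite /ucoord; field.
  rewrite normrM normfV mulrC ler_pM ?invr_ge0//.
  by rewrite -[leRHS]invrK lef_pV2 ?posrE ?invr_gt0.
split; first by rewrite (le_trans Hu)// ler_wpM2r.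
rewrite /perp -sumrB (le_trans (ler_norm_sum _ _ _))//.
apply: (@le_trans _ _ (\sum_(i < d) (1 + M ^+ 2) * c)); last first.
  by rewrite sumr_const card_ord -mulr_natl mulrA.
apply: ler_sum => i _; rewrite (le_trans (ler_dist_dist _ _))//.
rewrite (_ : _ - _ = (tnth y' i - tnth y i - t * e i) -
  (ucoord e k x y' - ucoord e k x y - t) * e i); last by ring.
rewrite (le_trans (ler_normB _ _))// [leRHS]mulrDl mul1r lerD// normrM.
by rewrite expr2 mulrAC ler_pM.
Qed.

(** The scale [h * rho] compensates the factor [h] of [coord_dist]: the cube of radius [rho] then
    lies in the core, where the slope is almost one half. *)
Definition gbump x rho y := bump (h * rho) L (ucoord e k x y) (perp e k x y).
Definition gslope x rho y := slope (h * rho) L (ucoord e k x y) (perp e k x y).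

(** The constant is [14 = 8 + 6], for the length and the width of the tube. *)
Lemma tube_cube x rho y : 0 <= rho ->
  `|ucoord e k x y| <= 8 * L * (h * rho) /\ perp e k x y <= 6 * (h * rho) ->
  cube x (14 * L * h * M * rho) y.
Proof.
move=> rho0 [Hu Hp] i.
have -> : tnth y i - tnth x i = ucoord e k x y * e i + (tnth y i - tnth x i - ucoord e k x y * e i).
  by ring.
have Hi : `|tnth y i - tnth x i - ucoord e k x y * e i| <= 6 * (h * rho).
  by apply: le_trans Hp; rewrite /perp (bigD1 i)//= lerDl sumr_ge0.
have hr : 0 <= h * rho by rewrite mulr_ge0// ltW.
have H1 : `|ucoord e k x y| * `|e i| <= 8 * L * (h * rho) * M by apply: ler_pM.
have H2 : 1 * (h * rho) <= L * M * (h * rho).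
  apply: ler_wpM2r => //; apply: (@le_trans _ _ (L * 1)); first by move: L4; lra.
  by rewrite ler_wpM2l//; move: L4; lra.
rewrite (le_trans (ler_normD _ _))// normrM; lra.
Qed.

Lemma gbump_supp x rho y : 0 < rho -> gbump x rho y != 0 ->
  cube x (14 * L * h * M * rho) y.
Proof.
move=> r0 H; apply: tube_cube (ltW r0) _; apply: bump_supp H => //.
- exact: mulr_gt0.
- exact: perp_ge0.
Qed.

Lemma gslope_supp x rho y : 0 < rho -> gslope x rho y != 0 ->
  (`|ucoord e k x y| <= 8 * L * (h * rho) /\ perp e k x y <= 6 * (h * rho)).
Proof.
move=> r0 H; apply: slope_supp H => //; first exact: mulr_gt0.
exact: perp_ge0.
Qed.

Lemma gslope_core x rho y : 0 < rho -> cube x rho y -> 2^-1 - 2 / L <= gslope x rho y.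
Proof.
move=> r0 H.
have [H1 H2] : `|ucoord e k x y - ucoord e k x x - 0| <= h * rho /\
    `|perp e k x y - perp e k x x| <= h * rho.
  by apply: coord_dist => i; rewrite mul0r subr0; exact: H.
have u0 : ucoord e k x x = 0 by rewrite /ucoord subrr mul0r.
have p0 : perp e k x x = 0.
  by rewrite /perp big1// => i _; rewrite u0 subrr mul0r subrr normr0.
rewrite u0 !subr0 in H1; rewrite p0 subr0 ger0_norm ?perp_ge0// in H2.
by apply: slope_core => //; exact: mulr_gt0.
Qed.

Section family.
Variables (N : nat) (P : pred nat) (xs : nat -> d.-tuple R) (rho : nat -> R) (rho0 : R).
Hypothesis Hrho : forall n, P n -> 0 < rho n <= rho0.
Hypothesis disj : forall n m, P n -> P m -> n != m ->
  cube (xs n) (14 * L * h * M * rho n) `&` cube (xs m) (14 * L * h * M * rho m) = set0.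

(** The bumps sit in disjoint cubes, so the sums inherit the size bounds of a single bump, whatever
    the number of terms. *)
Lemma bump_family_class (alpha : R) : 0 <= rho0 -> 0 <= alpha -> h * alpha <= 4^-1 ->
  2 * (h * alpha) * L <= 1 ->
  test_class e alpha (2 * h) (5 * (h * rho0))
    (fun y => \sum_(n < N | P n) gslope (xs n) (rho n) y).
Proof.
move=> r0 a0 a4 aL.
have rho_gt0 n : P n -> 0 < rho n by move=> /Hrho/andP[].
have Hgt0 n : P n -> 0 < h * rho n by move=> /rho_gt0; exact: mulr_gt0.
have notboth n m y : P n -> P m -> n != m ->
    cube (xs n) (14 * L * h * M * rho n) y -> cube (xs m) (14 * L * h * M * rho m) y -> False.
  move=> Pn Pm nm H1 H2.
  by have /seteqP[/(_ y) H _] := disj Pn Pm nm; apply: H.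
split.
- move=> y; apply: (@sum_le1 _ N P (fun n => gslope (xs n) (rho n) y)) => // [n Pn|n m Pn Pm nm].
    by apply: slope_norm_le => //; exact: Hgt0.
  have [|H1] := eqVneq (gslope (xs n) (rho n) y) 0; first by left.
  have [|H2] := eqVneq (gslope (xs m) (rho m) y) 0; first by right.
  exfalso; apply: (notboth n m y) => //; apply: tube_cube;
    by [apply: ltW; exact: rho_gt0 | apply: gslope_supp => //; exact: rho_gt0].
- apply: (@lip_sum N P (fun n => gslope (xs n) (rho n))) => n Pn; exists (4 * (h / (h * rho n))) => y y' c H.
  have [H1 H2] : `|ucoord e k (xs n) y' - ucoord e k (xs n) y - 0| <= h * c /\
      `|perp e k (xs n) y' - perp e k (xs n) y| <= h * c.
    by apply: coord_dist => i; rewrite mul0r subr0.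
  rewrite subr0 in H1.
  have := slope_dist (Hgt0 _ Pn) L4 H1 H2.
  by congr (_ <= _); ring.
pose phi y := \sum_(n < N | P n) gbump (xs n) (rho n) y.
have b0 n y : P n -> 0 <= gbump (xs n) (rho n) y <= 5 * (h * rho n).
  by move=> Pn; apply: bump_itv; rewrite ?perp_ge0 ?Hgt0.
have b1 n m y : P n -> P m -> n != m ->
    gbump (xs n) (rho n) y = 0 \/ gbump (xs m) (rho m) y = 0.
  move=> Pn Pm nm.
  have [|H1] := eqVneq (gbump (xs n) (rho n) y) 0; first by left.
  have [|H2] := eqVneq (gbump (xs m) (rho m) y) 0; first by right.
  by exfalso; apply: (notboth n m y) => //; apply: gbump_supp => //; exact: rho_gt0.
have phi0 y : 0 <= phi y by rewrite sumr_ge0// => n Pn; have /andP[] := b0 n y Pn.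
(* At most one bump is nonzero at [y'] and all are nonnegative at [y], so [phi] increases by no more
   than a single bump does. This makes the Lipschitz constant [2 * h] independent of the number and
   the sizes of the bumps. *)
have one y y' c : (forall i, `|tnth y' i - tnth y i| <= c) -> phi y' - phi y <= 2 * h * c.
  move=> H; have c0 : 0 <= c := le_trans (normr_ge0 _) (H k).
  have hc0 : 0 <= 2 * h * c by rewrite mulr_ge0// mulr_ge0// ltW.
  have [[n [Pn gn]]|H0] := pselect (exists n : 'I_N, P n /\ gbump (xs n) (rho n) y' != 0).
    have -> : phi y' = gbump (xs n) (rho n) y'.
      rewrite /phi (bigD1 n)//= big1 ?addr0// => m /andP[Pm mn].
      by have [//|/eqP] := b1 m n y' Pm Pn mn; rewrite (negbTE gn).
    have le1 : gbump (xs n) (rho n) y <= phi y.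
      rewrite /phi (bigD1 n)//= lerDl sumr_ge0// => m /andP[Pm _].
      by have /andP[] := b0 m y Pm.
    have [H1 H2] : `|ucoord e k (xs n) y' - ucoord e k (xs n) y - 0| <= h * c /\
        `|perp e k (xs n) y' - perp e k (xs n) y| <= h * c.
      by apply: coord_dist => i; rewrite mul0r subr0.
    rewrite subr0 in H1.
    have := bump_dist (Hgt0 _ Pn) L4 H1 H2.
    rewrite -/(gbump (xs n) (rho n) y') -/(gbump (xs n) (rho n) y) ler_norml => /andP[_].
    lra.
  have -> : phi y' = 0.
    rewrite /phi big1// => n Pn; apply/eqP; rewrite -[_ == _]negbK; apply/negP => gn.
    by apply: H0; exists n.
  by have := phi0 y; lra.
exists phi; split.
- move=> y; apply: (@sum_le1 _ N P (fun n => gbump (xs n) (rho n) y)) => [|n Pn|n m Pn Pm nm]; last exact: b1.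
    by rewrite mulr_ge0// mulr_ge0// ltW.
  have /andP[H1 H2] := b0 n y Pn; have /andP[_ H3] := Hrho Pn.
  rewrite ger0_norm// (le_trans H2)// ler_pM2l// ler_pM2l//.
- move=> y y' c H; rewrite ler_norml lerNl opprB; apply/andP; split.
    by apply: one => i; rewrite distrC.
  exact: one.
(* A positive common step exists because the family is finite. *)
have [del del0 Hdel] : exists2 del, 0 < del & forall n, (n < N)%N -> P n -> 4 * del <= h * rho n.
  elim: (N) => [|N' [del del0 IH]]; first by exists 1.
  have [PN|PN] := boolP (P N'); last first.
    exists del => // n; rewrite ltnS leq_eqVlt => /orP[/eqP->|]; last exact: IH.
    by rewrite (negbTE PN).
  exists (Num.min del (h * rho N' / 4)); first by rewrite lt_min del0 divr_gt0// Hgt0.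
  move=> n; rewrite ltnS leq_eqVlt => /orP[/eqP-> _|nN Pn].
    by rewrite mulrC -ler_pdivlMr// ge_min lexx orbT.
  by apply: le_trans (IH _ nN Pn); rewrite ler_pM2l// ge_min lexx.
exists del => // y y' t t0 td cone; rewrite mulr_suml /phi -sumrB; apply: ler_sum => n Pn.
have [H1 H2] := coord_dist (xs n) cone.
apply: (@slope_bump _ (h * rho n) L _ _ (h * alpha)) => //.
- exact: Hgt0.
- by rewrite mulr_ge0// ltW.
- by apply: le_trans (Hdel n (ltn_ord n) Pn); rewrite ler_pM2l.
- by rewrite -mulrA.
- by rewrite -mulrA.
Qed.

End family.
End bump_family.

(** * Frank-Wolfe iteration *)

Section bounded_measurable.
Context d0 (T : measurableType d0) (R : realType).
Implicit Types (f g : T -> R) (A D : set T).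

(** Such functions are integrable over every set of finite measure, so integrability need not be
    tracked along the computations. *)
Definition bm f := measurable_fun [set: T] f /\ exists C, forall x, `|f x| <= C.

Lemma bm_cst c : bm (fun=> c).
Proof. by split=> //; exists `|c|. Qed.

Lemma bm_indic A : measurable A -> bm (\1_A : T -> R).
Proof. by move=> mA; split=> //; exists 1 => x; rewrite indicE; case: (_ \in _); rewrite ?normr1 ?normr0. Qed.

Lemma bmD f g : bm f -> bm g -> bm (fun x => f x + g x).
Proof.
move=> [mf [C HC]] [mg [C' HC']]; split; first exact: measurable_funD.
by exists (C + C') => x; rewrite (le_trans (ler_normD _ _))// lerD.
Qed.

Lemma bmM f g : bm f -> bm g -> bm (fun x => f x * g x).
Proof.
move=> [mf [C HC]] [mg [C' HC']]; split; first exact: measurable_funM.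
by exists (C * C') => x; rewrite normrM ler_pM.
Qed.

Lemma bmZ c f : bm f -> bm (fun x => c * f x).
Proof. exact/bmM/bm_cst. Qed.

Lemma bmB f g : bm f -> bm g -> bm (fun x => f x - g x).
Proof.
move=> Hf Hg; have := bmD Hf (bmZ (-1) Hg).
by congr bm; apply/funext => x; rewrite mulN1r.
Qed.

Lemma bm_sum N (P : pred nat) (F : nat -> T -> R) :
  (forall n, P n -> bm (F n)) -> bm (fun x => \sum_(n < N | P n) F n x).
Proof.
move=> H; elim: N => [|N IH].
  by rewrite (_ : (fun _ => _) = fun=> 0); [exact: bm_cst|apply/funext => x; rewrite big_ord0].
rewrite (_ : (fun _ => _) = fun y => \sum_(n < N | P n) F n y + (if P N then F N y else 0)); last first.
  by apply/funext => y; rewrite big_mkcond big_ord_recr/= -big_mkcond.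
apply: bmD => //; case: (boolP (P N)) => PN; [exact: H|exact: bm_cst].
Qed.

Variable mu : {measure set T -> \bar R}.
Local Notation I D f := (\int[mu]_(x in D) f x).

Lemma bm_integrable D f : measurable D -> (mu D < +oo)%E -> bm f ->
  mu.-integrable D (EFin \o f).
Proof.
move=> mD Dfin [mf [C HC]]; apply: measurable_bounded_integrable => //.
  exact: measurable_funTS.
exists C; split; first exact: num_real.
by move=> r Cr x _; rewrite /= (le_trans (HC x))// ltW.
Qed.

Variable D : set T.
Hypotheses (mD : measurable D) (Dfin : (mu D < +oo)%E).

Lemma bmI_D f g : bm f -> bm g -> I D (fun x => f x + g x) = I D f + I D g.
Proof. by move=> Hf Hg; rewrite -RintegralD//; exact: bm_integrable. Qed.

Lemma bmI_Z c f : bm f -> I D (fun x => c * f x) = c * I D f.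
Proof. by move=> Hf; rewrite RintegralZl//; exact: bm_integrable. Qed.

Lemma bmI_B f g : bm f -> bm g -> I D (fun x => f x - g x) = I D f - I D g.
Proof. by move=> Hf Hg; rewrite -RintegralB//; exact: bm_integrable. Qed.

Lemma bmI_le f g : bm f -> bm g -> (forall x, D x -> f x <= g x) -> I D f <= I D g.
Proof. by move=> Hf Hg fg; apply: le_Rintegral => //; exact: bm_integrable. Qed.

Lemma bmI_indic A : measurable A -> I D (\1_A : T -> R) = fine (mu (A `&` D)).
Proof. by move=> mA; rewrite /Rintegral integral_indic. Qed.

Lemma bmI_sum N (P : pred nat) (F : nat -> T -> R) :
  (forall n, P n -> bm (F n)) ->
  I D (fun x => \sum_(n < N | P n) F n x) = \sum_(n < N | P n) I D (F n).
Proof.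
move=> H; elim: N => [|N IH].
  rewrite big_ord0 (_ : (fun _ => _) = fun=> 0).
    by rewrite Rintegral_cst// mul0r.
  by apply/funext => x; rewrite big_ord0.
rewrite big_mkcond big_ord_recr/= -big_mkcond -IH.
rewrite (_ : (fun _ => _) = fun y => \sum_(n < N | P n) F n y + (if P N then F N y else 0)); last first.
  by apply/funext => y; rewrite big_mkcond big_ord_recr/= -big_mkcond.
rewrite (@bmI_D _ (fun y => if P N then F N y else 0)); last 2 first.
- exact: bm_sum.
- case: (boolP (P N)) => PN; [exact: H|exact: bm_cst].
congr (_ + _); case: (P N) => //; by rewrite Rintegral_cst// mul0r.
Qed.

Lemma bmI_abs f C : bm f -> (forall x, D x -> `|f x| <= C) -> `|I D f| <= C * fine (mu D).
Proof.
move=> Hf fC; rewrite -Rintegral_cst// (le_trans (le_normr_Rintegral _ _))//.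
  exact: bm_integrable.
apply: le_Rintegral => //.
- by apply/integrable_norm/bm_integrable.
- exact/bm_integrable/bm_cst.
Qed.

Lemma bmI_subset A f : measurable A -> A `<=` D -> bm f ->
  I D f = I A f + I (D `\` A) f.
Proof.
move=> mA AD Hf; rewrite -Rintegral_setU//.
- by rewrite setDUK.
- exact: measurableD.
- by rewrite setDUK//; exact: bm_integrable.
- by apply/disj_setPS => x [Ax [_ nAx]].
Qed.

End bounded_measurable.

Section frank_wolfe.
Context {R : realType} {d : nat}.
Implicit Types (f g : d.-tuple R -> R).

Lemma lip_bm C C' f : lip C f -> (forall x, `|f x| <= C') -> bm f.
Proof. by move=> Hf H; split; [exact: measurable_lip Hf|exists C']. Qed.

Lemma test_class_bm e alpha B eps f : test_class e alpha B eps f -> bm f.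
Proof. by move=> [f1 [C HC] _]; exact: lip_bm HC f1. Qed.

Lemma lip_max0B (c C : R) f : lip C f -> lip C (fun x => Num.max (c - f x) 0).
Proof.
move=> Hf x y r H; apply: maxr_dist; last first.
  by rewrite subrr normr0; exact: le_trans (normr_ge0 _) (Hf x y r H).
by rewrite (_ : _ - _ = - (f y - f x)); [rewrite normrN; exact: Hf|ring].
Qed.

Variables (mu : {measure set (d.-tuple R) -> \bar R}) (D : set (d.-tuple R)).
Hypotheses (mD : measurable D) (Dfin : (mu D < +oo)%E).
Variables (e : 'I_d -> R) (alpha B kappa : R).
Hypothesis kappa0 : 0 < kappa.
Local Notation K eps := (test_class e alpha B eps).
Local Notation I f := (\int[mu]_(x in D) f x).

Let defect c f x : R := Num.max (c - f x) 0.

Lemma defect_itv c eps F x : 0 <= c -> K eps F -> 0 <= defect c F x <= c + 1.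
Proof.
move=> c0 [F1 _ _]; rewrite /defect le_max lexx orbT/= ge_max addr_ge0// andbT lerD2l.
by have := F1 x; rewrite ler_norml => /andP[? _]; rewrite lerNl.
Qed.

Lemma defect_bm c eps F : 0 <= c -> K eps F -> bm (defect c F).
Proof.
move=> c0 KF; have [_ [C /(lip_max0B c) HC] _] := KF.
apply: (@lip_bm C (c + 1)) => // x.
by have /andP[? ?] := defect_itv x c0 KF; rewrite ger0_norm.
Qed.

(** The right-hand side is [(Num.max a 0 - t * b)^2]. This is the descent inequality for the squared
    defect: a linear term weighted by the defect itself, and a quadratic error. *)
Lemma sqr_max0B (a b t : R) :
  Num.max (a - t * b) 0 ^+ 2 <=
  Num.max a 0 ^+ 2 - 2 * t * (Num.max a 0 * b) + t ^+ 2 * b ^+ 2.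
Proof.
have -> : Num.max a 0 ^+ 2 - 2 * t * (Num.max a 0 * b) + t ^+ 2 * b ^+ 2 =
  (Num.max a 0 - t * b) ^+ 2 by ring.
rewrite -[leRHS]real_normK ?num_real//.
apply: lerXn2r; rewrite ?nnegrE// ?le_max ?lexx ?orbT//.
rewrite ge_max normr_ge0 andbT (le_trans _ (ler_norm _))// lerD2r.
by rewrite le_max lexx.
Qed.

(* Frank-Wolfe: moving slightly from [F] towards a test function that is good
   against the weight [defect c F] decreases the squared defect. *)
Lemma frank_wolfe eps eta :
  (forall eps' tau g C G, 0 < eps' -> 0 < tau -> lip C g -> (forall x, 0 <= g x <= G) ->
    exists2 F, K eps' F & kappa * I g - tau <= I (fun x => F x * g x)) ->
  0 < eps -> 0 < eta ->
  exists2 F, K eps F & I (fun x => defect (kappa / 2) F x ^+ 2) <= eta.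
Proof.
move=> gain eps0 eta0; set c := kappa / 2.
have c0 : 0 < c by rewrite divr_gt0.
pose J F := I (fun x => defect c F x ^+ 2).
pose S := [set J F | F in K eps].
have J0 F : 0 <= J F by apply: Rintegral_ge0 => x _; exact: sqr_ge0.
have S0 : has_inf S.
  split; last by exists 0 => _ [F _ <-]; exact: J0.
  have [F KF _] := gain eps 1 (fun=> 0) 0 0 eps0 ltr01 (lip_cst 0) (fun=> introT andP (conj (lexx _) (lexx _))).
  by exists (J F); exists F.
have [ieta|etai] := ltP (inf S) eta.
  have /(inf_adherent) := S0 => /(_ (eta - inf S)).
  rewrite subr_gt0 => /(_ ieta) [_ [F KF <-]]; rewrite addrC subrK => HF.
  by exists F => //; exact: ltW.
pose m := inf S; have m0 : 0 < m by exact: lt_le_trans etai.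
pose V := fine (mu D); have V0 : 0 <= V by exact: fine_ge0.
(* At a near minimizer [F] the move towards [F'] has linear gain at least [t * (c1 * m)]. The step
   [t] is so small that the quadratic error [4 * t^2 * V] uses at most half of it, and [F] is so
   close to the infimum [m] that its excess is below the other half. *)
pose c1 := c / (c + 1).
have c10 : 0 < c1 by rewrite divr_gt0// addr_gt0.
pose t := Num.min 1 (c1 * m / (8 * (V + 1))).
have V1 : 0 < 8 * (V + 1) by rewrite mulr_gt0// ltr_wpDl.
have t0 : 0 < t by rewrite lt_min ltr01 divr_gt0// mulr_gt0.
have t1 : t <= 1 by rewrite ge_min lexx.
have tV : 4 * t ^+ 2 * V <= t * (c1 * m) / 2.
  have : t * (8 * (V + 1)) <= c1 * m by rewrite -ler_pdivlMr// ge_min lexx orbT.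
  move=> H; have : t * (t * (8 * (V + 1))) <= t * (c1 * m) by rewrite ler_pM2l.
  have : 0 <= t ^+ 2 by exact: sqr_ge0.
  lra.
have d0 : 0 < t * (c1 * m) / 2 by rewrite divr_gt0// mulr_gt0// mulr_gt0.
have [_ [F KF <-] HF] := inf_adherent d0 S0.
have [F1 [C HC] _] := KF.
have bF := test_class_bm KF.
pose g := defect c F.
have lg : lip C g by exact: lip_max0B.
have g01 x : 0 <= g x <= c + 1 by exact: defect_itv (ltW c0) KF.
have bg : bm g by exact: defect_bm (ltW c0) KF.
have tau0 : 0 < c1 * m / 2 by rewrite divr_gt0// mulr_gt0.
have [F' KF' HF'] := gain eps _ g C (c + 1) eps0 tau0 lg g01.
have bF' := test_class_bm KF'.
pose Ft x := (1 - t) * F x + t * F' x.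
have KFt : K eps Ft by apply: test_class_convex => //; exact: ltW.
have bFt := test_class_bm KFt.
have mJ : m <= J Ft by apply: ge_inf; [exact: S0.2|exists Ft].
pose b x := F' x - F x.
have bb : bm b by exact: bmB.
have b2 x : `|b x| <= 2.
  have [F'1 _ _] := KF'; rewrite (le_trans (ler_normB _ _))//.
  by have := F'1 x; have := F1 x; lra.
have H1 : J Ft <= J F - 2 * t * I (fun x => g x * b x) + t ^+ 2 * I (fun x => b x * b x).
  rewrite /J; have bgg : bm (fun x => g x * g x) by exact: bmM.
  have bgb : bm (fun x => g x * b x) by exact: bmM.
  have bbb : bm (fun x => b x * b x) by exact: bmM.
  have -> : I (fun x => defect c F x ^+ 2) = I (fun x => g x * g x) by [].
  rewrite -(bmI_Z mD Dfin (2 * t) bgb) -(bmI_Z mD Dfin (t ^+ 2) bbb).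
  rewrite -(bmI_B mD Dfin bgg (bmZ _ bgb)) -(bmI_D mD Dfin); last 2 first.
  - exact/bmB/bmZ.
  - exact: bmZ.
  apply: bmI_le => //.
  - have bdt := defect_bm (ltW c0) KFt.
    exact: (bmM bdt bdt).
  - by apply: bmD; [exact/bmB/bmZ|exact: bmZ].
  move=> x _; have := sqr_max0B (c - F x) (b x) t.
  rewrite /defect /Ft /g /defect -!expr2.
  have -> : c - F x - t * b x = c - ((1 - t) * F x + t * F' x) by rewrite /b; ring.
  by [].
have H2 : I (fun x => b x * b x) <= 4 * V.
  apply: le_trans (ler_norm _) _; apply: bmI_abs => //; first exact: bmM.
  move=> x _; rewrite normrM (_ : 4 = 2 * 2); last by ring.
  by rewrite ler_pM.
have H3 : I (fun x => g x * b x) = I (fun x => F' x * g x) - I (fun x => F x * g x).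
  rewrite -(bmI_B mD Dfin (bmM bF' bg) (bmM bF bg)).
  by congr (fine (integral _ _ _)); apply/funext => x; rewrite /b; congr (_%:E); ring.
(* Where the weight [g] is nonzero [F] is below [c], half of the rate [kappa] that [F'] achieves on
   average. *)
have H4 : I (fun x => F x * g x) <= c * I g.
  rewrite -(bmI_Z mD Dfin c bg); apply: bmI_le => //; [exact: bmM|exact: bmZ|].
  move=> x _; have /andP[g0 _] := g01 x; move: g0; rewrite /g /defect.
  by case: (leP (c - F x) 0) => h; rewrite ?mulr0// => ?; rewrite ler_wpM2r//; lra.
(* The weight is at most [c + 1], so its integral controls that of its square. *)
have H5 : c1 * J F <= c * I g.
  rewrite (_ : c * I g = c1 * ((c + 1) * I g)); last first.
    by rewrite /c1; field; rewrite gt_eqF// addr_gt0.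
  rewrite ler_pM2l// -(bmI_Z mD Dfin _ bg); apply: bmI_le => //; [exact: (bmM bg bg)|exact: bmZ|].
  by move=> x _; have /andP[g0 g1] := g01 x; rewrite expr2 ler_wpM2r.
have mF : m <= J F by apply: ge_inf; [exact: S0.2|exists F].
have H6 : c1 * m / 2 <= I (fun x => g x * b x).
  rewrite H3; have : c1 * m <= c1 * J F by rewrite ler_pM2l.
  have : kappa * I g = 2 * (c * I g) by rewrite /c; field.
  lra.
have H7 : 2 * t * (c1 * m / 2) <= 2 * t * I (fun x => g x * b x).
  by rewrite ler_pM2l// mulr_gt0.
have H8 : t ^+ 2 * I (fun x => b x * b x) <= t ^+ 2 * (4 * V).
  by rewrite ler_wpM2l// sqr_ge0.
exfalso; rewrite -/m in HF; lra.
Qed.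

(* Chebyshev and Borel-Cantelli turn the small defects into a set of full
   measure on which the test functions are eventually bounded below. *)
Lemma full_measure_tests : 
  (forall eps' tau g C G, 0 < eps' -> 0 < tau -> lip C g -> (forall x, 0 <= g x <= G) ->
    exists2 F, K eps' F & kappa * I g - tau <= I (fun x => F x * g x)) ->
  exists F : nat -> d.-tuple R -> R, (forall n, K (2^-1 ^+ n) (F n)) /\
    mu.-negligible (D `\` \bigcup_j \bigcap_(n in [set n | (j <= n)%N])
      [set x | kappa / 4 <= F n x]).
Proof.
move=> gain.
have c0 : 0 < kappa / 4 by rewrite divr_gt0.
(* Where [F < kappa / 4] the defect from [kappa / 2] exceeds [kappa / 4], so this bound leaves by
   Chebyshev an exceptional set of mass at most [2^-n]. *)
have H n : exists F, K (2^-1 ^+ n) F /\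
    I (fun x => defect (kappa / 2) F x ^+ 2) <= (kappa / 4) ^+ 2 * 2^-1 ^+ n.
  have e0 : 0 < 2^-1 ^+ n :> R by rewrite exprn_gt0// invr_gt0.
  have [F KF HF] := frank_wolfe gain e0 (mulr_gt0 (exprn_gt0 2 c0) e0).
  by exists F.
have {H} [F HF] := choice H.
exists F; split; first by move=> n; have [] := HF n.
have bF n : bm (F n) by exact: test_class_bm (HF n).1.
have mF n : measurable [set x | F n x < kappa / 4].
  rewrite (_ : [set _ | _] = F n @^-1` `]-oo, kappa / 4[%classic).
    by rewrite -[X in measurable X]setTI; exact: (bF n).1.
  by apply/seteqP; split => x /=; rewrite in_itv.
pose E n := D `&` [set x | F n x < kappa / 4].
have mE n : measurable (E n) by exact: measurableI.
have Efin n : (mu (E n) < +oo)%E.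
  by apply: le_lt_trans Dfin; apply: le_measure; rewrite ?inE//; exact: subIsetl.
have muE n : (mu (E n) <= (2^-1 ^+ n)%:E)%E.
  have c2 : 0 < (kappa / 4) ^+ 2 by exact: exprn_gt0.
  have kc : 0 <= kappa / 2 by rewrite divr_ge0// ltW.
  rewrite -[leLHS]fineK ?ge0_fin_numE// lee_fin -(ler_pM2l c2).
  apply: le_trans (HF n).2.
  have <- : I (\1_(E n) : _ -> R) = fine (mu (E n)).
    by rewrite bmI_indic//; congr (fine (mu _)); apply/setIidPl; exact: subIsetl.
  have bE := bm_indic R (mE n).
  have bd := defect_bm kc (HF n).1.
  rewrite -(bmI_Z mD Dfin _ bE); apply: bmI_le => //; first exact: bmZ.
    by under eq_fun do rewrite expr2; exact: bmM.
  move=> x _; rewrite indicE; have [|_] := boolP (x \in E n); last by rewrite mulr0 sqr_ge0.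
  rewrite inE => -[_ /= Fx]; rewrite mulr1; apply: lerXn2r; rewrite ?nnegrE ?(ltW c0)//.
    by have /andP[] := defect_itv x kc (HF n).1.
  by rewrite /defect le_max; apply/orP; left; move: Fx; lra.
have sE : (\sum_(0 <= n <oo) mu (E n) < +oo)%E.
  apply: le_lt_trans (le_trans _ (epsilon_trick0 xpredT (ler0n R 2))) (ltry _).
  apply: lee_nneseries => n *; first exact: measure_ge0.
  rewrite (le_trans (muE n))// lee_fin expnS natrM invfM mulVKf ?pnatr_eq0//.
  by rewrite natrX exprVn.
have := lim_sup_set_cvg0 mE sE => E0.
exists (lim_sup_set E); split => //.
  by apply: bigcap_measurable => // n _; exact: bigcup_measurable.
move=> x [Dx nx] n _ /=; apply: contrapT => nE; apply: nx.
exists n => // j /= nj; rewrite leNgt; apply/negP => Fx; apply: nE.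
by exists j => //; split.
Qed.

End frank_wolfe.

(** * Blow-up at thick points *)

Lemma small_measure d0 (T : measurableType d0) (R : realType)
    (mu : {measure set T -> \bar R}) (F : nat -> set T) (eta : R) :
  (forall n, measurable (F n)) -> (mu (F 0%N) < +oo)%E ->
  (forall n, F n.+1 `<=` F n) -> \bigcap_n F n = set0 -> 0 < eta ->
  exists n, (mu (F n) < eta%:E)%E.
Proof.
move=> mF F0 ndF F_0 eta0.
have niF : nonincreasing_seq F.
  by apply/nonincreasing_seqP => n; apply/subsetPset; exact: ndF.
have mcap : measurable (\bigcap_n F n) by rewrite F_0.
have := nonincreasing_cvg_mu F0 mF mcap niF.
rewrite F_0 measure0 => /fine_cvg /cvgr_lt /(_ _ eta0) [n _ /(_ n (leqnn n))] /= H.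
exists n; rewrite -[mu _]fineK ?lte_fin// ge0_fin_numE//.
apply: le_lt_trans F0; apply: le_measure; rewrite ?inE//.
by have /subsetPset := niF 0%N n (leq0n n).
Qed.

Lemma fine_le_r (R : realType) (x : \bar R) (r : R) : (0 <= x)%E -> (x <= r%:E)%E ->
  fine x <= r.
Proof.
by move=> x0 xr; rewrite -lee_fin fineK// ge0_fin_numE// (le_lt_trans xr)// ltry.
Qed.

Lemma exists_pos_forall (R : realType) n (f : 'I_n -> R) : (forall i, 0 < f i) ->
  exists2 r : R, 0 < r & forall i, r <= f i.
Proof.
move=> f0; pose S := 1 + \sum_i (f i)^-1.
have S0 : 0 < S by rewrite ltr_wpDr// sumr_ge0// => i _; rewrite invr_ge0 ltW.
exists S^-1; first by rewrite invr_gt0.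
move=> i; rewrite -[f i]invrK lef_pV2 ?posrE ?invr_gt0//.
rewrite /S (bigD1 i)//= addrCA lerDl addr_ge0// sumr_ge0// => j _.
by rewrite invr_ge0 ltW.
Qed.

Section thick.
Context {R : realType} {d : nat}.
Variable mu : {measure set (d.-tuple R) -> \bar R}.
Variable s : R.
Hypothesis s0 : 0 < s.
Implicit Types (x y : d.-tuple R) (c B del : R).

(** The strict inequalities, on the coordinates and on the mass, make this set open. Measurability
    of [thick_limsup] follows without studying the density as a function. *)
Definition thick c B del : set (d.-tuple R) :=
  [set x | (forall i, `|tnth x i| < B) /\
    exists2 r : R, 0 < r < del & ((c * r `^ s)%:E < mu (cube x r))%E].

Definition thick_limsup c B : set (d.-tuple R) :=
  \bigcap_j thick c B j.+1%:R^-1.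

(** A strict mass bound survives a slight enlargement of the radius from [r] to [r'], and the cube
    of radius [r'] about any [y] within [r' - r] of [x] contains the original cube. *)
Lemma thick_open c B del : 0 < c -> cube_open (thick c B del).
Proof.
move=> c0 x [xB [r /andP[r0 rd] Hr]].
have [h1 h10 h1B] : exists2 h : R, 0 < h & forall i, h <= B - `|tnth x i|.
  by apply: exists_pos_forall => i; rewrite subr_gt0.
have [r' /andP[rr' r'd] Hr'] : exists2 r', r < r' < del & ((c * r' `^ s)%:E < mu (cube x r))%E.
  have [v crv vm] : exists2 v : R, c * r `^ s < v & (v%:E <= mu (cube x r))%E.
    move: Hr; case: (mu (cube x r)) => [v||//]; first by rewrite lte_fin => H; exists v.
    by move=> _; exists (c * r `^ s + 1); rewrite ?ltrDl// leey.
  have v0 : 0 < v by apply: le_lt_trans crv; rewrite mulr_ge0 ?powR_ge0// ltW.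
  pose b := (v / c) `^ s^-1.
  have rb : r < b.
    have : r `^ s < v / c by rewrite ltr_pdivlMr// mulrC.
    have si0 : 0 < s^-1 by rewrite invr_gt0.
    move=> /(gt0_ltr_powR si0); rewrite !nnegrE powR_ge0 => /(_ isT).
    rewrite divr_ge0 ?(ltW v0) ?(ltW c0)// => /(_ isT).
    by rewrite -powRrM divff ?gt_eqF// powRr1 ?(ltW r0).
  pose m := Num.min b del.
  have rm : r < m by rewrite lt_min rb.
  exists ((r + m) / 2).
    have md : m <= del by rewrite ge_min lexx orbT.
    by apply/andP; split; move: rm md; lra.
  apply: lt_le_trans vm; rewrite lte_fin [ltLHS]mulrC -ltr_pdivlMr//.
  have mb : (r + m) / 2 < b.
    have mb : m <= b by rewrite ge_min lexx.
    by move: rm mb; lra.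
  have -> : v / c = b `^ s.
    by rewrite /b -powRrM mulVf ?gt_eqF// powRr1// divr_ge0// ltW.
  apply: gt0_ltr_powR => //; rewrite nnegrE ?powR_ge0//.
  by rewrite divr_ge0// addr_ge0// ltW// (lt_trans r0 rm).
exists (Num.min (h1 / 2) (r' - r)); first by rewrite lt_min divr_gt0// subr_gt0.
move=> y xy; split=> [i|].
  have yx : `|tnth y i - tnth x i| <= h1 / 2.
    by apply: le_trans (xy i) _; rewrite ge_min lexx.
  have := ler_normD (tnth y i - tnth x i) (tnth x i); rewrite subrK.
  have := h1B i; move: h10 yx; lra.
exists r'; first by rewrite r'd (lt_trans r0).
apply: lt_le_trans Hr' _; apply: le_measure; rewrite ?inE; try exact: measurable_cube.
move=> z xz; have := cube_trans (cubeC xy) xz; apply: cubeS.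
by rewrite -lerBrDr ge_min lexx orbT.
Qed.

Lemma measurable_thick c B del : 0 < c -> measurable (thick c B del).
Proof. by move=> c0; apply: measurable_cube_open; exact: thick_open. Qed.

Lemma measurable_thick_limsup c B : 0 < c -> measurable (thick_limsup c B).
Proof. by move=> c0; apply: bigcapT_measurable => j; exact: measurable_thick. Qed.

Lemma thick_subset c B del del' : del <= del' -> thick c B del `<=` thick c B del'.
Proof.
move=> dd x [xB [r /andP[r0 rd] H]]; split=> //; exists r => //.
by rewrite r0 (lt_le_trans rd).
Qed.

Lemma thick_box c B del : thick c B del `<=` box d B.
Proof. by move=> x [xB _] i; exact: ltW. Qed.

End thick.

(** * Gain of bumps against a weight *)

Section gain_estimates.
Context d0 (T : measurableType d0) (R : realType).
Variable mu : {measure set T -> \bar R}.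
Local Notation I D f := (\int[mu]_(x in D) f x).

(** Against the weight frozen at [gx] a bump gains at least [gx * (mu core / 2 - b * mu S)], because
    it costs at most [b] on its tube [S]; the bound on [b * mu S] leaves [gx * c1 / 4]. Freezing the
    weight costs [om * mu Q], since [f] has absolute value at most one. *)
Lemma core_gain (f g : T -> R) (core S Q D : set T) (b c1 gx om : R) :
  measurable core -> measurable S -> measurable Q -> measurable D -> (mu D < +oo)%E ->
  bm f -> bm g -> 0 <= b -> b < 2^-1 -> 0 <= gx -> 0 <= om -> Q `<=` D ->
  (forall y, core y -> 2^-1 - b <= f y) -> (forall y, - b <= f y) ->
  (forall y, f y <= 1) ->
  (forall y, f y != 0 -> S y /\ Q y) ->
  c1 <= fine (mu core) -> (mu S < +oo)%E -> b * fine (mu S) <= c1 / 4 ->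
  (forall y, Q y -> `|g y - gx| <= om) ->
  gx * (c1 / 4) - om * fine (mu Q) <= I D (fun y => f y * g y).
Proof.
move=> mC mS mQ mD Dfin bf bg b0 b2 gx0 om0 QD fC fb f1 fS C1 Sfin Sb gQ.
have CS y : core y -> S y /\ Q y.
  by move=> Cy; apply: fS; apply/eqP => f0; have := fC y Cy; rewrite f0; lra.
pose f1' y : R := 2^-1 * \1_core y - b * \1_S y.
pose f2 y : R := gx * f1' y - om * \1_Q y.
have bC := bm_indic R mC; have bS := bm_indic R mS; have bQ := bm_indic R mQ.
have bf1 : bm f1' by apply: bmB; exact: bmZ.
have bf2 : bm f2 by apply: bmB; exact: bmZ.
have H : I D f2 <= I D (fun y => f y * g y).
  apply: (bmI_le mD Dfin bf2 (bmM bf bg)) => y _.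
  have i1 (A : set T) : A y -> \1_A y = 1 :> R by move=> Ay; rewrite indicE mem_set.
  have i0 (A : set T) : ~ A y -> \1_A y = 0 :> R by move=> Ay; rewrite indicE memNset.
  rewrite /f2 /f1'.
  have [f0|/fS[Sy Qy]] := eqVneq (f y) 0.
    have nC : ~ core y by move=> /fC; rewrite f0; lra.
    rewrite f0 mul0r (i0 _ nC) mulr0 sub0r.
    have i1p (A : set T) : 0 <= \1_A y :> R by [].
    have : 0 <= gx * (b * \1_S y) by rewrite !mulr_ge0.
    have : 0 <= om * \1_Q y by rewrite mulr_ge0.
    lra.
  rewrite (i1 _ Sy) (i1 _ Qy) !mulr1.
  have e1 : f y * g y = gx * f y + f y * (g y - gx) by ring.
  have e2 : - om <= f y * (g y - gx).
    have : `|f y * (g y - gx)| <= 1 * om.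
      rewrite normrM; apply: ler_pM => //; last exact: gQ.
      by rewrite ler_norml f1 andbT; have := fb y; lra.
    by rewrite ler_norml mul1r => /andP[].
  have e3 : 2^-1 * \1_core y - b <= f y.
    have [Cy|nC] := pselect (core y); first by rewrite (i1 _ Cy) mulr1; exact: fC.
    by rewrite (i0 _ nC) mulr0 sub0r; exact: fb.
  have : gx * (2^-1 * \1_core y - b) <= gx * f y by rewrite ler_wpM2l.
  by rewrite e1; lra.
apply: le_trans H.
rewrite /f2 (bmI_B mD Dfin (bmZ _ bf1) (bmZ _ bQ)) (bmI_Z mD Dfin _ bf1) (bmI_Z mD Dfin _ bQ).
rewrite /f1' (bmI_B mD Dfin (bmZ _ bC) (bmZ _ bS)) (bmI_Z mD Dfin _ bC) (bmI_Z mD Dfin _ bS).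
rewrite !bmI_indic//.
have -> : core `&` D = core by apply/setIidPl => y /CS[_ /QD].
have -> : Q `&` D = Q by apply/setIidPl.
have SD : fine (mu (S `&` D)) <= fine (mu S).
  have H : (mu (S `&` D) <= mu S)%E by apply: le_measure; rewrite ?inE//; exact: measurableI.
  by apply: fine_le => //; rewrite ge0_fin_numE// (le_lt_trans H).
have bSD : b * fine (mu (S `&` D)) <= b * fine (mu S) by rewrite ler_wpM2l.
have : gx * (c1 / 4) <= gx * (2^-1 * fine (mu core) - b * fine (mu (S `&` D))).
  by rewrite ler_wpM2l//; move: bSD Sb C1; lra.
by lra.
Qed.

Lemma disjoint_mass N (P : pred nat) (Q : nat -> set T) (D : set T) :
  measurable D -> (mu D < +oo)%E -> (forall n, measurable (Q n)) ->
  (forall n, P n -> Q n `<=` D) ->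
  (forall n m, P n -> P m -> n != m -> Q n `&` Q m = set0) ->
  \sum_(n < N | P n) fine (mu (Q n)) <= fine (mu D).
Proof.
move=> mD Dfin mQ QD disj.
have bQ n : P n -> bm (\1_(Q n) : T -> R) by move=> _; exact: bm_indic.
have H : I D (fun x => \sum_(n < N | P n) \1_(Q n) x) <= I D (fun=> 1).
  apply: (bmI_le mD Dfin); [exact: (@bm_sum _ _ _ N P (fun n => \1_(Q n)))|exact: bm_cst|].
  move=> x _; apply: le_trans (ler_norm _) _.
  apply: (@sum_le1 _ N P (fun n => \1_(Q n) x)) => // [n _|n m Pn Pm nm].
    by rewrite indicE; case: (_ \in _); rewrite ?normr1 ?normr0.
  rewrite !indicE; have [/set_mem Qn|] := boolP (x \in Q n); last by left.
  have [/set_mem Qm|] := boolP (x \in Q m); last by right.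
  by have /seteqP[/(_ x) + _] := disj _ _ Pn Pm nm; case.
rewrite Rintegral_cst// mul1r in H; apply: le_trans H.
rewrite (bmI_sum mD Dfin N bQ) le_eqVlt; apply/orP; left; apply/eqP.
apply: eq_bigr => n Pn; rewrite bmI_indic//; congr (fine (mu _)).
by apply/esym/setIidPl; exact: QD.
Qed.

(** The numbers [m n] link two sums: the gains add up to about [\sum a n * m n / 4], while the
    tripled cubes cover almost all of [X], so that the integral of [g] is at most about
    [K4 * \sum a n * m n]. Their ratio is [kappa]; the errors come from [U] outside [X], from the
    uncovered part and from the oscillation of [g]. *)
Lemma family_gain N (P : pred nat) (f : nat -> T -> R) (g : T -> R) (Q Q3 : nat -> set T)
    (U X : set T) (a m : nat -> R) (K4 G eta om V kappa : R) :
  measurable U -> measurable X -> X `<=` U -> (mu U < +oo)%E -> fine (mu U) <= V ->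
  (forall n, measurable (Q n)) -> (forall n, measurable (Q3 n)) ->
  (forall n, P n -> Q n `<=` U) ->
  (forall n m, P n -> P m -> n != m -> Q n `&` Q m = set0) ->
  (forall n, P n -> bm (f n)) -> bm g -> 0 <= G -> (forall x, 0 <= g x <= G) ->
  (forall x, `|\sum_(n < N | P n) f n x| <= 1) ->
  (forall n, P n -> 0 <= a n) ->
  (forall n, P n -> 0 <= m n) ->
  (forall n, P n -> m n <= fine (mu (Q n))) ->
  (forall n, P n -> (mu (Q3 n) <= (K4 * m n)%:E)%E) ->
  0 <= kappa -> kappa * K4 = 4^-1 -> 0 <= om ->
  (forall n y, P n -> Q3 n y -> `|g y - a n| <= 3 * om) ->
  (mu (U `\` X) < eta%:E)%E ->
  (mu (X `\` \bigcup_(n in [set n | (n < N)%N /\ P n]) Q3 n) < eta%:E)%E ->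
  (forall n, P n -> a n * (m n / 4) - om * fine (mu (Q n)) <= I U (fun y => f n y * g y)) ->
  kappa * I X g - ((kappa + 1) * G * eta + 2 * (om * V)) <=
    I X (fun y => (\sum_(n < N | P n) f n y) * g y).
Proof.
move=> mU mX XU Ufin UV mQ mQ3 QU disj bf bg G0 gG F1 a0 m0 mQn Q3m kappa0 kK om0 gQ3 UX.
set W := X `\` _ => Weta gain.
have Xfin : (mu X < +oo)%E by apply: le_lt_trans Ufin; apply: le_measure; rewrite ?inE.
have mW : measurable W by apply: measurableD => //; apply: bigcup_measurable.
have mUX : measurable (U `\` X) by exact: measurableD.
have Wfin : (mu W < +oo)%E by apply: lt_trans Weta _; rewrite ltry.
have UXfin : (mu (U `\` X) < +oo)%E by apply: lt_trans UX _; rewrite ltry.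
have bF : bm (fun y => \sum_(n < N | P n) f n y) by exact: bm_sum.
have SQ : \sum_(n < N | P n) fine (mu (Q n)) <= V.
  by apply: le_trans UV; exact: disjoint_mass.
have Sm : \sum_(n < N | P n) m n <= V.
  by apply: le_trans SQ; apply: ler_sum => n Pn; exact: mQn.
have IU : \sum_(n < N | P n) a n * (m n / 4) - om * V <=
    I U (fun y => (\sum_(n < N | P n) f n y) * g y).
  have -> : (fun y => (\sum_(n < N | P n) f n y) * g y) =
      fun y => \sum_(n < N | P n) (f n y * g y).
    by apply/funext => y; rewrite mulr_suml.
  rewrite (@bmI_sum _ _ _ mu U mU Ufin N P (fun n y => f n y * g y)); last first.
    by move=> n Pn; apply: bmM => //; exact: bf.
  apply: (@le_trans _ _ (\sum_(n < N | P n) (a n * (m n / 4) - om * fine (mu (Q n))))).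
    by rewrite sumrB lerD2l lerN2 -mulr_sumr ler_wpM2l.
  by apply: ler_sum => n Pn; exact: gain.
have IX : I X g <= \sum_(n < N | P n) (a n + 3 * om) * (K4 * m n) + G * eta.
  pose g2 y : R := \sum_(n < N | P n) (a n + 3 * om) * \1_(Q3 n) y + G * \1_W y.
  have bQ n : P n -> bm (fun y => (a n + 3 * om) * \1_(Q3 n) y : R).
    by move=> _; apply: bmZ; exact: bm_indic.
  have bW : bm (fun y => G * \1_W y : R) by apply: bmZ; exact: bm_indic.
  have bs : bm (fun y => \sum_(n < N | P n) (a n + 3 * om) * \1_(Q3 n) y).
    exact: (@bm_sum _ _ _ N P (fun n y => (a n + 3 * om) * \1_(Q3 n) y)).
  have p0 n : P n -> 0 <= a n + 3 * om by move=> Pn; rewrite addr_ge0 ?a0// mulr_ge0.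
  apply: (@le_trans _ _ (I X g2)).
    apply: (bmI_le mX Xfin bg (bmD bs bW)) => y Xy; rewrite /g2.
    have S0 (R' : pred 'I_N) : (forall n, R' n -> P n) ->
        0 <= \sum_(n < N | R' n) (a n + 3 * om) * \1_(Q3 n) y.
      by move=> R'P; apply: sumr_ge0 => n /R'P Pn; rewrite mulr_ge0 ?p0.
    have [[n /= [nN Pn] Qn]|nQ] :=
        pselect ((\bigcup_(n in [set n | (n < N)%N /\ P n]) Q3 n) y).
      rewrite (bigD1 (Ordinal nN))//= [\1_(Q3 n) y]indicE mem_set// mulr1.
      have := S0 (fun i => P i && (i != Ordinal nN)) (fun i => fun H => (andP H).1).
      have : 0 <= G * \1_W y by rewrite mulr_ge0.
      by have := gQ3 n y Pn Qn; rewrite ler_norml => /andP[_]; lra.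
    have -> : \1_W y = 1 :> R by rewrite indicE mem_set.
    by rewrite mulr1; have := S0 P (fun i => id); have /andP[_] := gG y; lra.
  rewrite /g2 (bmI_D mX Xfin bs bW) (bmI_sum mX Xfin N bQ).
  rewrite (bmI_Z mX Xfin _ (bm_indic R mW)) bmI_indic//.
  apply: lerD.
    apply: ler_sum => n Pn; rewrite (bmI_Z mX Xfin _ (bm_indic R (mQ3 n))) bmI_indic//.
    rewrite ler_wpM2l ?p0//; apply: fine_le_r => //; apply: le_trans (Q3m n Pn).
    by apply: le_measure; rewrite ?inE//; exact: measurableI.
  rewrite ler_wpM2l//; apply: fine_le_r => //; apply: le_trans (ltW Weta).
  by apply: le_measure; rewrite ?inE//; exact: measurableI.
have bFg := bmM bF bg.
have IUX : I (U `\` X) (fun y => (\sum_(n < N | P n) f n y) * g y) <= G * eta.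
  apply: le_trans (ler_norm _) _.
  apply: (@le_trans _ _ (G * fine (mu (U `\` X)))).
    apply: bmI_abs => // x _; rewrite normrM -[G]mul1r; apply: ler_pM => //.
    by have /andP[g0 gG'] := gG x; rewrite ger0_norm.
  by rewrite ler_wpM2l//; apply: fine_le_r => //; exact: ltW.
rewrite (bmI_subset mU Ufin mX XU bFg) in IU.
have HK : kappa * I X g <= \sum_(n < N | P n) a n * (m n / 4) + 3 / 4 * (om * V) + kappa * (G * eta).
  apply: (@le_trans _ _ (kappa * (\sum_(n < N | P n) (a n + 3 * om) * (K4 * m n) + G * eta))).
    exact: ler_wpM2l.
  rewrite mulrDr lerD2r mulr_sumr.
  rewrite (_ : \sum_(n < N | P n) kappa * _ = \sum_(n < N | P n) (a n * (m n / 4) + 3 / 4 * (om * m n))).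
    rewrite big_split/= lerD2l -!mulr_sumr ler_wpM2l// ler_wpM2l//.
  by apply: eq_bigr => n Pn; transitivity ((kappa * K4) * (a n + 3 * om) * m n); [ring|rewrite kK; lra].
have oV : 0 <= om * V by rewrite mulr_ge0//; apply: le_trans SQ; exact: sumr_ge0.
rewrite [(kappa + 1) * G * eta](_ : _ = kappa * (G * eta) + G * eta); last by ring.
by lra.
Qed.

End gain_estimates.

Section blowup.
Context {R : realType} {d : nat}.
Variable mu : {measure set (d.-tuple R) -> \bar R}.
Variables (w K : R).
Hypotheses (d_gt0 : (0 < d)%N) (w0 : 0 < w) (w1 : w < 1) (K0 : 0 < K).
Hypothesis boxfin : forall B, (mu (box d B) < +oo)%E.
Hypothesis tube_bound : forall (e : 'I_d -> R) k x a b, e k != 0 ->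
  (forall i : 'I_d, (k < i)%N -> e i = 0) -> 0 < a -> 0 < b ->
  (mu (tube e k x a b) <= (K * (d%:R ^+ d * (`|e k| * a * b ^+ d.-1)) `^ w)%:E)%E.
Local Notation s := (d%:R * w).
Local Notation Int D f := (\int[mu]_(x in D) f x).

Let dR : 0 < d%:R :> R. Proof. by rewrite ltr0n. Qed.
Let s0 : 0 < s. Proof. exact: mulr_gt0. Qed.

Lemma powR_exprn (a : R) : 0 <= a -> (a ^+ d) `^ w = a `^ s.
Proof. by move=> a0; rewrite -powR_mulrn// -powRrM. Qed.

(** A cube lies in the tube of equal half-length and half-width along the first axis. *)
Lemma cube_bound x r : 0 < r ->
  (mu (cube x r) <= (K * (d%:R ^+ d) `^ w * r `^ s)%:E)%E.
Proof.
move=> r0; pose k : 'I_d := Ordinal d_gt0; pose e (i : 'I_d) : R := (i == k)%:R.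
have ek : e k = 1 by rewrite /e eqxx.
have := @tube_bound e k x r r; rewrite ek oner_eq0 normr1 mul1r -exprS prednK//.
have dd0 : 0 <= d%:R ^+ d :> R by rewrite exprn_ge0// ltW.
rewrite powRM ?exprn_ge0 ?(ltW r0)// (powR_exprn (ltW r0)) mulrA => H.
apply: le_trans (H isT _ r0 r0); last first.
  by move=> i ki; rewrite /e; case: eqP => // ik; move: ki; rewrite ik ltnn.
apply: le_measure; rewrite ?inE; [exact: measurable_cube|exact: measurable_tube|].
move=> y H'; have uE : ucoord e k x y = tnth y k - tnth x k by rewrite /ucoord ek divr1.
split; first by rewrite uE; exact: H'.
move=> i; rewrite uE /e; have [->|ik] := eqVneq i k.
  by rewrite mulr1 subrr normr0 ltW.
by rewrite mulr0 subr0; exact: H'.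
Qed.

Lemma tube_arith (t M h L r : R) : 0 <= t -> t <= M -> 0 <= h -> 0 <= L -> 0 <= r ->
  (d%:R ^+ d * (t * (8 * L * (h * r)) * (6 * (h * r)) ^+ d.-1)) `^ w <=
  (d%:R ^+ d * (M * 8 * h * (6 * h) ^+ d.-1)) `^ w * L `^ w * r `^ s.
Proof.
move=> t0 tM h0 L0 r0; have M0 := le_trans t0 tM.
have dd0 : 0 <= d%:R ^+ d :> R by rewrite exprn_ge0// ltW.
have p0 a : 0 <= a -> 0 <= a ^+ d.-1 :> R by move=> a0; rewrite exprn_ge0.
have C0 : 0 <= d%:R ^+ d * (M * 8 * h * (6 * h) ^+ d.-1).
  by rewrite mulr_ge0// mulr_ge0 ?p0 ?mulr_ge0 // mulr_ge0.
rewrite -(powR_exprn r0) -powRM// -powRM ?mulr_ge0 ?exprn_ge0 ?mulr_ge0 ?p0 ?mulr_ge0//.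
apply: ge0_ler_powR; rewrite ?nnegrE ?(ltW w0)//.
- by rewrite mulr_ge0// mulr_ge0 ?p0 ?mulr_ge0 // mulr_ge0.
- by rewrite mulr_ge0 ?exprn_ge0// mulr_ge0.
have -> : r ^+ d = r * r ^+ d.-1 by rewrite -exprS prednK.
rewrite mulrA exprMn [(h * r) ^+ _]exprMn [in leRHS]exprMn.
apply: (@le_trans _ _ (t * (8 * (L * (h * (r * (d%:R ^+ d * (6 ^+ d.-1 * (h ^+ d.-1 * r ^+ d.-1))))))))).
  by rewrite le_eqVlt; apply/orP; left; apply/eqP; ring.
apply: (@le_trans _ _ (M * (8 * (L * (h * (r * (d%:R ^+ d * (6 ^+ d.-1 * (h ^+ d.-1 * r ^+ d.-1))))))))).
  by rewrite ler_wpM2r// !mulr_ge0 ?p0.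
by rewrite le_eqVlt; apply/orP; left; apply/eqP; ring.
Qed.

Section gain.
Variables (c B M : R).
Hypotheses (c0 : 0 < c) (M1 : 1 <= M).
Local Notation X := (thick_limsup mu s c B).
Local Notation U j := (thick mu s c B j.+1%:R^-1).

(** Constants tied by equations, so that they stay opaque in the estimates. [Kt] bounds the mass of
    tubes, [Lam * rho] is the radius of a cube containing the whole bump, and [K3] bounds the mass
    of the tripled cubes, so that [kappa * (K3 / c) = 1 / 4]. [L >= 5] keeps [2 / L] below one half,
    and [alpha] gives equality in [2 * (h * alpha) * L <= 1]. *)
Variables h Kt L Lam K3 kappa alpha : R.
Hypotheses (hE : h = d%:R * (1 + M ^+ 2))
  (KtE : Kt = K * (d%:R ^+ d * (M * 8 * h * (6 * h) ^+ d.-1)) `^ w)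
  (LE : L = Num.max 5 ((8 * Kt / c) `^ (1 - w)^-1))
  (LamE : Lam = 14 * L * h * M)
  (K3E : K3 = K * (d%:R ^+ d) `^ w * (3 * Lam) `^ s)
  (kappaE : kappa = c / (4 * K3))
  (alphaE : alpha = (2 * h * L)^-1).

Let M0 : 0 < M. Proof. by apply: lt_le_trans M1. Qed.
Let h1 : 1 <= h /\ M <= h.
Proof. rewrite hE; exact: (bump_scale_ge (Ordinal d_gt0) M1). Qed.
Let h0 : 0 < h. Proof. by apply: lt_le_trans h1.1. Qed.
Let L5 : 5 <= L. Proof. by rewrite LE le_max lexx. Qed.
Let L4 : 4 <= L. Proof. by apply: le_trans L5; rewrite ler_nat. Qed.
Let L0 : 0 < L. Proof. by apply: lt_le_trans L5. Qed.
Let Lam0 : 0 < Lam. Proof. by rewrite LamE !mulr_gt0. Qed.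
Let K30 : 0 < K3. Proof. by rewrite K3E !mulr_gt0 ?powR_gt0 ?exprn_gt0 ?mulr_gt0. Qed.
Let kappa0 : 0 < kappa. Proof. by rewrite kappaE divr_gt0 ?mulr_gt0. Qed.
Let alpha0 : 0 < alpha. Proof. by rewrite alphaE invr_gt0 !mulr_gt0. Qed.
Let Kt0 : 0 < Kt.
Proof. by rewrite KtE mulr_gt0 ?powR_gt0 ?mulr_gt0 ?exprn_gt0 ?mulr_gt0. Qed.

(* The length-to-width ratio [L] of the tubes is chosen so that a tube carries
   much less mass than [L] disjoint thick cubes would. *)
Let L_large : 2 / L * (Kt * L `^ w) <= c / 4.
Proof.
have w10 : 0 < 1 - w by rewrite subr_gt0.
have u0 : 0 <= 8 * Kt / c by apply: divr_ge0; [apply: mulr_ge0 => //; exact: ltW | exact: ltW].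
have H : 8 * Kt / c <= L `^ (1 - w).
  rewrite -[leLHS](@powRr1 _ (8 * Kt / c))// -[X in _ `^ X](@mulVf _ (1 - w)) ?gt_eqF// powRrM.
  apply: ge0_ler_powR; rewrite ?nnegrE ?powR_ge0 ?(ltW w10) ?(ltW L0)//.
  by rewrite LE le_max lexx orbT.
have LL : L = L `^ (1 - w) * L `^ w.
  by rewrite -powRD ?subrK ?powRr1 ?(ltW L0)// oner_eq0.
have Lw : 0 < L `^ w by rewrite powR_gt0.
have H2 : 8 * Kt * L `^ w <= L * c.
  have -> : L * c = L `^ (1 - w) * c * L `^ w by rewrite mulrAC -LL.
  by rewrite ler_pM2r// -ler_pdivrMr.
have -> : 2 / L * (Kt * L `^ w) = 2 * Kt * L `^ w / L by ring.
by rewrite ler_pdivrMr//; lra.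
Qed.

Section direction.
Variables (e : 'I_d -> R) (k : 'I_d).
Hypotheses (eM : forall i, `|e i| <= M) (ekM : M^-1 <= `|e k|).
Hypothesis ek : forall i : 'I_d, (k < i)%N -> e i = 0.
Local Notation T x rho := (tube e k x (8 * L * (h * rho)) (6 * (h * rho))).

Let tube_mass x rho : 0 < rho -> (mu (T x rho) <= (Kt * L `^ w * rho `^ s)%:E)%E.
Proof.
move=> r0; have ek0 : 0 < `|e k| by apply: lt_le_trans ekM; rewrite invr_gt0.
have hr : 0 < h * rho by exact: mulr_gt0.
have H8 : 0 < 8 * L * (h * rho) by apply: mulr_gt0 => //; exact: mulr_gt0.
have H6 : 0 < 6 * (h * rho) by exact: mulr_gt0.
apply: (le_trans (tube_bound x _ ek H8 H6)); first by rewrite -normr_gt0.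
rewrite KtE lee_fin -!(mulrA K) ler_pM2l//.
by apply: tube_arith => //; exact: ltW.
Qed.

Let Lam1 rho : 0 < rho -> rho <= Lam * rho.
Proof.
move=> r0; rewrite ler_peMl ?(ltW r0)// LamE -mulrA.
have hM : 1 <= h * M by apply: mulr_ege1 => //; exact: h1.1.
by apply: mulr_ege1 => //; have := L4; lra.
Qed.

(** [U j] is an open neighbourhood of [X] with almost the same mass. Each point of [X] receives a
    thick radius so small that the cube containing its whole bump stays in [U j], and the Vitali
    selection is made on these large cubes. A finite number [N] of them already leaves little of [X]
    uncovered by the tripled cubes. *)
Lemma blowup_gain eps tau g C G : 0 < eps -> 0 < tau ->
  lip C g -> (forall x, 0 <= g x <= G) ->
  exists2 F, test_class e alpha (2 * h) eps F &
    kappa * Int X g - tau <= Int X (fun x => F x * g x).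
Proof.
move=> eps0 tau0 gC gG.
have G0 : 0 <= G by have /andP[/le_trans] := gG [tuple 0 | i < d]; exact.
have bg : bm g by apply: (lip_bm gC (C' := G)) => x; have /andP[? ?] := gG x; rewrite ger0_norm.
have mU j : measurable (U j) by exact: measurable_thick.
have mX : measurable X by exact: measurable_thick_limsup.
have XU j : X `<=` U j by move=> x; exact.
have UB j : U j `<=` box d B by exact: thick_box.
have Ufin j : (mu (U j) < +oo)%E.
  by apply: le_lt_trans (boxfin B); apply: le_measure; rewrite ?inE//; exact: measurable_box.
have Xfin : (mu X < +oo)%E.
  by apply: le_lt_trans (Ufin 0%N); apply: le_measure; rewrite ?inE//; exact: XU.
pose V := fine (mu (box d B)); have V0 : 0 <= V by exact: fine_ge0.
have fineV A : measurable A -> A `<=` box d B -> fine (mu A) <= V.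
  move=> mA AB; have H : (mu A <= mu (box d B))%E.
    by apply: le_measure; rewrite ?inE//; exact: measurable_box.
  by apply: fine_le => //; rewrite ge0_fin_numE// (le_lt_trans H).
pose eta := tau / (2 * (kappa + 1) * (G + 1)).
have k10 : 0 < 2 * (kappa + 1) by rewrite mulr_gt0// addr_gt0.
have G10 : 0 < G + 1 by rewrite ltr_wpDl.
have eta0 : 0 < eta by rewrite divr_gt0// mulr_gt0.
have etaE : (kappa + 1) * G * eta <= tau / 2.
  have : 2 * (kappa + 1) * (G + 1) * eta = tau.
    by rewrite /eta mulrC divfK// gt_eqF// mulr_gt0.
  have : 0 <= (kappa + 1) * eta by rewrite mulr_ge0 ?addr_ge0 ?ltW.
  lra.
have [j Hj] : exists j, (mu (U j `\` X) < eta%:E)%E.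
  apply: small_measure => //.
  - by move=> n; exact: measurableD.
  - apply: le_lt_trans (Ufin 0%N); apply: le_measure; rewrite ?inE//; exact: measurableD.
  - move=> n; apply: setSD; apply: thick_subset.
    by rewrite lef_pV2 ?posrE ?ltr0n// ler_nat.
  - apply/seteqP; split => // x Hx.
    by have [_ nX] := Hx 0%N I; apply: nX => i _; have [] := Hx i I.
pose Cw := (`|C| * Lam + 1) * (V + 1).
have Cw0 : 0 < Cw.
  by rewrite mulr_gt0// ltr_wpDl// mulr_ge0// ltW.
(* The first bound makes the bumps at most [eps] high; the second makes the oscillation of [g] on
   them cost at most [tau / 4]. *)
pose rho0 := Num.min (eps / (5 * h)) (tau / (4 * Cw)).
have C40 : 0 < 4 * Cw by exact: mulr_gt0.
have rho00 : 0 < rho0.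
  by rewrite lt_min; apply/andP; split; apply: divr_gt0 => //; exact: mulr_gt0.
pose om := `|C| * (Lam * rho0).
have om0 : 0 <= om by apply: mulr_ge0 => //; apply: mulr_ge0; exact: ltW.
have omV : om * V <= tau / 4.
  have H1 : rho0 * (4 * Cw) <= tau by rewrite -(ler_pdivlMr _ _ C40) ge_min lexx orbT.
  have : om * V <= rho0 * Cw.
    rewrite /om /Cw [leLHS](_ : _ = rho0 * (`|C| * Lam * V)); last by ring.
    rewrite ler_pM2l//; apply: ler_pM => //; rewrite ?lerDl//.
    by rewrite mulr_ge0// ltW.
  lra.
have Hrho x : exists rho, X x -> [/\ 0 < rho <= rho0,
    ((c * rho `^ s)%:E < mu (cube x rho))%E & cube x (Lam * rho) `<=` U j].
  have [Xx|nX] := pselect (X x); last by exists 0.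
  have [r r0 xr] := thick_open s0 c0 (XU j _ Xx).
  pose q := Num.min rho0 (r / Lam).
  have q0 : 0 < q by rewrite lt_min rho00 divr_gt0.
  pose i := Num.truncn q^-1.
  have iq : i.+1%:R^-1 <= q.
    by rewrite -[leRHS]invrK lef_pV2 ?posrE ?invr_gt0// ltW// truncnS_gt.
  have [_ [rho /andP[rr0 ri] Hm]] := Xx i I.
  have rq : rho <= q by apply: le_trans iq; exact: ltW.
  exists rho => _; split=> //.
    by rewrite rr0 (le_trans rq)// ge_min lexx.
  apply: subset_trans xr; apply: cubeS; rewrite mulrC -ler_pdivlMr//.
  by apply: le_trans rq _; rewrite ge_min lexx orbT.
have {Hrho} [rho Hrho] := choice Hrho.
have [|xs [P [PX disj cov]]] := @vitali_cubes _ _ X (fun x => Lam * rho x) (Lam * rho0).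
  by move=> x /Hrho[/andP[r0 rr] _ _]; rewrite mulr_gt0//= ler_pM2l.
pose rn n := rho (xs n).
have rn1 n : P n -> 0 < rn n <= rho0 by move=> /PX/Hrho[].
have rn0 n : P n -> 0 < rn n by move=> /rn1/andP[].
have rn_mass n : P n -> ((c * rn n `^ s)%:E < mu (cube (xs n) (rn n)))%E by move=> /PX/Hrho[].
have rn_sub n : P n -> cube (xs n) (Lam * rn n) `<=` U j by move=> /PX/Hrho[].
pose Q n := cube (xs n) (Lam * rn n).
pose Q3 n := cube (xs n) (3 * (Lam * rn n)).
have mQ n : measurable (Q n) by exact: measurable_cube.
have mQ3 n : measurable (Q3 n) by exact: measurable_cube.
pose W N := X `\` \bigcup_(n in [set n | (n < N)%N /\ P n]) Q3 n.
have mW N : measurable (W N).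
  by apply: measurableD => //; apply: bigcup_measurable => n _.
have [N HN] : exists N, (mu (W N) < eta%:E)%E.
  apply: small_measure => //.
  - apply: le_lt_trans Xfin; apply: le_measure; rewrite ?inE//.
    exact: subDsetl.
  - move=> n; apply: setDS; apply: bigcup_subset => m /= [mn Pm]; split => //.
    exact: ltnW.
  - apply/seteqP; split => // x Hx.
    have [Xx _] := Hx 0%N I; have [n Pn Qn] := cov x Xx.
    by have [_] := Hx n.+1 I; apply; exists n.
pose f n := gslope e k M L (xs n) (rn n).
pose F y := \sum_(n < N | P n) f n y.
have TF : test_class e alpha (2 * h) eps F.
  have ha : h * alpha = (2 * L)^-1.
    by rewrite alphaE; field; rewrite ?gt_eqF//.
  have := @bump_family_class _ _ e k M L M1 eM ekM L4 N P xs rn rho0 rn1.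
  rewrite -!hE -LamE => /(_ disj alpha (ltW rho00) (ltW alpha0)); rewrite ha.
  have L8 : (2 * L)^-1 <= 4^-1 by rewrite lef_pV2 ?posrE ?mulr_gt0//; have := L5; lra.
  have L21 : 2 * (2 * L)^-1 * L <= 1 by rewrite invfM mulrA divff// mul1r mulVf ?gt_eqF.
  move=> /(_ L8 L21)[F1 Flip [phi [phi1 phiL Hphi]]].
  split=> //; exists phi; split=> // y; apply: le_trans (phi1 y) _.
  have : rho0 <= eps / (5 * h) by rewrite ge_min lexx.
  by rewrite ler_pdivlMr ?mulr_gt0//; lra.
have hr0 n : P n -> 0 < h * rn n by move=> /rn0; exact: mulr_gt0.
have f1 n y : P n -> `|f n y| <= 1.
  by move=> /hr0 H; rewrite /f /gslope -hE; exact: slope_norm_le.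
have bf n : P n -> bm (f n).
  move=> Pn; apply: (@lip_bm _ _ (4 * (h / (h * rn n))) 1); last by move=> y; exact: f1.
  move=> y y' t H; rewrite /f /gslope -hE.
  have [H1 H2] : `|ucoord e k (xs n) y' - ucoord e k (xs n) y - 0| <= h * t /\
      `|perp e k (xs n) y' - perp e k (xs n) y| <= h * t.
    by rewrite hE; apply: coord_dist => // i; rewrite mul0r subr0.
  rewrite subr0 in H1; have := slope_dist (hr0 _ Pn) L4 H1 H2.
  by congr (_ <= _); ring.
have Qfin n : P n -> (mu (Q n) < +oo)%E.
  move=> Pn; apply: le_lt_trans (Ufin j); apply: le_measure; rewrite ?inE//.
  exact: rn_sub.
have coreQ n : P n -> cube (xs n) (rn n) `<=` Q n.
  by move=> Pn; apply: cubeS; apply: Lam1; exact: rn0.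
have core_mass n : P n -> c * rn n `^ s <= fine (mu (cube (xs n) (rn n))).
  move=> Pn; rewrite -lee_fin fineK; first exact/ltW/rn_mass.
  rewrite ge0_fin_numE//; apply: le_lt_trans (Qfin n Pn); apply: le_measure; rewrite ?inE//.
    exact: measurable_cube.
  exact: coreQ.
have F1 x : `|\sum_(n < N | P n) f n x| <= 1.
  by have [+ _ _] := TF; exact.
exists F => //.
have Vom : (kappa + 1) * G * eta + 2 * (om * V) <= tau by move: etaE omV; lra.
apply: (@le_trans _ _ (kappa * Int X g - ((kappa + 1) * G * eta + 2 * (om * V)))).
  by rewrite lerD2l lerN2.
apply: (@family_gain _ _ _ mu N P f g Q Q3 (U j) X (fun n => g (xs n)) (fun n => c * rn n `^ s)
  (K3 / c)) => //.
- exact: fineV.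
- by move=> n _; have /andP[] := gG (xs n).
- by move=> n _; rewrite mulr_ge0 ?powR_ge0 ?ltW.
- move=> n Pn; apply: le_trans (core_mass n Pn) _; apply: fine_le.
  + rewrite ge0_fin_numE//; apply: le_lt_trans (Qfin n Pn); apply: le_measure; rewrite ?inE//.
      exact: measurable_cube.
    exact: coreQ.
  + by rewrite ge0_fin_numE// Qfin.
  + by apply: le_measure; rewrite ?inE//; [exact: measurable_cube|exact: coreQ].
- move=> n Pn; apply: (le_trans (cube_bound _ _)); first by do 2 apply: mulr_gt0 => //; exact: rn0.
  have rp := ltW (rn0 n Pn); have lp := ltW Lam0.
  rewrite lee_fin mulrA powRM ?mulr_ge0// K3E le_eqVlt; apply/orP; left; apply/eqP.
  by field; rewrite gt_eqF.
- exact: ltW.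
- by rewrite kappaE; field; rewrite !gt_eqF.
- move=> n y Pn /gC /le_trans; apply.
  rewrite /om [leLHS](_ : _ = 3 * (C * (Lam * rn n))); last by ring.
  have rp := ltW (rn0 n Pn); have lp := ltW Lam0.
  rewrite ler_pM2l//; apply: (@le_trans _ _ (`|C| * (Lam * rn n))).
    by rewrite ler_wpM2r ?ler_norm// mulr_ge0.
  rewrite ler_wpM2l// ler_wpM2l//.
  by have /andP[] := rn1 n Pn.
move=> n Pn; have rp := rn0 n Pn.
have L20 : 0 <= 2 / L by rewrite divr_ge0// ltW.
have L22 : 2 / L < 2^-1 by rewrite ltr_pdivrMr//; have := L5; lra.
have Tm := tube_mass (xs n) rp.
apply: (@core_gain _ _ _ mu (f n) g (cube (xs n) (rn n)) (T (xs n) (rn n)) (Q n) (U j) (2 / L)) => //.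
- exact: measurable_cube.
- exact: measurable_tube.
- exact: bf.
- by have /andP[] := gG (xs n).
- exact: rn_sub.
- by move=> y Hy; exact: gslope_core.
- by move=> y; rewrite /f /gslope -hE; apply: slope_ge => //; exact: hr0.
- by move=> y; have := f1 n y Pn; rewrite ler_norml => /andP[].
- move=> y fy; have := gslope_supp M1 L4 rp fy; rewrite -hE => -[Hu Hp]; split.
    split=> // i; apply: le_trans Hp.
    by rewrite /perp (bigD1 i)//= lerDl sumr_ge0.
  rewrite /Q LamE hE; apply: (@tube_cube _ _ e k) => //; first exact: ltW.
  by rewrite -hE.
- exact: core_mass.
- by apply: le_lt_trans Tm _; rewrite ltry.
- have := fine_le_r (measure_ge0 _ _) Tm => Tm'.
  apply: (@le_trans _ _ (2 / L * (Kt * L `^ w * rn n `^ s))); first by rewrite ler_wpM2l.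
  by rewrite mulrA [leRHS]mulrAC; apply: ler_wpM2r L_large; exact: powR_ge0.
move=> y Qy; apply: le_trans (gC _ _ _ Qy) _; rewrite /om.
have lp := ltW Lam0; have r0 := ltW rp.
apply: (@le_trans _ _ (`|C| * (Lam * rn n))).
  by rewrite ler_wpM2r ?ler_norm// mulr_ge0.
rewrite ler_wpM2l// ler_wpM2l//.
by have /andP[] := rn1 n Pn.
Qed.

End direction.
End gain.

(** The order of the quantifiers matters: [alpha], [kappa] and [Bc] depend on [e] only through the
    bound [M], so a velocity can later be approximated by a rational direction to within an accuracy
    known in advance. *)
Lemma directional_tests (c M : R) : 0 < c -> 1 <= M ->
  exists alpha kappa Bc, [/\ 0 < alpha, 0 < kappa & forall B (e : 'I_d -> R) k,
    (forall i, `|e i| <= M) -> M^-1 <= `|e k| -> (forall i : 'I_d, (k < i)%N -> e i = 0) ->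
    exists F : nat -> d.-tuple R -> R, (forall n, test_class e alpha Bc (2^-1 ^+ n) (F n)) /\
      mu.-negligible (thick_limsup mu s c B `\` \bigcup_j \bigcap_(n in [set n | (j <= n)%N])
        [set x | kappa <= F n x])].
Proof.
move=> c0 M1; have M0 : 0 < M by exact: lt_le_trans M1.
pose h : R := d%:R * (1 + M ^+ 2).
pose Kt : R := K * (d%:R ^+ d * (M * 8 * h * (6 * h) ^+ d.-1)) `^ w.
pose L : R := Num.max 5 ((8 * Kt / c) `^ (1 - w)^-1).
pose Lam : R := 14 * L * h * M.
pose K3 : R := K * (d%:R ^+ d) `^ w * (3 * Lam) `^ s.
pose kappa : R := c / (4 * K3).
have h0 : 0 < h by apply: mulr_gt0 => //; rewrite ltr_wpDr ?sqr_ge0.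
have L0 : 0 < L by rewrite lt_max ltr0n.
have Lam0 : 0 < Lam by apply: mulr_gt0 => //; apply: mulr_gt0 => //; exact: mulr_gt0.
have kappa0 : 0 < kappa.
  apply: divr_gt0 => //; apply: mulr_gt0 => //; apply: mulr_gt0; last first.
    by apply: powR_gt0; exact: mulr_gt0.
  by apply: mulr_gt0 => //; apply: powR_gt0; exact: exprn_gt0.
exists (2 * h * L)^-1, (kappa / 4), (2 * h); split.
- by rewrite invr_gt0; apply: mulr_gt0 => //; exact: mulr_gt0.
- exact: divr_gt0.
move=> B e k eM ekM ek.
have mX := measurable_thick_limsup mu s0 B c0.
apply: (@full_measure_tests _ _ mu _ mX) => //.
  apply: le_lt_trans (boxfin B); apply: le_measure; rewrite ?inE//; first exact: measurable_box.
  by move=> x Hx; exact: thick_box (Hx 0%N Logic.I).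
move=> eps' tau g C G e0 t0 gC gG.
exact: (@blowup_gain c B M c0 M1 h Kt L Lam K3 kappa _ erefl erefl erefl erefl erefl erefl erefl
  e k eM ekM ek eps' tau g C G e0 t0 gC gG).
Qed.

End blowup.

(** * Lipschitz functions on the line *)

Section lebesgue_line.
Context {R : realType}.
Local Notation leb := (@lebesgue_measure R).
Implicit Types (f g : R -> R) (a b c C t x : R).

Lemma null_cover (A : set R) eps : leb A = 0%E -> 0 < eps ->
  exists a b : nat -> R, [/\ forall k, a k <= b k, A `<=` \bigcup_k `]a k, b k]%classic &
    (\sum_(k <oo) (b k - a k)%:E <= eps%:E)%E].
Proof.
move=> A0 e0.
have : (leb A < eps%:E)%E by rewrite A0 lte_fin.
rewrite /lebesgue_measure /lebesgue_stieltjes_measure /measure_extension /mu_ext.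
move=> /ereal_inf_lt[_ [F [mF AF] <-]] HF.
have H k : exists p : R * R, p.1 <= p.2 /\ F k = `]p.1, p.2]%classic.
  have /ocitvP[->|[p p12 ->]] := mF k; last by exists p; split=> //; exact: ltW.
  by exists (0, 0); rewrite set_itv_ge// bnd_simp ltxx.
have {H} [p Hp] := choice H.
exists (fun k => (p k).1), (fun k => (p k).2); split=> [k|x /AF[k _]|].
- by have [] := Hp k.
- by have [_ ->] := Hp k; exists k.
apply: ltW; apply: le_lt_trans HF; apply: lee_nneseries => k _.
  by rewrite lee_fin subr_ge0; have [] := Hp k.
have [p12 ->] := Hp k; have /= <- := @wlength_itv_bnd R idfun _ _ false false p12; exact: lexx.
Qed.

Lemma stieltjes_itv (F : cumulative R R) a b : a <= b ->
  lebesgue_stieltjes_measure F `]a, b]%classic = (F b - F a)%:E.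
Proof.
move=> ab; rewrite /lebesgue_stieltjes_measure /measure_extension.
by rewrite measurable_mu_extE/= ?wlength_itv_bnd//; exact: is_ocitv.
Qed.

Lemma leb_itvoc a b : a <= b -> leb `]a, b]%classic = (b - a)%:E.
Proof. exact: (@stieltjes_itv idfun). Qed.

(** Intervals of small total length that cover a null set have a total Stieltjes mass at most [C]
    times as large. *)
Lemma stieltjes_dominated (F : cumulative R R) C :
  (forall a b, a <= b -> F b - F a <= C * (b - a)) ->
  lebesgue_stieltjes_measure F `<< leb.
Proof.
move=> FC; apply/null_content_dominatesP => A mA A0.
have C0 : 0 <= C.
  have := FC 0 1 ler01; rewrite subr0 mulr1; apply: le_trans.
  by rewrite subr_ge0 cumulative_is_nondecreasing.
apply/eqP; rewrite -measure_le0; apply/lee_addgt0Pr => eps e0; rewrite add0e.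
have e1 : 0 < eps / (C + 1) by rewrite divr_gt0// ltr_wpDl.
have [a [b [ab AU Hs]]] := null_cover A0 e1.
apply: (@le_trans _ _ (\sum_(k <oo) lebesgue_stieltjes_measure F `]a k, b k]%classic)%E).
  by apply: measure_sigma_subadditive => // k; exact: measurable_itv.
apply: (@le_trans _ _ (\sum_(k <oo) (C%:E * (b k - a k)%:E))%E).
  apply: lee_nneseries => k _ //.
  by rewrite stieltjes_itv// -EFinM lee_fin FC.
rewrite nneseriesZl; last by move=> k _; rewrite lee_fin subr_ge0.
apply: (@le_trans _ _ (C%:E * (eps / (C + 1))%:E)%E).
  by apply: lee_pmul => //; apply: nneseries_ge0 => k _; rewrite lee_fin subr_ge0.
rewrite -EFinM lee_fin mulrA ler_pdivrMr ?ltr_wpDl//.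
by rewrite mulrDr mulr1 mulrC lerDl ltW.
Qed.

(** Restricting the Stieltjes measure to []-n, n]] makes it finite, so its Radon-Nikodym density is
    integrable on the whole line. *)
Lemma stieltjes_density (F : cumulative R R) C n : 0 < n ->
  (forall a b, a <= b -> F b - F a <= C * (b - a)) ->
  exists2 h : R -> R, leb.-integrable setT (EFin \o h) &
    forall a b, - n <= a -> a <= b -> b <= n -> F b - F a = \int[leb]_(x in `]a, b]) h x.
Proof.
move=> n0 FC; pose D : set (measurableTypeR R) := `]- n, n]%classic.
have mD : measurable D by exact: measurable_itv.
have nn : - n <= n by lra.
have Dfin : (lebesgue_stieltjes_measure F D < +oo)%E by rewrite stieltjes_itv// ltry.
have dom : mfrestr mD Dfin `<< leb.
  have /null_content_dominatesP H : lebesgue_stieltjes_measure F `<< leb by exact: stieltjes_dominated FC.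
  apply/null_content_dominatesP => A mA A0; apply: (@subset_measure0 _ _ _ (lebesgue_stieltjes_measure F) _ A) => //.
  - exact: measurableI.
  - exact: H.
have [h [h0 hfin hint hE]] := @radon_nikodym_sigma_finite _ _ R leb (mfrestr mD Dfin) dom.
exists (fine \o h).
  by apply: eq_integrable hint => // x _; rewrite /= fineK.
move=> a b na ab bn; rewrite /Rintegral.
have -> : (\int[leb]_(x in `]a, b]) ((fine \o h) x)%:E = \int[leb]_(x in `]a, b]) h x)%E.
  by apply: eq_integral => x _; rewrite /= fineK.
have := hE `]a, b]%classic (measurable_itv _); rewrite /= /mfrestr /mrestr => <-.
have -> : `]a, b]%classic `&` D = `]a, b]%classic.
  by apply/setIidPl; apply: subset_itv; rewrite bnd_simp.
by rewrite stieltjes_itv.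
Qed.

Lemma lip_continuous f C : (forall s t, `|f s - f t| <= C * `|s - t|) -> continuous f.
Proof.
move=> fC; have C0 : 0 <= C by have := le_trans (normr_ge0 _) (fC 1 0); rewrite subr0 normr1 mulr1.
move=> x; apply/(@cvgrPdist_le _ R^o) => e e0; have C1 : 0 < C + 1 by rewrite ltr_wpDl.
near=> y; apply: le_trans (fC _ _) _.
apply: (@le_trans _ _ ((C + 1) * `|x - y|)); first by rewrite ler_wpM2r// lerDl.
rewrite -ler_pdivlMl// mulrC; near: y.
by apply: cvgr_dist_le; [exact: cvg_id|exact: divr_gt0].
Unshelve. all: by end_near. Qed.

(** Differentiability at [t] with derivative [c], written without a quotient so that [h = 0] needs
    no exception. *)
Definition has_slope f t c :=
  forall eps, 0 < eps -> exists2 del, 0 < del &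
    forall h, `|h| < del -> `|f (t + h) - f t - c * h| <= eps * `|h|.

Lemma has_slope_ge f t c m : has_slope f t c ->
  (exists2 del, 0 < del & forall h, 0 < h -> h < del -> m * h <= f (t + h) - f t) -> m <= c.
Proof.
move=> fc [del del0 H]; apply/ler_addgt0Pr => eps e0.
have [del' del0' H'] := fc eps e0.
pose h := Num.min del del' / 2.
have m0 : 0 < Num.min del del' by rewrite lt_min del0.
have h0 : 0 < h by rewrite divr_gt0.
have hm : h < Num.min del del' by rewrite /h; lra.
have hd : h < del by apply: lt_le_trans hm _; rewrite ge_min lexx.
have hd' : `|h| < del' by rewrite ger0_norm ?(ltW h0)//; apply: lt_le_trans hm _; rewrite ge_min lexx orbT.
rewrite -(ler_pM2r h0); have := H h h0 hd; have := H' h hd'.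
by rewrite (ger0_norm (ltW h0)) ler_norml => /andP[? ?]; lra.
Qed.

(* The Stieltjes measure of [f t + C t] is dominated by Lebesgue measure, and
   its Radon-Nikodym density is the derivative at Lebesgue points. *)
Lemma lip_density f C n : 0 < n -> (forall s t, `|f s - f t| <= C * `|s - t|) ->
  exists (g : R -> R) (N : set R), [/\ leb.-integrable setT (EFin \o g),
    measurable N, leb N = 0%E,
    forall a b, - n <= a -> a <= b -> b <= n -> f b - f a = \int[leb]_(x in `]a, b]) g x &
    forall t, - n < t < n -> ~ N t -> has_slope f t (g t)].
Proof.
move=> n0 fC; pose F0 t := f t + C * t.
have C0 : 0 <= C by have := le_trans (normr_ge0 _) (fC 1 0); rewrite subr0 normr1 mulr1.
have F0nd : nondecreasing F0.
  move=> s t st; rewrite /F0; have := fC t s; rewrite [in leRHS]ger0_norm ?subr_ge0//.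
  by rewrite ler_norml => /andP[]; lra.
have fcont := lip_continuous fC.
have F0rc : right_continuous F0.
  apply: right_continuousW => x; apply: cvgD; first exact: fcont.
  by apply: cvgM; [exact: cvg_cst|exact: cvg_id].
pose F : cumulative R R := HB.pack F0 (isCumulative.Build R _ R F0 F0nd F0rc).
have FC a b : a <= b -> F b - F a <= 2 * C * (b - a).
  move=> ab; rewrite /F /= /F0.
  have := fC b a; rewrite [in leRHS]ger0_norm ?subr_ge0//.
  by rewrite ler_norml => /andP[]; lra.
have [h hint hE] := stieltjes_density n0 FC.
pose D : set R := `]- n, n]%classic.
pose g t : R := h t - C * \1_D t.
have DE : leb D = (2 * n)%:E.
  by rewrite /D leb_itvoc ?opprK ?mulr2n ?mulrDl ?mul1r//; lra.
have mD : measurable D by exact: measurable_itv.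
have iD : leb.-integrable setT (EFin \o (fun t => C * \1_D t)).
  rewrite (_ : EFin \o _ = fun t => (C%:E * (EFin \o \1_D) t)%E); last exact/funext.
  by apply: integrableZl => //; exact: integrable_indic_itv.
have ig : leb.-integrable setT (EFin \o g).
  rewrite (_ : EFin \o g = (EFin \o h) \- (fun t => (C * \1_D t)%R%:E))%E; last exact/funext.
  exact: (integrableB _ hint iD).
have gE a b : - n <= a -> a <= b -> b <= n -> f b - f a = \int[leb]_(x in `]a, b]) g x.
  move=> na ab bn.
  have mab : measurable (`]a, b]%classic : set R) by exact: measurable_itv.
  rewrite RintegralB//; try exact: integrableS ig; try exact: integrableS hint; try exact: integrableS iD.
  rewrite -hE// /F /= /F0.
  have -> : \int[leb]_(x in `]a, b]) (C * \1_D x) = C * (b - a).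
    rewrite (@eq_Rintegral _ _ _ leb _ (fun=> C)); last first.
      move=> x; rewrite inE/= in_itv/= => /andP[ax xb].
      rewrite indicE mem_set ?mulr1// /D /= in_itv/=.
      by rewrite (le_lt_trans na ax) (le_trans xb bn).
    transitivity (C * fine (leb `]a, b]%classic)); first exact: Rintegral_cst.
    by rewrite leb_itvoc.
  by ring.
have [N [mN N0 NP]] := lebesgue_differentiation (open_integrable_locally openT ig).
exists g, N; split=> // t /andP[nt tn] Nt eps e0.
have Lt : lebesgue_pt g t by apply: contrapT => H; apply: Nt; exact: NP.
have [||dF dE] := @FTC1_lebesgue_pt R g (BRight (- n)) t n tn _ _ Lt.
- exact: integrableS ig.
- exact: nt.
move: dF dE; set G := (fun y => _) => dF dE.
have cG : h^-1 *: (G (h *: 1 + t) - G t) @[h --> 0^'] --> g t.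
  by move/derivableP: dF => /[dup] H1; rewrite -dE derive1E; case.
have [d1 /= d10 H1] := (@cvgrPdist_le _ R^o _ _ _ _ _).1 cG eps e0.
pose d2 := Num.min d1 (Num.min (n - t) (t + n)).
exists d2; first by rewrite !lt_min d10 subr_gt0 tn/= -ltrBlDr sub0r.
move=> k kd; have [->|k0] := eqVneq k 0; first by rewrite addr0 mulr0 !subrr normr0 mulr0.
have kd1 : `|k| < d1 by apply: lt_le_trans kd _; rewrite ge_min lexx.
have [kn1 kn2] : - n < t + k /\ t + k < n.
  have : `|k| < n - t by apply: lt_le_trans kd _; rewrite !ge_min lexx orbT.
  have : `|k| < t + n by apply: lt_le_trans kd _; rewrite !ge_min lexx !orbT.
  by rewrite !ltr_norml => /andP[? ?] /andP[? ?]; split; lra.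
have GE y : - n < y -> y < n -> G y = f y - f (- n).
  by move=> y1 y2; rewrite gE// ?ltW.
have := H1 k; rewrite /= sub0r normrN => /(_ kd1 k0).
rewrite [k *: 1]mulr1 [k + t]addrC !GE// /GRing.scale/=.
move=> H; have k0' : 0 < `|k| by rewrite normr_gt0.
have -> : f (t + k) - f t - g t * k = - (k * (g t - k^-1 * (f (t + k) - f (- n) - (f t - f (- n))))).
  by field.
by rewrite normrN normrM mulrC ler_wpM2r.
Qed.

(** The increment is the integral of the almost everywhere derivative, which is at least [kappa] on
    [A] and at least [- C] elsewhere. *)
Lemma lip_increment_ge f C n (A : set R) kappa a b : 0 < n ->
  (forall s t, `|f s - f t| <= C * `|s - t|) -> measurable A ->
  (forall t, A t ->
    exists2 del, 0 < del & forall h, 0 < h -> h < del -> kappa * h <= f (t + h) - f t) ->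
  - n <= a -> a <= b -> b < n ->
  kappa * fine (leb (A `&` `]a, b])) - C * fine (leb (`]a, b] `\` A)) <= f b - f a.
Proof.
move=> n0 fC mA HA na ab bn.
have [g [N [ig mN N0 gE gs]]] := lip_density n0 fC.
rewrite (gE _ _ na ab (ltW bn)).
pose low t := kappa * \1_A t - C * \1_(~` A) t.
have mI : measurable (`]a, b]%classic : set (measurableTypeR R)) by exact: measurable_itv.
have Ifin : (leb `]a, b]%classic < +oo)%E by rewrite leb_itvoc// ltry.
have mA' : measurable (A : set (measurableTypeR R)) by exact: mA.
have mAC : measurable (~` A : set (measurableTypeR R)) by exact: measurableC.
have bA : bm (\1_A : measurableTypeR R -> R) by exact: bm_indic.
have bAC : bm (\1_(~` A) : measurableTypeR R -> R) by exact: bm_indic.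
have bl : bm (low : measurableTypeR R -> R) by apply: bmB; exact: bmZ.
have -> : kappa * fine (leb (A `&` `]a, b])) - C * fine (leb (`]a, b] `\` A)) =
    \int[leb]_(x in `]a, b]) low x.
  apply/esym; etransitivity; first exact: (bmI_B mI Ifin (bmZ kappa bA) (bmZ C bAC)).
  congr (_ - _).
    by etransitivity; [exact: (bmI_Z mI Ifin kappa bA)|congr (_ * _); exact: bmI_indic].
  etransitivity; first exact: (bmI_Z mI Ifin C bAC).
  by congr (_ * _); rewrite setDE setIC; exact: bmI_indic.
have mN' : measurable (N : set (measurableTypeR R)) by exact: mN.
have il := bm_integrable mI Ifin bl.
have igI := integrableS measurableT mI (@subsetT _ _) ig.
rewrite /Rintegral (negligible_integral mN' mI il N0) (negligible_integral mN' mI igI N0).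
have mIN := measurableD mI mN'.
have IN : (`]a, b] `\` N) `<=` `]a, b]%classic by exact: subDsetl.
apply: (@le_Rintegral _ _ _ leb _ low g mIN (integrableS mI mIN IN il) (integrableS mI mIN IN igI)).
move=> t [/=]; rewrite in_itv/= => /andP[at1 tb] Nt.
have tn : - n < t < n by rewrite (le_lt_trans na at1) (le_lt_trans tb bn).
have gt := gs t tn Nt; rewrite /low !indicE.
have [At|At] := pselect (A t).
  rewrite mem_set// memNset; last exact.
  by rewrite mulr1 mulr0 subr0; apply: has_slope_ge gt (HA t At).
rewrite memNset// mem_set// mulr1 mulr0 sub0r; apply: has_slope_ge gt _.
exists 1 => // h h0 _; have := fC (t + h) t.
by rewrite addrAC subrr add0r (ger0_norm (ltW h0)) ler_norml => /andP[+ _]; rewrite mulNr.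
Qed.

(** The increments over a fixed interval tend to zero with [n], so [A] fills at most the proportion
    [C / (kappa + C)] of every interval and has no point of density. *)
Lemma null_increments (A : set R) (f : nat -> R -> R) C kappa : 0 < kappa -> measurable A ->
  (forall n s t, `|f n s - f n t| <= C * `|s - t|) ->
  (forall n t, `|f n t| <= 2^-1 ^+ n) ->
  (forall n t, A t ->
    exists2 del, 0 < del & forall h, 0 < h -> h < del -> kappa * h <= f n (t + h) - f n t) ->
  leb A = 0%E.
Proof.
move=> k0 mA fC fe HA.
have C0 : 0 <= C by have := le_trans (normr_ge0 _) (fC 0%N 1 0); rewrite subr0 normr1 mulr1.
have mA' : measurable (A : set (measurableTypeR R)) by exact: mA.
have key a b : a <= b ->
    kappa * fine (leb (A `&` `]a, b])) <= C * fine (leb (`]a, b] `\` A)).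
  move=> ab; rewrite -subr_le0; apply/ler_addgt0Pr => eps e0; rewrite add0r.
  have [n Hn] : exists n, 2 * 2^-1 ^+ n < eps.
    have : 2 * 2^-1 ^+ n @[n --> \oo] --> (2 * 0 : R).
      by apply: cvgM; [exact: cvg_cst|apply: cvg_expr; rewrite ger0_norm ?invf_lt1 ?invr_ge0// ltr1n].
    by rewrite mulr0 => /(cvgr_lt (0 : R)) /(_ _ e0) [n _ /(_ n (leqnn n))]; exists n.
  pose m := `|a| + `|b| + 1.
  have m0 : 0 < m by rewrite ltr_wpDl// addr_ge0.
  have ma : - m <= a by rewrite /m; have := ler_norm (- a); rewrite normrN; have := normr_ge0 b; lra.
  have mb : b < m by rewrite /m; have := ler_norm b; have := normr_ge0 a; lra.
  have := lip_increment_ge m0 (fC n) mA (HA n) ma ab mb.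
  have := fe n a; have := fe n b; rewrite !ler_norml => /andP[_ ?] /andP[? _] ?.
  by lra.
have [N [mN N0 NP]] := lebesgue_density mA.
apply: (@subset_measure0 _ _ _ leb A N) => // x Ax; apply: NP => /= cv.
have {cv} := cv; rewrite indicE mem_set// => cv.
(* With this choice [(kappa + C) * (1 - th) = C + kappa / 2], which exceeds the [C] allowed by
   [key]. *)
pose th := kappa / (2 * (kappa + C)).
have kC : 0 < kappa + C by rewrite ltr_wpDr.
have th0 : 0 < th by rewrite divr_gt0// mulr_gt0.
have : (\forall r \near (0:R)^'+, (1 - th)%:E < leb (A `&` ball x r) * (leb (ball x r))^-1)%E.
  have /cv : nbhs (1%:E : \bar R) [set y | ((1 - th)%:E < y)%E].
    by apply: open_ereal_gt'; rewrite lte_fin gtrBl.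
  by [].
have : (\forall r \near (0:R)^'+, 0 < r) by exact: nbhs_right_gt.
move=> /filterI H /H {H} H.
have [r [r0 Hr]] := filter_ex H.
have xr : x - r <= x + r by rewrite lerD2l; lra.
pose J : set (measurableTypeR R) := `]x - r, x + r]%classic.
have bE : leb (ball x r) = (2 * r)%:E by rewrite lebesgue_measure_ball ?ltW// mulr_natl.
have IE : leb J = (2 * r)%:E by rewrite /J leb_itvoc//; congr EFin; ring.
have {}key : kappa * fine (leb (A `&` J)) <= C * fine (leb (J `\` A)) := key _ _ xr.
have mI : measurable J by exact: measurable_itv.
have mAI := measurableI _ _ mA' mI.
have AIfin : (leb (A `&` J) < +oo)%E.
  apply: (@le_lt_trans _ _ (leb J)); last by rewrite IE ltry.
  by apply: le_measure; rewrite ?inE.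
pose v := fine (leb (A `&` J)).
have vE : leb (A `&` J) = v%:E by rewrite fineK// ge0_fin_numE.
have dE : fine (leb (J `\` A)) = 2 * r - v.
  rewrite measureD//=; last by rewrite IE ltry.
  by rewrite IE setIC vE.
have v1 : (1 - th) * (2 * r) < v.
  rewrite -lte_fin -vE; move: Hr; rewrite bE inver gt_eqF ?mulr_gt0//.
  rewrite lte_pdivlMr ?mulr_gt0// -EFinM => /lt_le_trans; apply.
  apply: le_measure; rewrite ?inE//; first exact: measurableI _ _ mA' (measurable_ball _ _).
  apply: setIS => y; rewrite /J ball_itv/= !in_itv/= => /andP[-> /ltW ->].
  by [].
rewrite dE in key.
have : (kappa + C) * v <= C * (2 * r) by move: key; rewrite vE/=; lra.
have : (kappa + C) * ((1 - th) * (2 * r)) < (kappa + C) * v by rewrite ltr_pM2l.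
have : (kappa + C) * th = kappa / 2 by rewrite /th; field; rewrite gt_eqF.
have : 0 < kappa * r by exact: mulr_gt0.
move=> kr thE; rewrite mulrA mulrBr mulr1 thE; lra.
Qed.

End lebesgue_line.

(** * Null images of Lipschitz curves *)

Lemma pow2_gt0 {R : realType} n : 0 < (2 ^ n.+1)%:R :> R.
Proof. by rewrite ltr0n expn_gt0. Qed.

Section hausdorff_null.
Context {R : realType} {d : nat}.
Implicit Types (P : set (d.-tuple R)) (x y : d.-tuple R).

Lemma edist_le_sup x y (c : R) : 0 <= c -> (forall i, `|tnth x i - tnth y i| <= c) ->
  Defs.edist x y <= d%:R * c.
Proof.
move=> c0 H; rewrite /Defs.edist -[leRHS]ger0_norm ?mulr_ge0// -sqrtr_sqr ler_wsqrtr//.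
apply: (@le_trans _ _ (\sum_(i < d) c ^+ 2)).
  apply: ler_sum => i _; rewrite -real_normK ?num_real//.
  by rewrite ler_pXn2r ?nnegrE.
rewrite sumr_const card_ord -[leLHS]mulr_natl exprMn ler_wpM2r ?sqr_ge0//.
by rewrite -natrX ler_nat; case: (d) => // n; rewrite expnS leq_pmulr// expn1.
Qed.

Lemma sup_le_edist x y i : `|tnth x i - tnth y i| <= Defs.edist x y.
Proof.
rewrite -sqrtr_sqr /Defs.edist ler_wsqrtr// (bigD1 i)//= lerDl.
by rewrite sumr_ge0// => j _; rewrite sqr_ge0.
Qed.

Lemma diam_ge0 P : (0 <= diam P)%E.
Proof. by apply: ereal_sup_ubound; left. Qed.

Lemma diam_le P (r : R) : 0 <= r -> (forall x y, P x -> P y -> Defs.edist x y <= r) ->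
  (diam P <= r%:E)%E.
Proof.
move=> r0 H; apply: ge_ereal_sup => _ [->|[x Px [y Py <-]]]; first by rewrite lee_fin.
by rewrite lee_fin H.
Qed.

(** The size of single pieces is left free: a total diameter of at most [eps] already forces each
    piece to be that small. In this form nullity passes to countable unions by distributing
    geometric errors. *)
Definition small_covers P := forall eps : R, 0 < eps ->
  exists F : nat -> set (d.-tuple R), P `<=` \bigcup_k F k /\
    (\sum_(k <oo) diam (F k) <= eps%:E)%E.

Lemma small_coversS P Q : P `<=` Q -> small_covers Q -> small_covers P.
Proof.
move=> PQ H eps e0; have [F [QF HF]] := H eps e0.
by exists F; split=> // x /PQ/QF.
Qed.

Lemma small_covers_H1 P : small_covers P -> H1 P = 0%E.
Proof.
move=> H; apply/eqP; rewrite eq_le; apply/andP; split.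
  apply: ge_ereal_sup => _ [delta + <-]; rewrite /= in_itv/= andbT => d0.
  apply/lee_addgt0Pr => eps e0; rewrite add0e.
  have m0 : 0 < Num.min eps delta by rewrite lt_min e0.
  have [F [PF HF]] := H _ m0.
  have dF k : (diam (F k) <= (Num.min eps delta)%:E)%E.
    apply: le_trans HF.
    have := @nneseries_lim_ge _ (fun k => diam (F k)) xpredT 0%N k.+1 (fun n _ _ => diam_ge0 _).
    apply: le_trans; rewrite big_nat_recr//=.
    by rewrite leeDr// sume_ge0// => i _; exact: diam_ge0.
  apply: (@le_trans _ _ (\sum_(k <oo) diam (F k))%E).
    apply: ereal_inf_lbound; exists F => //; split=> // k.
    by apply: le_trans (dF k) _; rewrite lee_fin ge_min lexx orbT.
  by apply: le_trans HF _; rewrite lee_fin ge_min lexx.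
apply: (@le_trans _ _ (H1_delta 1 P)).
  apply: le_ereal_inf_tmp => _ [F _ <-].
  by apply: nneseries_ge0 => k _ _; exact: diam_ge0.
by apply: ereal_sup_ubound; exists 1 => //; rewrite /= in_itv/= ltr01.
Qed.

Lemma small_covers_bigcup (P : nat -> set (d.-tuple R)) :
  (forall n, small_covers (P n)) -> small_covers (\bigcup_n P n).
Proof.
move=> H eps e0.
have /choice[F HF] n := H n _ (divr_gt0 e0 (pow2_gt0 n)).
have /card_esym/ppcard_eqP[f] := card_nat2.
exists (fun i => F (f i).1 (f i).2); split=> [x [n _ /(HF n).1[k _ Fx]]|].
  by exists (f^-1%FUN (n, k)) => //=; rewrite invK ?inE.
rewrite nneseries_esumT; last by move=> n; exact: diam_ge0.
have fbij : set_bij [set: nat] [set: nat * nat] f by exact: bij.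
rewrite -(@reindex_esum _ _ _ _ _ f (fun nk => diam (F nk.1 nk.2)) fbij).
rewrite (_ : setT = setT `*`` fun=> setT); last by apply/seteqP; split.
rewrite -(@esum_esum _ _ _ _ _ (fun n k => diam (F n k))); last by move=> *; exact: diam_ge0.
rewrite -nneseries_esumT; last by move=> n; apply: esum_ge0 => *; exact: diam_ge0.
apply: le_trans (epsilon_trick0 xpredT (ltW e0)); apply: lee_nneseries => n _.
  by move=> _; apply: esum_ge0 => *; exact: diam_ge0.
by rewrite -nneseries_esumT; [have [] := HF n|move=> *; exact: diam_ge0].
Qed.

Section curve.
Variable gam : R -> d.-tuple R.
Local Notation leb := (@lebesgue_measure R).

Lemma null_image_small (L : R) (S : set R) : leb S = 0%E ->
  (forall i s t, `|tnth (gam s) i - tnth (gam t) i| <= L * `|s - t|) ->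
  small_covers (gam @` S).
Proof.
move=> S0 gL eps e0.
pose C := d%:R * `|L| + 1; have C0 : 0 < C by rewrite ltr_wpDl// mulr_ge0.
have [a [b [ab Sab Hs]]] := null_cover S0 (divr_gt0 e0 C0).
exists (fun k => gam @` `]a k, b k]%classic); split.
  by move=> _ [t /Sab[k _ tk] <-]; exists k => //; exists t.
apply: (@le_trans _ _ (\sum_(k <oo) (C%:E * (b k - a k)%:E))%E).
  apply: lee_nneseries => k _; first by move=> _; exact: diam_ge0.
  have bk0 : 0 <= b k - a k by rewrite subr_ge0.
  rewrite -EFinM; apply: diam_le; first exact: mulr_ge0 (ltW C0) bk0.
  move=> _ _ [u + <-] [v + <-]; rewrite /= !in_itv/= => /andP[u1 u2] /andP[v1 v2].
  apply: (@le_trans _ _ (d%:R * (`|L| * (b k - a k)))).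
    apply: edist_le_sup => [|i]; first exact: mulr_ge0.
    apply: le_trans (gL i u v) _.
    apply: (@le_trans _ _ (`|L| * `|u - v|)); first by rewrite ler_wpM2r ?ler_norm.
    by rewrite ler_wpM2l// ler_norml; apply/andP; split; lra.
  by rewrite mulrA ler_wpM2r// lerDl.
rewrite nneseriesZl; last by move=> k _; rewrite lee_fin subr_ge0.
apply: (@le_trans _ _ (C%:E * (eps / C)%:E)%E).
  apply: lee_pmul => //; first by rewrite lee_fin ltW.
  by apply: nneseries_ge0 => k _ _; rewrite lee_fin subr_ge0.
by rewrite -EFinM lee_fin mulrC divfK ?gt_eqF.
Qed.

(** A Sard-type argument. Near a stationary parameter the curve moves by at most [eta] times the
    displacement. Disjoint intervals selected by Vitali in a bounded range have total length at most
    [2 * (m + 2)], so the images of the tripled ones cover with total diameter proportional to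
    [eta]. *)
Lemma stationary_image_small m (Z : set R) : 0 < m ->
  (forall t, Z t -> `|t| <= m /\ forall i, has_slope (fun u => tnth (gam u) i) t 0) ->
  small_covers (gam @` Z).
Proof.
move=> m0 HZ eps e0.
pose eta := eps / (d%:R * 6 * (m + 2) + 1).
have D0 : 0 < d%:R * 6 * (m + 2) + 1.
  by rewrite ltr_wpDl// mulr_ge0 ?mulr_ge0 ?addr_ge0// ltW.
have eta0 : 0 < eta by rewrite divr_gt0.
have H t : exists r, Z t -> 0 < r <= 1 /\ forall u i, `|u - t| <= 3 * r ->
    `|tnth (gam u) i - tnth (gam t) i| <= 3 * eta * r.
  have [Zt|nZ] := pselect (Z t); last by exists 0.
  have [_ Ht] := HZ t Zt.
  have H i : exists del, 0 < del /\ forall h, `|h| < del ->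
      `|tnth (gam (t + h)) i - tnth (gam t) i - 0 * h| <= eta * `|h|.
    by have [del d0 Hd] := Ht i eta eta0; exists del.
  have {H} [del Hdel] := choice H.
  have [r r0 rdel] := exists_pos_forall (fun i => (Hdel i).1).
  exists (Num.min 1 (r / 4)) => _; split.
    by rewrite lt_min ltr01 divr_gt0//= ge_min lexx.
  move=> u i ur; have r4 : Num.min 1 (r / 4) <= r / 4 by rewrite ge_min lexx orbT.
  have utd : `|u - t| < del i by have := rdel i; move: ur r4 r0; lra.
  have := (Hdel i).2 (u - t) utd; rewrite [t + _]addrC subrK mul0r subr0 => /le_trans; apply.
  by rewrite [leRHS](_ : _ = eta * (3 * Num.min 1 (r / 4))); [rewrite ler_pM2l|ring].
have {H} [r Hr] := choice H.
(* Real parameters are viewed as 1-tuples, so that the covering by cubes becomes a covering by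
   intervals. *)
have [z /= [t Zt <-]|xs [V [VX disj cov]]] := @vitali_cubes R 1 [set [tuple t] | t in Z] (fun z : 1.-tuple R => r (tnth z ord0)) 1.
  by have [] := Hr t Zt.
pose tn n := tnth (xs n) ord0.
pose rn n := r (tn n).
have VZ n : V n -> Z (tn n) by move=> /VX[t Zt E]; rewrite /tn -E.
pose D : set (measurableTypeR R) := `](- (m + 2)), m + 2]%classic.
pose Q n : set (measurableTypeR R) := `](tn n - rn n), tn n + rn n]%classic.
have mm : - (m + 2) <= m + 2 by lra.
have DE : leb D = (2 * (m + 2))%:E by rewrite /D leb_itvoc//; congr EFin; ring.
have Dfin : (leb D < +oo)%E by rewrite DE ltry.
have QE n : V n -> fine (leb (Q n)) = 2 * rn n.
  move=> /VZ/Hr[/andP[r0 _] _]; rewrite /Q leb_itvoc/=; last by move: r0; rewrite /rn; lra.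
  by ring.
have QD n : V n -> Q n `<=` D.
  move=> /VZ Zt; have [/andP[r0 r1] _] := Hr _ Zt; have [tm _] := HZ _ Zt.
  move: tm; rewrite ler_norml => /andP[? ?] u; rewrite /Q /D /= !in_itv/= /rn => /andP[? ?].
  by apply/andP; split; lra.
have SQ N : \sum_(n < N | V n) fine (leb (Q n)) <= 2 * (m + 2).
  have -> : 2 * (m + 2) = fine (leb D) by rewrite DE.
  apply: (@disjoint_mass _ _ _ leb N V Q D) => //.
  - exact: measurable_itv.
  - by move=> n; exact: measurable_itv.
  - move=> n k Vn Vk nk; apply/seteqP; split=> // u [Qn Qk].
    have cub j : Q j u -> cube (xs j) (r (tnth (xs j) ord0)) [tuple u].
      rewrite /Q /= in_itv/= => /andP[? ?] i; rewrite !ord1 tnth0 ler_norml.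
      by apply/andP; split; rewrite -/(tn j) -/(rn j); lra.
    by have /seteqP[/(_ [tuple u]) + _] := disj n k Vn Vk nk; apply; split; exact: cub.
exists (fun n => if V n then gam @` [set u | `|u - tn n| <= 3 * rn n] else set0); split.
  move=> _ [t Zt <-]; have [|n /= Vn /(_ ord0)] := cov [tuple t]; first by exists t.
  by rewrite tnth0 => tn3; exists n => //; rewrite Vn; exists t.
apply: lime_le; first by apply: is_cvg_nneseries => n _ _; exact: diam_ge0.
near=> N; rewrite big_mkord.
apply: (@le_trans _ _ (\sum_(n < N) (if V n then d%:R * (6 * eta * rn n) else 0)%:E)%E).
  apply: lee_sum => n _; case: ifPn => Vn; last first.
    by apply: diam_le => // x y [].
  have [/andP[r0 r1] H] := Hr _ (VZ n Vn).
  have e6 : 0 <= 6 * eta * rn n by apply: mulr_ge0 (ltW r0); apply: mulr_ge0 (ltW eta0).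
  apply: diam_le; first by rewrite mulr_ge0.
  move=> _ _ [u /= u3 <-] [v /= v3 <-]; apply: edist_le_sup => // i.
  have := H u i u3; have := H v i v3; rewrite -/(rn n) !ler_norml => /andP[? ?] /andP[? ?].
  by apply/andP; split; lra.
rewrite sumEFin lee_fin -big_mkcond/=.
apply: (@le_trans _ _ (d%:R * 3 * eta * \sum_(n < N | V n) fine (leb (Q n)))).
  rewrite mulr_sumr; apply: ler_sum => n Vn; rewrite QE// le_eqVlt; apply/orP; left; apply/eqP.
  by ring.
apply: (@le_trans _ _ (d%:R * 3 * eta * (2 * (m + 2)))).
  by rewrite ler_wpM2l//; apply: mulr_ge0 (ltW eta0); exact: mulr_ge0.
have -> : d%:R * 3 * eta * (2 * (m + 2)) = eta * (d%:R * 6 * (m + 2)) by ring.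
rewrite /eta mulrAC ler_pdivrMr// ler_pM2l//.
by rewrite lerDl.
Unshelve. all: by end_near. Qed.

End curve.

End hausdorff_null.

Lemma negligible_bigcup_count d0 (T : measurableType d0) (R : realType)
    (mu : {measure set T -> \bar R}) (I : countType) (P : set I) (F : I -> set T) :
  (forall i, P i -> mu.-negligible (F i)) -> mu.-negligible (\bigcup_(i in P) F i).
Proof.
move=> H; apply: (@negligibleS _ _ _ mu (\bigcup_n
    (if unpickle n is Some i then (if pselect (P i) then F i else set0) else set0)) _).
  by move=> x [i Pi Fi]; exists (pickle i) => //; rewrite pickleK; case: pselect.
apply: negligible_bigcup => n; case: (unpickle n) => [i|]; last exact: negligible_set0.
by case: pselect => Pi; [exact: H|exact: negligible_set0].
Qed.

(** * Lipschitz curves against countably many directions *)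

Section curves.
Context {R : realType} {d : nat}.
Local Notation leb := (@lebesgue_measure R).
Variables (gam : R -> d.-tuple R) (L : R).
Hypothesis gamL : forall i s t, `|tnth (gam s) i - tnth (gam t) i| <= L * `|s - t|.

Definition in_direction (e : 'I_d -> R) (alpha del : R) : set R :=
  [set t | forall h, 0 < h -> h <= del -> thin_cone e alpha h (gam t) (gam (t + h))].

Lemma closed_le_lip (f : R -> R) C c : (forall s t, `|f s - f t| <= C * `|s - t|) ->
  closed [set t | f t <= c].
Proof.
by move=> fC; have /continuous_closedP H := lip_continuous fC; exact: (H [set x | x <= c] (@closed_le R c)).
Qed.

Lemma closed_in_direction e alpha del : closed (in_direction e alpha del).
Proof.
rewrite (_ : in_direction _ _ _ = \bigcap_(h in [set h | 0 < h /\ h <= del])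
  \bigcap_(i in [set: 'I_d])
  [set t | `|tnth (gam (t + h)) i - tnth (gam t) i - h * e i| <= alpha * h]); last first.
  apply/seteqP; split => t /= H; first by move=> h [h0 hd] i _; exact: H.
  by move=> h h0 hd i; exact: H.
apply: closed_bigI => h _; apply: closed_bigI => i _.
apply: (@closed_le_lip _ (2 * L)) => s t.
apply: le_trans (ler_dist_dist _ _) _.
rewrite (_ : _ - _ - _ - _ = (tnth (gam (s + h)) i - tnth (gam (t + h)) i) - (tnth (gam s) i - tnth (gam t) i)); last by ring.
apply: le_trans (ler_normB _ _) _.
have := gamL i (s + h) (t + h); have := gamL i s t.
rewrite (_ : s + h - (t + h) = s - t); last by ring.
by lra.
Qed.

Lemma lip_comp_curve C f : lip C f -> forall s t, `|f (gam s) - f (gam t)| <= C * L * `|s - t|.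
Proof. by move=> fC s t; rewrite -mulrA; apply: fC => i; exact: gamL. Qed.

(** Along the curve the functions [phi] become small, uniformly Lipschitz functions of one variable
    that grow at rate [kappa] on this set. The index is shifted by [j], where the lower bound on
    [F n] begins. *)
Lemma direction_null e alpha Bc kappa del j (F : nat -> d.-tuple R -> R) :
  0 < kappa -> 0 < del -> (forall n, test_class e alpha Bc (2^-1 ^+ n) (F n)) ->
  leb.-negligible (in_direction e alpha del `&`
       [set t | forall n, (j <= n)%N -> kappa <= F n (gam t)]).
Proof.
move=> k0 del0 HF; set A := (X in leb.-negligible X).
have mA : measurable A.
  apply: closed_measurable; apply: closedI; first exact: closed_in_direction.
  rewrite (_ : mkset _ = \bigcap_(n in [set n | (j <= n)%N]) [set t | - F n (gam t) <= - kappa]).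
    apply: closed_bigI => n _; have [_ [C FC] _] := HF n.
    apply: (@closed_le_lip _ (C * L)) => s t.
    by rewrite -opprD normrN; exact: lip_comp_curve.
  apply/seteqP; split => t /= H n nj; first by rewrite /= lerN2; exact: H.
  by have := H n nj; rewrite /= lerN2.
have H n : exists phi : d.-tuple R -> R, [/\ forall y, `|phi y| <= 2^-1 ^+ n, lip Bc phi &
    exists2 del : R, 0 < del & forall y y' t, 0 < t -> t <= del ->
      thin_cone e alpha t y y' -> F n y * t <= phi y' - phi y].
  by have [_ _] := HF n.
have {H} [phi Hphi] := choice H.
exists A; split=> //.
apply: (@null_increments _ A (fun n t => phi (n + j)%N (gam t)) (Bc * L) kappa k0 mA).
- by move=> n s t; apply: lip_comp_curve; have [] := Hphi (n + j)%N.
- move=> n t; have [/(_ (gam t)) /le_trans + _ _] := Hphi (n + j)%N; apply.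
  by rewrite exprD ler_piMr ?exprn_ge0 ?invr_ge0// exprn_ile1 ?invr_ge0// invf_le1// ler1n.
move=> n t [/= tdir tF]; have [_ _ [del' del'0 Hd]] := Hphi (n + j)%N.
exists (Num.min del del'); first by rewrite lt_min del0.
move=> h h0; rewrite lt_min => /andP[hd hd'].
apply: le_trans (Hd _ _ _ h0 (ltW hd') (tdir h h0 (ltW hd))).
by rewrite ler_pM2r// tF// leq_addl.
Qed.

(** Rademacher's theorem in one variable, for each coordinate on each interval []-(n+1), n+1[]. *)
Lemma curve_slopes : exists2 N : set (measurableTypeR R), leb.-negligible N &
  forall t, ~ N t -> forall i, exists c, has_slope (fun u => tnth (gam u) i) t c.
Proof.
have H (p : 'I_d * nat) : exists N : set (measurableTypeR R), [/\ measurable N, leb N = 0%E &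
    forall t, `|t| < p.2.+1%:R -> ~ N t -> exists c, has_slope (fun u => tnth (gam u) p.1) t c].
  have [g [N [_ mN N0 _ gN]]] := lip_density (ltr0Sn R p.2) (gamL p.1).
  exists N; split=> // t; rewrite ltr_norml => tp Nt; exists (g t); exact: gN.
have {H} [N HN] := choice H.
exists (\bigcup_(p in [set: 'I_d * nat]) N p).
  apply: negligible_bigcup_count => p _; have [mN N0 _] := HN p.
  by exists (N p); split.
move=> t Nt i.
have [n tn] : exists n : nat, `|t| < n.+1%:R by exists (Num.truncn `|t|); exact: truncnS_gt.
have [_ _ /(_ t tn)] := HN (i, n); apply=> Nin.
by apply: Nt; exists (i, n).
Qed.

End curves.

Section test_families.
Context {R : realType} {d : nat}.
Local Notation leb := (@lebesgue_measure R).
Local Notation dir q := (fun i => ratr (q i) : R).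

(** [k] is the last nonzero coordinate of the direction, the pivot that keeps the matrices of the
    tubes triangular; [M] controls the direction and its pivot quantitatively. *)
Definition admissible (M : nat) (q : {ffun 'I_d -> rat}) (k : 'I_d) :=
  [/\ 1 <= M%:R :> R, forall i, `|dir q i| <= M%:R, M%:R^-1 <= `|dir q k| &
    forall i : 'I_d, (k < i)%N -> dir q i = 0].

Variables (alpha kappa Bc : nat -> nat -> R).
Variable F : nat -> nat -> {ffun 'I_d -> rat} -> 'I_d -> nat -> d.-tuple R -> R.
Hypothesis alpha0 : forall m M, 0 < alpha m M.
Hypothesis kappa0 : forall m M, 0 < kappa m M.
Hypothesis HF : forall m M q k, admissible M q k ->
  forall n, test_class (dir q) (alpha m M) (Bc m M) (2^-1 ^+ n) (F m M q k n).

Definition limit_tests (m M : nat) q k : set (d.-tuple R) :=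
  \bigcup_j \bigcap_(n in [set n | (j <= n)%N]) [set x | kappa m M <= F m M q k n x].

Lemma rational_direction (w : 'I_d -> R) : (exists i, w i != 0) ->
  exists (M : nat) k, forall a, 0 < a -> exists q, admissible M q k /\
    forall i, `|dir q i - w i| <= a.
Proof.
move=> [i0 wi0].
have [k /= wk kmax] : extremum_spec (fun a b : nat => (b <= a)%N) (fun i => w i != 0) (@nat_of_ord d)
    [arg max_(i > i0 | w i != 0) (i : nat)] by exact: arg_maxnP.
pose M := (Num.truncn (\sum_i `|w i| + 2 / `|w k| + 1)).+1.
have S0 : 0 <= \sum_i `|w i| by exact: sumr_ge0.
have wk0 : 0 < `|w k| by rewrite normr_gt0.
have wk2 : 0 < 2 / `|w k| by exact: divr_gt0.
have MS : \sum_i `|w i| + 2 / `|w k| + 1 < M%:R by exact: truncnS_gt.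
exists M, k => a a0.
pose b := Num.min a (Num.min 1 (`|w k| / 2)).
have b0 : 0 < b by rewrite !lt_min a0 ltr01 divr_gt0.
have ba : b <= a by rewrite ge_min lexx.
have b1 : b <= 1 by rewrite !ge_min lexx orbT.
have bk : b <= `|w k| / 2 by rewrite !ge_min lexx !orbT.
have Q i : exists q : rat, `|ratr q - w i| <= b /\ (w i = 0 -> q = 0).
  have [->|wi] := eqVneq (w i) 0.
    by exists 0; rewrite rmorph0 subrr normr0 ltW.
  have [q] : exists q, ratr q \in `]w i - b, w i + b[.
    by apply: rat_in_itvoo; rewrite ltrD2l gtrN.
  rewrite in_itv/= => /andP[q1 q2]; exists q; split; last by move/eqP; rewrite (negbTE wi).
  by rewrite ler_norml; apply/andP; split; lra.
have {Q} [q Hq] := choice Q.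
exists [ffun i => q i]; split; last first.
  by move=> i; rewrite ffunE; apply: le_trans (Hq i).1 ba.
split.
- by rewrite ler1n.
- move=> i; rewrite ffunE.
  have : `|w i| <= \sum_i `|w i| by rewrite (bigD1 i)//= lerDl sumr_ge0.
  have := ler_normD (ratr (q i) - w i) (w i); rewrite subrK; have := (Hq i).1; lra.
- rewrite ffunE.
  have : `|w k| / 2 <= `|ratr (q k) : R|.
    have := ler_normD (ratr (q k)) (w k - ratr (q k)); rewrite addrC subrK.
    by have := (Hq k).1; rewrite distrC; lra.
  apply: le_trans; rewrite -[leRHS]invrK lef_pV2 ?posrE ?invr_gt0 ?ltr0n ?divr_gt0//.
  by rewrite invf_div; move: MS; lra.
move=> i ki; rewrite ffunE (Hq i).2 ?rmorph0//; apply/eqP; apply: contraTT ki => wi.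
by rewrite -leqNgt; exact: kmax.
Qed.

(** Outside a null set of parameters the curve has a velocity. If it is nonzero, some admissible
    rational direction is close enough to put the parameter into one of countably many null sets.
    Only stationary parameters are left, and their image is small. *)
Lemma limit_tests_unrectifiable :
  purely_unrectifiable1 (\bigcup_m \bigcap_(p in [set p : nat * {ffun 'I_d -> rat} * 'I_d |
    admissible p.1.1 p.1.2 p.2]) limit_tests m p.1.1 p.1.2 p.2).
Proof.
move=> gam [L gamL0].
have gamL i s t : `|tnth (gam s) i - tnth (gam t) i| <= L * `|s - t|.
  by apply: le_trans (gamL0 s t); exact: sup_le_edist.
apply: small_covers_H1.
have [N Nneg HN] := curve_slopes gamL.
pose A (p : nat * nat * {ffun 'I_d -> rat} * 'I_d * nat * nat) : set (measurableTypeR R) :=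
  let: (m, M, q, k, j, l) := p in
  in_direction gam (dir q) (alpha m M) l.+1%:R^-1 `&`
       [set t | forall n, (j <= n)%N -> kappa m M <= F m M q k n (gam t)].
pose P : set (nat * nat * {ffun 'I_d -> rat} * 'I_d * nat * nat) :=
  [set p | let: (m, M, q, k, j, l) := p in admissible M q k].
have Aneg : leb.-negligible (\bigcup_(p in P) A p).
  apply: negligible_bigcup_count => -[[[[[m M] q] k] j] l] adm.
  by apply: (direction_null gamL _ (kappa0 m M)) => // n; exact: HF.
have [D [mD D0 ND]] := negligibleU Nneg Aneg.
pose Z (n : nat) := [set t | `|t| <= n.+1%:R /\ forall i, has_slope (fun u => tnth (gam u) i) t 0].
(* Index [0] carries the null set of parameters, index [n.+1] the stationary parameters of absolute
   value at most [n.+1]. *)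
apply: (@small_coversS _ _ _ (\bigcup_n (if n is n'.+1 then gam @` Z n' else gam @` D))); last first.
  apply: small_covers_bigcup => -[|n]; first exact: null_image_small D0 gamL.
  by apply: (@stationary_image_small _ _ gam n.+1%:R) => // t.
move=> x [[m _ Em] [t _ tE]]; move: Em; rewrite -tE => Em {x tE}.
have [Dt|nD] := pselect (D t); first by exists 0%N => //; exists t.
have /choice[w Hw] := HN t (fun Nt => nD (ND _ (or_introl Nt))).
have [w0|w0] := pselect (exists i, w i != 0); last first.
  exists (Num.truncn `|t|).+1 => //; exists t => //; split; first by rewrite ltW// truncnS_gt.
  move=> i; have -> : 0 = w i; last exact: Hw.
  by apply/eqP; rewrite eq_sym; apply/negP => wi; apply: w0; exists i; apply/negP.
exfalso; apply: nD; apply: ND; right.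
(* Half of the aperture pays for replacing the velocity by a rational direction, the other half for
   the error in the derivative. *)
have [M [k /(_ (alpha m M / 2) (divr_gt0 (alpha0 m M) (ltr0n R 2)))[q [adm qw]]]] := rational_direction w0.
have [j _ Hj] := Em (M, q, k) adm.
have /choice[del Hdel] i : exists del, 0 < del /\ forall h, `|h| < del ->
    `|tnth (gam (t + h)) i - tnth (gam t) i - w i * h| <= alpha m M / 2 * `|h|.
  by have [del del0 H] := Hw i _ (divr_gt0 (alpha0 m M) (ltr0n R 2)); exists del.
have [r r0 rdel] := exists_pos_forall (fun i => (Hdel i).1).
pose l := Num.truncn r^-1.
have lr : l.+1%:R^-1 < r by rewrite -[ltRHS]invrK ltf_pV2 ?posrE ?invr_gt0// truncnS_gt.
exists (m, M, q, k, j, l) => //; split; last by move=> n jn; exact: Hj.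
move=> h h0 hl i.
have hd : `|h| < del i by rewrite ger0_norm ?(ltW h0)// (le_lt_trans hl)// (lt_le_trans lr).
have := (Hdel i).2 h hd; rewrite (ger0_norm (ltW h0)).
have qh : `|(dir q i - w i) * h| <= alpha m M / 2 * h.
  by rewrite normrM [`|h|]ger0_norm ?(ltW h0)// ler_wpM2r ?(ltW h0).
by move: qh; rewrite !ler_norml => /andP[? ?] /andP[? ?]; apply/andP; split; lra.
Qed.

End test_families.

(** * From positive density to a full-measure unrectifiable set *)

Section assembly.
Context {R : realType} {d : nat}.
Variable mu : {measure set (d.-tuple R) -> \bar R}.

Lemma cball_cube (x : d.-tuple R) r : cball x r `<=` cube x r.
Proof. by move=> y xy i; rewrite distrC (le_trans _ xy)// sup_le_edist. Qed.

Lemma cube_cball (x : d.-tuple R) r : 0 <= r -> cube x r `<=` cball x (d%:R * r).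
Proof. by move=> r0 y xy; apply: edist_le_sup => // i; rewrite distrC. Qed.

Lemma measurable_cball (x : d.-tuple R) r : measurable (cball x r).
Proof.
rewrite (_ : cball x r = [set y | `|Defs.edist x y| <= r]); last first.
  by apply/seteqP; split => y; rewrite /cball /= ger0_norm// sqrtr_ge0.
apply: measurable_norm_le.
have -> : Defs.edist x = Num.sqrt \o (fun y => \sum_(i < d) (tnth x i - tnth y i) ^+ 2) by [].
apply: measurableT_comp.
  by apply: continuous_measurable_fun; exact: sqrt_continuous.
apply: measurable_sum => i; apply: measurable_funX; apply: measurable_funB => //.
exact: measurable_tnth.
Qed.

Lemma box_fin (B : R) : locally_finite mu -> measurable (box d B) -> (mu (box d B) < +oo)%E.
Proof.
move=> lf mB; pose x0 : d.-tuple R := [tuple 0 | i < d].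
apply: le_lt_trans (lf x0 (d%:R * `|B|)).
apply: le_measure; rewrite ?inE//; first exact: measurable_cball.
move=> y yB; apply: cube_cball => // i; rewrite tnth_mktuple subr0.
exact: le_trans (yB i) (ler_norm _).
Qed.

(** [m] dominates the coordinates of [x] and the inverse of [l * omega s], where [l] is a positive
    level below the density. Passing from balls to the larger cubes only increases the mass. *)
Lemma density_thick (s : R) x : (0 < upper_density mu s x)%E ->
  exists m : nat, thick_limsup mu s m.+1%:R^-1 m.+1%:R x.
Proof.
move=> d0.
have [l l0 ld] : exists2 l : R, 0 < l & (l%:E < upper_density mu s x)%E.
  move: d0; case: (upper_density mu s x) => [r|_|//]; last by exists 1; rewrite ?ltry.
  by rewrite lte_fin => r0; exists (r / 2); rewrite ?divr_gt0// lte_fin; lra.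
have H (delta : R) : 0 < delta -> exists2 r, 0 < r < delta &
    (l%:E < mu (cball x r) * ((omega s * r `^ s)^-1)%:E)%E.
  move=> delta0.
  have : (l%:E < ereal_sup [set (mu (cball x r) * ((omega s * r `^ s)^-1)%:E)%E
      | r in [set` `]0, delta[%R]])%E.
    apply: lt_le_trans ld _; apply: ereal_inf_lbound; exists delta => //.
    by rewrite /= in_itv/= delta0.
  by move=> /ereal_sup_gt[_ [r /= + <-]]; rewrite in_itv/= => r0 Hr; exists r.
(* Read off from the density itself: with [omega s <= 0] all the quotients would be nonpositive. *)
have om0 : 0 < omega s.
  rewrite ltNge; apply/negP => om0; have [r /andP[r0 _]] := H 1 ltr01.
  apply/negP; rewrite -leNgt; apply: (@le_trans _ _ 0%E); last by rewrite lee_fin ltW.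
  apply: mule_ge0_le0 => //; rewrite lee_fin invr_le0.
  by rewrite mulr_le0_ge0// powR_ge0.
pose S := \sum_i `|tnth x i| + (l * omega s)^-1.
have lo : 0 < l * omega s by exact: mulr_gt0.
have S0 : 0 <= \sum_i `|tnth x i| by exact: sumr_ge0.
have mS : S < (Num.truncn S).+1%:R by exact: truncnS_gt.
have lo1 : 0 < (l * omega s)^-1 by rewrite invr_gt0.
exists (Num.truncn S) => j _; split=> [i|].
  apply: le_lt_trans mS; rewrite /S (bigD1 i)//= -addrA lerDl addr_ge0 ?(ltW lo1)//.
  exact: sumr_ge0.
have j0 : 0 < j.+1%:R^-1 :> R by rewrite invr_gt0.
have [r /andP[r0 rj] Hr] := H _ j0; exists r; first by rewrite r0.
have rs : 0 < r `^ s by exact: powR_gt0.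
have os : 0 < omega s * r `^ s by exact: mulr_gt0.
apply: (@lt_le_trans _ _ (mu (cball x r))); last first.
  apply: le_measure; rewrite ?inE//; [exact: measurable_cball|exact: measurable_cube|exact: cball_cube].
move: Hr; rewrite lte_pdivlMr// -EFinM => /(le_lt_trans _); apply.
rewrite lee_fin mulrA ler_pM2r//.
rewrite -[leRHS]invrK lef_pV2 ?posrE ?invr_gt0 ?ltr0n//.
by apply: ltW; apply: le_lt_trans mS; rewrite lerDr.
Qed.

(** A point of positive density outside the constructed set lies in some [thick_limsup] but misses
    one of the countably many [limit_tests], hence falls into a countable union of negligible
    sets. *)
Lemma thin_support (w K : R) : (0 < d)%N -> 0 < w -> w < 1 -> 0 < K -> locally_finite mu ->
  (forall (e : 'I_d -> R) k x a b, e k != 0 ->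
    (forall i : 'I_d, (k < i)%N -> e i = 0) -> 0 < a -> 0 < b ->
    (mu (tube e k x a b) <= (K * (d%:R ^+ d * (`|e k| * a * b ^+ d.-1)) `^ w)%:E)%E) ->
  {ae mu, forall x, (0 < upper_density mu (d%:R * w) x < +oo)%E} ->
  exists E : set (d.-tuple R), purely_unrectifiable1 E /\ mu.-negligible (~` E).
Proof.
move=> d0 w0 w1 K0 lf tube_bound dens.
have s0 : 0 < d%:R * w by rewrite mulr_gt0 ?ltr0n.
have boxfin B : (mu (box d B) < +oo)%E by apply: box_fin => //; exact: measurable_box.
have H (p : nat * nat) : exists t : R * R * R,
    [/\ 0 < t.1.1, 0 < t.1.2 & forall B (e : 'I_d -> R) k, 1 <= p.2%:R :> R ->
    (forall i, `|e i| <= p.2%:R) -> p.2%:R^-1 <= `|e k| -> (forall i : 'I_d, (k < i)%N -> e i = 0) ->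
    exists F : nat -> d.-tuple R -> R, (forall n, test_class e t.1.1 t.2 (2^-1 ^+ n) (F n)) /\
      mu.-negligible (thick_limsup mu (d%:R * w) p.1.+1%:R^-1 B `\` \bigcup_j \bigcap_(n in [set n | (j <= n)%N])
        [set x | t.1.2 <= F n x])].
  (* The triple [(1, 1, 1)] is a default for [M = 0], where no direction is admissible. *)
  have [M1|M1] := pselect (1 <= p.2%:R :> R); last by exists (1, 1, 1); split=> // B e k /M1.
  have c0 : 0 < p.1.+1%:R^-1 :> R by rewrite invr_gt0.
  have [al [ka [Bc [al0 ka0 HF]]]] := directional_tests d0 w0 w1 K0 boxfin tube_bound c0 M1.
  by exists (al, ka, Bc); split=> // B e k _; exact: HF.
have {H} [t Ht] := choice H.
pose dir (q : {ffun 'I_d -> rat}) i : R := ratr (q i).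
have H (p : nat * nat * {ffun 'I_d -> rat} * 'I_d) : exists F : nat -> d.-tuple R -> R,
    let: (m, M, q, k) := p in @admissible R d M q k ->
    (forall n, test_class (dir q) (t (m, M)).1.1 (t (m, M)).2 (2^-1 ^+ n) (F n)) /\
      mu.-negligible (thick_limsup mu (d%:R * w) m.+1%:R^-1 m.+1%:R `\` \bigcup_j \bigcap_(n in [set n | (j <= n)%N])
        [set x | (t (m, M)).1.2 <= F n x]).
  move: p => [[[m M] q] k].
  have [adm|] := pselect (@admissible R d M q k); last by exists (fun _ _ => 0).
  have [M1 qM qk qk0] := adm; have [_ _ HF] := Ht (m, M).
  by have [F HF'] := HF m.+1%:R (dir q) k M1 qM qk qk0; exists F.
have {H} [F HF] := choice H.
pose FF m M q k := F (m, M, q, k).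
have U := @limit_tests_unrectifiable R d (fun m M => (t (m, M)).1.1) (fun m M => (t (m, M)).1.2)
  (fun m M => (t (m, M)).2) FF _ _ _.
eexists; split.
  apply: U.
  - by move=> m M; have [] := Ht (m, M).
  - by move=> m M; have [] := Ht (m, M).
  - by move=> m M q k adm; have [] := HF (m, M, q, k) adm.
move: dens => [N [mN N0 HN]].
pose P : set (nat * nat * {ffun 'I_d -> rat} * 'I_d) := [set p | let: (m, M, q, k) := p in @admissible R d M q k].
pose bad (p : nat * nat * {ffun 'I_d -> rat} * 'I_d) := let: (m, M, q, k) := p in
  thick_limsup mu (d%:R * w) m.+1%:R^-1 m.+1%:R `\`
   limit_tests (fun m M => (t (m, M)).1.2) FF m M q k.
have badneg : mu.-negligible (\bigcup_(p in P) bad p).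
  apply: negligible_bigcup_count => -[[[m M] q] k] adm.
  by have [_] := HF (m, M, q, k) adm.
have Nneg : mu.-negligible N by exists N; split.
apply: negligibleS (negligibleU Nneg badneg) => x /= nE.
have [Nx|Nx] := pselect (N x); [by left|right].
have /andP[dx _] : (0 < upper_density mu (d%:R * w) x < +oo)%E by apply: contrapT => H; apply: Nx; exact: HN.
have [m mx] := density_thick dx.
apply: contrapT => nbad; apply: nE; exists m => // -[[M q] k] /= adm.
apply: contrapT => nlim; apply: nbad; exists (m, M, q, k) => //; split=> //.
Qed.

End assembly.

(** * Density exponent at least d *)

Lemma lebd_cube (R : realType) n (c : n.-tuple R) r : 0 <= r ->
  lebd (cube c r) = ((2 * r) ^+ n)%:E.
Proof.
move=> r0; rewrite /lebd; elim: n c => [|n IH] c.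
  by rewrite /= indicE mem_set ?expr0// => -[].
pose c' := [tuple tnth c (lift ord0 i) | i < n].
pose J : set R := `[(tnth c ord0 - r), (tnth c ord0 + r)]%classic.
have JE : lebesgue_measure (J : set (measurableTypeR R)) = (2 * r)%:E.
  rewrite lebesgue_measure_itv/= lte_fin; case: ltgtP => [_|H|/eqP H].
  - by rewrite -EFinD; congr EFin; ring.
  - by exfalso; lra.
  - by congr EFin; move/eqP: H; lra.
have indE (x : R) (t : n.-tuple R) : \1_(cube c r) [tuple of x :: t] = \1_J x * \1_(cube c' r) t :> R.
  rewrite !indicE; have [xJ|xJ] := pselect (J x); last first.
    rewrite [x \in J]memNset// mul0r memNset// => /(_ ord0); rewrite tnth0 => H; apply: xJ.
    by rewrite /J /= in_itv/=; move: H; rewrite ler_norml => /andP[? ?]; apply/andP; split; lra.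
  rewrite [x \in J]mem_set// mul1r; congr (_%:R); congr (nat_of_bool _).
  apply/idP/idP => /set_mem H; apply/mem_set => i.
    by have := H (lift ord0 i); rewrite tnthS tnth_mktuple.
  case: (unliftP ord0 i) => [j ->|->]; first by have := H j; rewrite tnthS tnth_mktuple.
  by move: xJ; rewrite /J /= in_itv/= tnth0 ler_norml => /andP[? ?]; apply/andP; split; lra.
rewrite /=; transitivity (\int[@lebesgue_measure R]_x (((2 * r) ^+ n)%:E * (\1_J x)%:E))%E.
  apply: eq_integral => x _; rewrite muleC -(IH c') -lebintZ//.
  - by congr lebint; apply/funext => t; rewrite indE.
  - by apply/measurable_EFinP; apply: measurable_indic; exact: measurable_cube.
rewrite integralZl//; last first.
  by apply: integrable_indic_itv.
rewrite integral_indic//; last exact: measurable_itv.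
rewrite setIT; transitivity (((2 * r) ^+ n)%:E * (2 * r)%:E)%E; first by congr (_ * _)%E; exact: JE.
by rewrite -EFinM exprSr.
Qed.

(** * Regularity of finite Borel measures *)

Section regularity.
Context {R : realType} {d : nat}.
Variable nu : {measure set (d.-tuple R) -> \bar R}.
Hypothesis nufin : (nu setT < +oo)%E.

(** A symmetric form of regularity: [U] approximates [A] from outside, and the complement of [F]
    from inside. Complementation just swaps [U] and [F], which suits the proof that regular sets
    form a sigma-algebra. *)
Definition regular_set (A : set (d.-tuple R)) := measurable A /\
  forall eps : R, 0 < eps -> exists U F, [/\ cube_open U, cube_open F,
    A `<=` U, ~` A `<=` F & (nu (U `&` F) < eps%:E)%E].

Let fin A : measurable A -> (nu A < +oo)%E.
Proof. by move=> mA; apply: le_lt_trans nufin; apply: le_measure; rewrite ?inE. Qed.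

Lemma cube_openI (U F : set (d.-tuple R)) : cube_open U -> cube_open F -> cube_open (U `&` F).
Proof.
move=> oU oF x [Ux Fx]; have [r r0 rU] := oU x Ux; have [s s0 sF] := oF x Fx.
exists (Num.min r s); first by rewrite lt_min r0.
by move=> y xy; split; [apply: rU|apply: sF]; apply: cubeS xy; rewrite ge_min lexx ?orbT.
Qed.

Lemma cube_open_bigcup (U : nat -> set (d.-tuple R)) :
  (forall n, cube_open (U n)) -> cube_open (\bigcup_n U n).
Proof.
move=> oU x [n _ Ux]; have [r r0 rU] := oU n x Ux.
by exists r => // y xy; exists n => //; exact: rU.
Qed.

Lemma regular_setC A : regular_set A -> regular_set (~` A).
Proof.
move=> [mA H]; split; first exact: measurableC.
move=> eps e0; have [U [F [oU oF AU AF H']]] := H eps e0.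
by exists F, U; split => //; rewrite ?setCK// setIC.
Qed.

Lemma regular_set0 : regular_set set0.
Proof.
split=> // eps e0; exists set0, setT; split=> //.
- by move=> x _; exists 1.
- by rewrite set0I measure0.
Qed.

(** To stay open, [F] must be a finite intersection. The infinite one would meet [U] only inside the
    union of the overlaps [W n]; continuity from above gives an [N] for which this holds up to
    [eps / 2]. *)
Lemma regular_bigcup (A : nat -> set (d.-tuple R)) :
  (forall n, regular_set (A n)) -> regular_set (\bigcup_n A n).
Proof.
move=> HA; split; first by apply: bigcup_measurable => n _; have [] := HA n.
move=> eps e0; have e20 : 0 < eps / 2 by exact: divr_gt0.
have H n : exists UF : set (d.-tuple R) * set (d.-tuple R), [/\ cube_open UF.1, cube_open UF.2,
    A n `<=` UF.1, ~` A n `<=` UF.2 & (nu (UF.1 `&` UF.2) <= (eps / 2 / (2 ^ n.+1)%:R)%:E)%E].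
  have [_ /(_ _ (divr_gt0 e20 (pow2_gt0 n)))[U [F [oU oF AU AF /ltW HUF]]]] := HA n.
  by exists (U, F).
have {H} [UF HUF] := choice H.
pose U := \bigcup_n (UF n).1.
pose F (N : nat) := \bigcap_(n in [set n | (n < N)%N]) (UF n).2.
have oU : cube_open U by apply: cube_open_bigcup => n; have [] := HUF n.
have oF N : cube_open (F N).
  elim: N => [|N IH]; first by move=> x _; exists 1.
  have -> : F N.+1 = F N `&` (UF N).2.
    apply/seteqP; split => x Hx; first by split=> [n nN|]; [apply: Hx; exact: ltnW|exact: (Hx N (ltnSn N))].
    move=> n; rewrite /= ltnS leq_eqVlt => /orP[/eqP->|nN]; first exact: Hx.2.
    exact: (Hx.1 n nN).
  by apply: cube_openI => //; have [] := HUF N.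
pose W n := (UF n).1 `&` (UF n).2.
have mW n : measurable (W n).
  by apply: measurable_cube_open; apply: cube_openI; have [] := HUF n.
have W2 : (nu (\bigcup_n W n) <= (eps / 2)%:E)%E.
  apply: (@le_trans _ _ (\sum_(n <oo) nu (W n))%E).
    apply: measure_sigma_subadditive => //; exact: bigcup_measurable.
  apply: le_trans (epsilon_trick0 xpredT (ltW e20)); apply: lee_nneseries => n _ //.
  by have [] := HUF n.
have mG N : measurable (U `&` F N) by apply: measurable_cube_open; exact: cube_openI.
have mG' N : measurable (U `&` F N `\` \bigcup_n W n).
  by apply: measurableD => //; exact: bigcup_measurable.
have [N HN] : exists N, (nu (U `&` F N `\` \bigcup_n W n) < (eps / 2)%:E)%E.
  apply: small_measure => //.
  - exact: fin.
  - move=> N; apply: setSD; apply: setIS => x Hx n nN; apply: Hx; exact: ltnW.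
  - apply/seteqP; split=> // x Hx; have [[[n _ Un] _] _] := Hx 0%N Logic.I.
    have [[_ Fn] nW] := Hx n.+1 Logic.I; apply: nW; exists n => //; split=> //.
    by apply: Fn => /=.
exists U, (F N); split=> //.
- by move=> x [n _ An]; exists n => //; have [_ _ + _ _] := HUF n; exact.
- move=> x nA n _; have [_ _ _ + _] := HUF n; apply=> An; apply: nA.
  by exists n.
have sub : U `&` F N `<=` (U `&` F N `\` \bigcup_n W n) `|` \bigcup_n W n.
  by move=> x Hx; have [Wx|nWx] := pselect ((\bigcup_n W n) x); [right|left].
have mWW : measurable (\bigcup_n W n) by exact: bigcup_measurable.
apply: (@le_lt_trans _ _ (nu ((U `&` F N `\` \bigcup_n W n) `|` \bigcup_n W n))).
  by apply: le_measure; rewrite ?inE//; exact: measurableU.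
rewrite (le_lt_trans (measureU2 _ _ _))//.
rewrite [eps]splitr EFinD; apply: lte_leD => //.
by rewrite ge0_fin_numE//; exact: fin.
Qed.

Lemma regular_halfspace i a : regular_set [set x | a < tnth x i].
Proof.
have oU b : cube_open [set x : d.-tuple R | b < tnth x i].
  move=> x /= bx; exists ((tnth x i - b) / 2); first by rewrite divr_gt0// subr_gt0.
  by move=> y /(_ i); rewrite ler_norml /= => /andP[? ?]; lra.
have oF b : cube_open [set x : d.-tuple R | tnth x i < b].
  move=> x /= bx; exists ((b - tnth x i) / 2); first by rewrite divr_gt0// subr_gt0.
  by move=> y /(_ i); rewrite ler_norml /= => /andP[? ?]; lra.
split; first exact: measurable_cube_open.
move=> eps e0.
pose G (n : nat) : set (d.-tuple R) := [set x | a < tnth x i] `&` [set x | tnth x i < a + n.+1%:R^-1].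
have [N HN] : exists N, (nu (G N) < eps%:E)%E.
  have mG n : measurable (G n) by apply: measurable_cube_open; exact: cube_openI.
  apply: small_measure => //.
  - exact: fin.
  - move=> n; apply: setIS => x /= /lt_le_trans; apply.
    by rewrite lerD2l lef_pV2 ?posrE ?ltr0n// ler_nat.
  - apply/seteqP; split=> // x Hx; have [/= ax _] := Hx 0%N Logic.I.
    have [_ /=] := Hx (Num.truncn (tnth x i - a)^-1) Logic.I.
    apply/negP; rewrite -leNgt -lerBrDl -[leRHS]invrK lef_pV2 ?posrE ?invr_gt0 ?subr_gt0 ?ltr0n//.
    by rewrite ltW// truncnS_gt.
exists [set x | a < tnth x i], [set x | tnth x i < a + N.+1%:R^-1]; split=> // x /= /negP.
rewrite -leNgt => /le_lt_trans; apply.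
by rewrite ltrDl invr_gt0.
Qed.

Lemma measurable_regular A : measurable A -> regular_set A.
Proof.
have sreg : sigma_algebra setT regular_set.
  split; [exact: regular_set0|by move=> B; rewrite setTD; exact: regular_setC|exact: regular_bigcup].
apply: smallest_sub => //.
elim/big_ind: _ => // [S S' HS HS' B [|]|i _ _ [B mB <-]]; [exact: HS|exact: HS'|].
rewrite setTI.
have {mB} : (<<s @RGenOInfty.G R>>)%classic B.
  have -> : (<<s @RGenOInfty.G R>>)%classic = (@RGenOInfty.G R).-sigma.-measurable by [].
  by rewrite -RGenOInfty.measurableE; exact: mB.
move: B; apply: smallest_sub.
  split.
  - by rewrite preimage_set0; exact: regular_set0.
  - by move=> B HB; rewrite setTD preimage_setC; exact: regular_setC.
  - by move=> B HB; rewrite preimage_bigcup; exact: regular_bigcup.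
move=> _ [a ->]; have := regular_halfspace i a; congr regular_set.
by apply/seteqP; split => x /=; rewrite in_itv/= andbT.
Qed.

End regularity.

Section high_density.
Context {R : realType} {d : nat}.
Variables (mu m : {measure set (d.-tuple R) -> \bar R}) (K s : R).
Hypotheses (K0 : 0 <= K) (ds : d%:R <= s).
Hypothesis mu_cube : forall x r, 0 < r -> (mu (cube x r) <= (K * r `^ s)%:E)%E.
Hypothesis m_lebd : forall A, measurable A -> lebd A = m A.
Hypothesis m_box : forall k, (m (box d k) < +oo)%E.

(** For a selected radius [r <= rho0] the tripled cube has [mu]-mass at most
    [K * 3^s * rho0^(s - d) * r^d], and [r^d] is at most the Lebesgue measure of the cube; the
    selected cubes are disjoint inside [U]. *)
Lemma cube_cover_mass (A U : set (d.-tuple R)) rho0 : 0 < rho0 ->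
  measurable A -> measurable U -> (m U < +oo)%E ->
  (forall x, A x -> exists2 r, 0 < r & cube x r `<=` U) ->
  (mu A <= (K * 3 `^ s * rho0 `^ (s - d%:R) * fine (m U))%:E)%E.
Proof.
move=> r0 mA mU Ufin AU.
have H x : exists r, A x -> 0 < r <= rho0 /\ cube x r `<=` U.
  have [Ax|nA] := pselect (A x); last by exists 0.
  have [r rp rU] := AU x Ax; exists (Num.min r rho0) => _; split.
    by rewrite lt_min rp r0 ge_min lexx orbT.
  by apply: subset_trans rU; apply: cubeS; rewrite ge_min lexx.
have {H} [rho Hrho] := choice H.
have [|xs [P [PA disj cov]]] := @vitali_cubes R d A rho rho0.
  by move=> x /Hrho[].
pose G n := if P n then cube (xs n) (3 * rho (xs n)) else set0.
have mG n : measurable (G n).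
  by rewrite /G; case: ifP => _; [exact: measurable_cube|exact: measurable0].
apply: (@le_trans _ _ (\sum_(n <oo) mu (G n))%E).
  apply: measure_sigma_subadditive => // x /cov[n /= Pn xn].
  by exists n => //; rewrite /G Pn.
apply: lime_le; first by apply: is_cvg_nneseries => n _ _; exact: measure_ge0.
near=> N; rewrite big_mkord.
pose c := K * 3 `^ s * rho0 `^ (s - d%:R).
have c0 : 0 <= c by rewrite !mulr_ge0 ?powR_ge0.
apply: (@le_trans _ _ (\sum_(n < N) (if P n then c * fine (m (cube (xs n) (rho (xs n)))) else 0)%:E)%E).
  apply: lee_sum => n _; rewrite /G; case: ifPn => Pn; last by rewrite measure0.
  have [/andP[rp rr] _] := Hrho _ (PA _ Pn).
  have r3 : 0 < 3 * rho (xs n) by exact: mulr_gt0.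
  apply: le_trans (mu_cube _ r3) _.
  rewrite -m_lebd; last exact: measurable_cube.
  rewrite lebd_cube ?(ltW rp)//= lee_fin powRM ?(ltW rp)// /c.
  rewrite -!mulrA ler_wpM2l// ler_wpM2l ?powR_ge0//.
  have -> : rho (xs n) `^ s = rho (xs n) `^ (s - d%:R) * rho (xs n) `^ d%:R.
    by rewrite -powRD ?subrK//; apply/implyP => _; rewrite gt_eqF.
  apply: ler_pM; rewrite ?powR_ge0//.
    by apply: ge0_ler_powR; rewrite ?nnegrE ?subr_ge0 ?(ltW rp) ?(ltW r0).
  rewrite powR_mulrn ?(ltW rp)//; apply: lerXn2r; rewrite ?nnegrE ?mulr_ge0 ?(ltW rp)//.
  by lra.
rewrite sumEFin lee_fin -big_mkcond/= -mulr_sumr ler_wpM2l//.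
apply: (@disjoint_mass _ _ _ m N P (fun n => cube (xs n) (rho (xs n))) U) => //.
- by move=> n; exact: measurable_cube.
- by move=> n Pn; have [_] := Hrho _ (PA _ Pn).
Unshelve. all: by end_near. Qed.

Lemma box_nbhd k x : box d k x -> exists2 r : R, 0 < r & cube x r `<=` box d (k + 1).
Proof.
move=> xk; exists 1 => // y xy i.
have := ler_normD (tnth y i - tnth x i) (tnth x i); rewrite subrK.
have := xy i; have := xk i; lra.
Qed.

Lemma mu_zero : d%:R < s -> mu setT = 0%E.
Proof.
move=> ds'; rewrite -(box_cover d).
apply/eqP; rewrite -measure_le0; apply: (@le_trans _ _ (\sum_(k <oo) mu (box d k%:R))%E).
  apply: measure_sigma_subadditive => // [k|]; first exact: measurable_box.
  by apply: bigcup_measurable => k _; exact: measurable_box.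
rewrite eseries0// => k _ _; apply/eqP; rewrite -measure_le0.
apply/lee_addgt0Pr => eps e0; rewrite add0e.
pose C := K * 3 `^ s * fine (m (box d (k%:R + 1))).
have C0 : 0 <= C by rewrite !mulr_ge0 ?powR_ge0 ?fine_ge0.
have sd : 0 < s - d%:R by rewrite subr_gt0.
have eC : 0 < eps / (C + 1) by rewrite divr_gt0// ltr_wpDl.
(* Makes the factor [rho0^(s - d)] equal to [eps / (C + 1)]; this is where the strict inequality
   [d < s] counts. *)
pose rho0 := (eps / (C + 1)) `^ (s - d%:R)^-1.
have r0 : 0 < rho0 by exact: powR_gt0.
apply: le_trans (cube_cover_mass r0 (measurable_box _) (measurable_box (k%:R + 1)) (m_box _) (@box_nbhd _)) _.
rewrite lee_fin mulrAC -/C /rho0 -powRrM mulVf ?gt_eqF// powRr1 ?(ltW eC)//.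
by rewrite mulrA ler_pdivrMr ?ltr_wpDl// mulrC ler_pM2l// lerDl.
Qed.

(** A bounded part of a null set has open neighbourhoods of small measure, by regularity of Lebesgue
    measure restricted to a larger box; covering inside such a neighbourhood with radii at most [1]
    gives small [mu]-mass. *)
Lemma mu_abs_cont : abs_cont_leb mu.
Proof.
move=> A mA; rewrite m_lebd// => A0.
have Ak k : mu (A `&` box d k%:R) = 0%E.
  pose D : set (d.-tuple R) := box d (k%:R + 1); have mD : measurable D := measurable_box _.
  pose nu := mrestr m mD.
  have nufin : (nu setT < +oo)%E by rewrite /nu /mrestr setTI; exact: m_box.
  have mAk : measurable (A `&` box d k%:R) by apply: measurableI => //; exact: measurable_box.
  have [_ reg] := @measurable_regular R d (mrestr m mD) nufin _ mAk.
  apply/eqP; rewrite -measure_le0; apply/lee_addgt0Pr => eps e0; rewrite add0e.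
  pose c := K * 3 `^ s * 1 `^ (s - d%:R).
  have c0 : 0 <= c by rewrite !mulr_ge0 ?powR_ge0.
  have ec : 0 < eps / (c + 1) by rewrite divr_gt0// ltr_wpDl.
  have [U [F [oU oF AU AF HUF]]] := reg _ ec.
  have mU := measurable_cube_open oU; have mF := measurable_cube_open oF.
  have UDle : (m (U `&` D) <= (eps / (c + 1))%:E)%E.
    apply: (@le_trans _ _ (m (A `&` D) + m ((U `&` F) `&` D))%E); last first.
      have -> : m (A `&` D) = 0%E.
        by apply: (@subset_measure0 _ _ _ m _ A) => //; exact: measurableI.
      by rewrite add0e; exact: ltW.
    apply: (@le_trans _ _ (m ((A `&` D) `|` ((U `&` F) `&` D)))).
      apply: le_measure; rewrite ?inE.
      + exact: measurableI.
      + by apply: measurableU; apply: measurableI => //; exact: measurableI.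
      move=> x [Ux Dx]; have [Ax|nA] := pselect (A x); first by left.
      by right; split=> //; split=> //; apply: AF => -[].
    by apply: measureU2; apply: measurableI => //; exact: measurableI.
  have := @cube_cover_mass (A `&` box d k%:R) (U `&` D) 1 ltr01 mAk (measurableI _ _ mU mD).
  rewrite -/c => H; apply: le_trans (H _ _) _.
  - by apply: le_lt_trans UDle _; rewrite ltry.
  - move=> x Ax; have [r rp rU] := oU x (AU x Ax); have [r' rp' rD] := box_nbhd Ax.2.
    exists (Num.min r r'); first by rewrite lt_min rp.
    by move=> y xy; split; [apply: rU|apply: rD]; apply: cubeS xy; rewrite ge_min lexx ?orbT.
  rewrite lee_fin; apply: (@le_trans _ _ (c * (eps / (c + 1)))).
    by rewrite ler_wpM2l//; apply: fine_le_r.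
  by rewrite mulrA ler_pdivrMr ?ltr_wpDl// mulrC ler_pM2l// lerDl.
have -> : A = \bigcup_k (A `&` box d k%:R) by rewrite -setI_bigcupr box_cover setIT.
apply/eqP; rewrite -measure_le0; apply: (@le_trans _ _ (\sum_(k <oo) mu (A `&` box d k%:R))%E).
  have mAk k : measurable (A `&` box d k%:R) by apply: measurableI => //; exact: measurable_box.
  by apply: measure_sigma_subadditive => //; exact: bigcup_measurable.
by rewrite eseries0// => k _ _; exact: Ak.
Qed.

End high_density.

Section degenerate.
Context {R : realType} {d : nat}.

Lemma pderivs0 l : pderivs l (fun _ : d.-tuple R => 0 : R) = fun=> 0.
Proof.
elim: l => //= i l ->; apply/funext => x; rewrite /pderiv.
exact: derive1_cst.
Qed.

Lemma schwartz0 : schwartz (fun _ : d.-tuple R => 0 : R[i]).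
Proof.
have H : schwartzR (fun _ : d.-tuple R => 0 : R).
  split=> [l i x|a b]; first by rewrite pderivs0; exact: derivable_cst.
  by exists 0 => x; rewrite pderivs0 mulr0 normr0.
by split.
Qed.

(** The formula for the norm degenerates at exponent zero: [0^-1 = 0] and a zeroth power is [1], so
    the norm of the zero transform is [1] while the right-hand side is [0]. *)
Lemma restriction_q0 (mu : {measure set (d.-tuple R) -> \bar R}) p :
  0 < p -> ~ restriction mu p 0.
Proof.
move=> p0 [C /(_ _ schwartz0)].
have -> : LpnormRd p (fun _ : d.-tuple R => 0 : R[i]) = 0%E.
  rewrite /LpnormRd; have -> : (fun x : d.-tuple R => (cmod (0 : R[i]) `^ p)%:E) = fun=> 0%E.
    apply/funext => x; rewrite /cmod /= expr0n/= addr0 sqrtr0 powR0 ?gt_eqF//.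
  have [m [_ mE]] := @lebint_integral R d.
  by rewrite mE// integral0 poweR0r// gt_eqF// invr_gt0.
rewrite mule0 unlock /= invr0 poweRe0 lee_fin ler10.
by [].
Qed.

End degenerate.

Theorem mainTheorem1 (R : realType) (d : nat)
    (mu : {measure set (d.-tuple R) -> \bar R}) (s p q : R) :
  locally_finite mu ->
  0 <= s ->
  {ae mu, forall x, (0 < upper_density mu s x < +oo)%E} ->
  1 < p ->
  q = s / d%:R * (p / (p - 1)) ->
  restriction mu p q ->
  (q = p / (p - 1) /\ abs_cont_leb mu) \/
  (exists E : set (d.-tuple R),
     purely_unrectifiable1 E /\ mu.-negligible (~` E)).
Proof.
move=> lf s0 dens p1 qE res.
have p0 : 0 < p by exact: lt_trans p1.
have p10 : 0 < p - 1 by rewrite subr_gt0.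
(* This disposes of [s = 0], and of [d = 0], where division by zero gives [q = 0]. *)
have [q0|q0] := eqVneq q 0; first by case: (restriction_q0 p0 (mu := mu)); rewrite -q0.
have d0 : (0 < d)%N.
  by rewrite lt0n; apply: contra_neq q0 => d0; rewrite qE d0 invr0 mulr0 mul0r.
have dR : 0 < d%:R :> R by rewrite ltr0n.
have s_gt0 : 0 < s.
  by rewrite lt_def s0 andbT; apply: contra_neq q0 => s00; rewrite qE s00 !mul0r.
have q_gt0 : 0 < q by rewrite qE mulr_gt0// divr_gt0.
pose w := s / d%:R.
have w0 : 0 < w by exact: divr_gt0.
(* Here the endpoint relation turns the exponent of the Gaussian test into [s / d]. *)
have wE : q * (1 - p^-1) = w.
  by rewrite qE -/w; field; rewrite !gt_eqF.
have dw : d%:R * w = s by rewrite /w mulrC divfK// gt_eqF.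
have [K K0 HK] := restriction_gauss_box p0 q_gt0 res.
rewrite wE in HK.
have K1 : 0 < K + 1 by rewrite ltr_wpDl.
have tube_bound := @gauss_box_tube R d mu (K + 1) w.
have {}tube_bound := tube_bound _.
have HK1 : forall (A : 'M[R]_d) (xi0 : d.-tuple R) S,
    (forall i j : 'I_d, (i < j)%N -> A i j = 0) -> (forall i, A i i != 0) ->
    measurable S ->
    (forall xi, S xi -> forall x, (dotp x xi0 - dotp x xi) ^+ 2 <= qform A x) ->
    (mu S <= ((K + 1) * (\prod_i `|A i i|) `^ w)%:E)%E.
  move=> A xi0 S A1 A2 mS AS; apply: le_trans (HK A xi0 S A1 A2 mS AS) _.
  by rewrite lee_fin ler_wpM2r ?powR_ge0// lerDl.
have {}tube_bound := tube_bound HK1.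
have [sd|ds] := ltP s d%:R.
  right; apply: (thin_support d0 w0 _ K1 lf tube_bound); last by rewrite dw.
  by rewrite /w ltr_pdivrMr// mul1r.
have [m [m_box mE]] := @lebint_integral R d.
have m_lebd A : measurable A -> lebd A = m A.
  move=> mA; rewrite /lebd mE//.
    by rewrite integral_indic// setIT.
  by apply/measurable_EFinP; exact: measurable_indic.
pose K' := (K + 1) * (d%:R ^+ d) `^ w.
have K'0 : 0 <= K' by rewrite mulr_ge0 ?powR_ge0// ltW.
have mu_cube x r : 0 < r -> (mu (cube x r) <= (K' * r `^ s)%:E)%E.
  by move=> r0; rewrite -dw; exact: (cube_bound d0 tube_bound).
have [sd|sd] := eqVneq s d%:R.
  left; split; first by rewrite qE sd divff ?mul1r// gt_eqF.
  exact: (mu_abs_cont K'0 ds mu_cube m_lebd m_box).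
(* What remains is [s > d], where [mu] vanishes and is supported on the empty set. *)
right; exists set0; split.
  move=> phi _; rewrite set0I; apply: small_covers_H1 => eps e0.
  exists (fun=> set0); split=> //.
  have -> : diam (set0 : set (d.-tuple R)) = 0%E.
    by apply/eqP; rewrite eq_le diam_ge0 andbT; apply: diam_le.
  by rewrite eseries0// lee_fin ltW.
rewrite setC0; exists setT; split=> //.
by apply: (mu_zero K'0 ds mu_cube m_lebd m_box); rewrite lt_def sd.
Qed.
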